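(* Let Hypothesis A hold. For every $\varepsilon>0$ the problem of finding $(\phi',\bar\phi)\in\mathcal V\times\mathcal W$ such that $$\text{(S)}\quad\begin{cases} a_2(\bar\phi,\bar\psi)=(\bar f,\bar\psi)-\frac1{L_z}c(\phi',\bar\psi) & \forall\,\bar\psi\in\mathcal W,\\[1mm] a(\phi',\psi')=\varepsilon(f',\psi')-\varepsilon c(\psi',\bar\phi) & \forall\,\psi'\in\mathcal V,\end{cases}$$ admits a unique solution $(\phi'_\varepsilon,\bar\phi_\varepsilon)\in\mathcal V\times\mathcal W$, and $\phi_\varepsilon:=\phi'_\varepsilon+\bar\phi_\varepsilon$ is the unique (weak) solution in $\mathcal V$ of the Singular Perturbation model $$-\frac{\partial}{\partial x}\Big(A_\perp\frac{\partial\phi}{\partial x}\Big)-\frac1\varepsilon\frac{\partial}{\partial z}\Big(A_z\frac{\partial\phi}{\partial z}\Big)=f\ \text{ in }\Omega,\qquad \frac{\partial\phi}{\partial z}=0\ \text{ on }\Omega_x\times\partial\Omega_z,\qquad \phi=0\ \text{ on }\partial\Omega_x\times\Omega_z .$$ The function $\phi'_\varepsilon$ has zero mean value along the $z$-coordinate, i.e. $\overline{\phi'_\varepsilon}=0$ for every $\varepsilon>0$. Consequently, $(\phi'_\varepsilon,\bar\phi_\varepsilon)\in\mathcal V\times\mathcal W$ is the unique solution of (S) if and only if $(\phi'_\varepsilon,\bar\phi_\varepsilon,\bar P_\varepsilon)\in\mathcal V\times\mathcal W\times\mathcal W$ is a solution of the AP-formulation $$\text{(AP)}\quad\begin{cases}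 a_2(\bar\phi,\bar\psi)=(\bar f,\bar\psi)-\frac1{L_z}c(\phi',\bar\psi) & \forall\,\bar\psi\in\mathcal W,\\[1mm] a(\phi',\psi')+b(\bar P,\psi')=\varepsilon(f',\psi')-\varepsilon c(\psi',\bar\phi) & \forall\,\psi'\in\mathcal V,\\[1mm] b(\bar Q,\phi')=0 & \forall\,\bar Q\in\mathcal W,\end{cases}$$ and in this last case $\bar P_\varepsilon=0$. Finally, for $0<\varepsilon<1$ these solutions satisfy the bounds $$\|\phi_\varepsilon\|_{H^1(\Omega)}\le C\|f\|_{L^2(\Omega)},\qquad \|\phi'_\varepsilon\|_{H^1(\Omega)}\le C\|f\|_{L^2(\Omega)},\qquad \|\bar\phi_\varepsilon\|_{H^1(\Omega_x)}\le C\|f\|_{L^2(\Omega)},$$ with a constant $C>0$ independent of $\varepsilon$. In the limit $\varepsilon\to0$ there exist functions $(\phi'_0,\bar\phi_0)\in\mathcal V\times\mathcal W$ such that one has the weak convergences $$\phi'_\varepsilon\rightharpoonup\phi'_0\ \text{ in }H^1(\Omega),\qquad \bar\phi_\varepsilon\rightharpoonup\bar\phi_0\ \text{ in }H^1(\Omega_x),$$ and the strong convergences $$\phi'_\varepsilon\to\phi'_0\ \text{ in }L^2(\Omega),\qquad \partial_z\phi'_\varepsilon\to\partial_z\phi'_0\ \text{ in }L^2(\Omega),\qquad \bar\phi_\varepsilon\to\bar\phi_0\ \text{ in }L^2(\Omega_x),$$ where $\phi'_0\equiv0$ and $\bar\phi_0$ is the unique (weak) solution in $\mathcal W$ of the Limit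 model $$-\frac{\partial}{\partial x}\Big(\bar A_\perp\frac{\partial\bar\phi}{\partial x}\Big)=\bar f\ \text{ in }\Omega_x,\qquad \bar\phi=0\ \text{ on }\partial\Omega_x .$$
   Context: Let $L_x,L_z>0$, $\Omega_x=(0,L_x)$, $\Omega_z=(0,L_z)$, $\Omega=\Omega_x\times\Omega_z$, with points $(x,z)$. For a function $u(x,z)$ on $\Omega$ write $\bar u(x)=\frac1{L_z}\int_0^{L_z}u(x,z)\,dz$ (mean along $z$) and $u'(x,z)=u(x,z)-\bar u(x)$ (fluctuation; the prime is not a derivative). Unknowns and test functions named $\phi',\psi'$ are general elements of the space indicated, not assumed a priori to have zero mean; likewise $\bar\phi,\bar\psi,\bar P,\bar Q$ denote functions of $x$ only. Hypothesis A: $A_\perp,A_z\in L^\infty(\Omega)$ satisfy $0<c_\perp\le A_\perp(x,z)\le M_\perp$ and $0<c_z\le A_z(x,z)\le M_z$ for almost all $(x,z)\in\Omega$, with positive constants $c_\perp,c_z,M_\perp,M_z$; and $f\in L^2(\Omega)$. Spaces: $\mathcal V=\{\psi\in H^1(\Omega):\psi=0\text{ on }\partial\Omega_x\times\Omega_z\}$, $\mathcal W=\{\psi\in H^1(\Omega_x):\psi=0\text{ on }\partial\Omega_x\}$. $(\cdot,\cdot)$ denotes the $L^2$ scalar product (on $\Omega$ or $\Omega_x$ according to the arguments). Bilinear forms (with $A_\perp'=A_\perp-\bar A_\perp$): $a_0(\phi',\psi')=\int_0^{L_z}\!\int_0^{L_x}A_z\,\partial_z\phi'\,\partial_z\psi'\,dx\,dz$;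 $a_1(\phi',\psi')=\int_0^{L_z}\!\int_0^{L_x}A_\perp\,\partial_x\phi'\,\partial_x\psi'\,dx\,dz$; $a_2(\bar\phi,\bar\psi)=\int_0^{L_x}\bar A_\perp\,\partial_x\bar\phi\,\partial_x\bar\psi\,dx$; $c(\phi',\bar\psi)=\int_0^{L_z}\!\int_0^{L_x}A_\perp'(x,z)\,\partial_x\phi'(x,z)\,\partial_x\bar\psi(x)\,dx\,dz$; $d(\phi',\psi')=\frac1{L_z}\int_0^{L_x}\!\int_0^{L_z}\!\int_0^{L_z}A_\perp'(x,z)\,\partial_x\phi'(x,z)\,\partial_x\psi'(x,\zeta)\,dz\,d\zeta\,dx$; $b(\bar P,\psi')=\int_0^{L_x}\bar P(x)\int_0^{L_z}\psi'(x,z)\,dz\,dx$; $a(\phi',\psi')=a_0(\phi',\psi')+\varepsilon a_1(\phi',\psi')-\varepsilon d(\phi',\psi')$. *)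

(* Defs.v *)
From HB Require Import structures.
From mathcomp Require Import all_boot all_order all_algebra.
From mathcomp Require Import all_classical all_reals all_analysis.
Set Implicit Arguments.
Unset Strict Implicit.
Unset Printing Implicit Defensive.
Import Order.TTheory GRing.Theory Num.Theory.
Import numFieldNormedType.Exports.
Local Open Scope classical_set_scope.
Local Open Scope ring_scope.

(* A function on D is a total function whose values off D are irrelevant;
   elements of L^2 and H^1 are representatives, compared with [ae_eq]. *)

Section L2.
Context d (T : measurableType d) (R : realType).
Variables (mu : {measure set T -> \bar R}) (D : set T).

Definition L2 (u : T -> R) : Prop := u \_ D \in Lfun mu 2%:E.

Definition Linfty (u : T -> R) : Prop := u \_ D \in Lfun mu +oo%E.

Definition L2norm (u : T -> R) : R := fine ('N[mu]_2%:E[EFin \o (u \_ D)])%E.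

Definition L2prod (u v : T -> R) : R := \int[mu]_(p in D) (u p * v p).

End L2.

Section smooth.
Context (R : realType) (E : normedModType R).

(* All directional derivatives up to order n exist and are continuous; in
   finite dimension this is the usual class C^n. *)
Fixpoint Ck (n : nat) (f : E -> R) : Prop :=
  continuous f /\
  if n is m.+1
  then forall v : E, (forall p, derivable f p v) /\ Ck m ('D_v f)
  else True.

Definition smooth (f : E -> R) : Prop := forall n, Ck n f.

Definition test_fun (D : set E) (eta : E -> R) : Prop :=
  smooth eta /\
  exists K : set E, [/\ compact K, K `<=` D & forall p, ~ K p -> eta p = 0].

End smooth.

(* Weak convergence, as e tends to 0 from the right, in the space H normed
   by N: convergence against every bounded linear functional on H. *)
Definition weak_cvg0 (T : Type) (R : realType) (H : set (T -> R))
    (N : (T -> R) -> R) (u : R -> T -> R) (u0 : T -> R) : Prop :=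
  forall ell : (T -> R) -> R,
    (forall (k : R) v w, H v -> H w ->
       ell (fun x => k * v x + w x) = k * ell v + ell w) ->
    (exists K : R, forall v, H v -> `|ell v| <= K * N v) ->
    ell (u e) @[e --> 0^'+] --> ell u0.

Section interval.
Context (R : realType).
Variable (L : R).
Implicit Types (u v w : R -> R).

Definition mu1 : {measure set (measurableTypeR R) -> \bar R} :=
  @lebesgue_measure R.

Definition Itv : set R := `]0, L[%classic.

Definition weak_deriv1 u w : Prop :=
  L2 mu1 Itv w /\
  forall eta : R -> R, test_fun (E := R) Itv eta ->
    \int[mu1]_(x in Itv) (u x * 'D_1 eta x) =
    - \int[mu1]_(x in Itv) (w x * eta x).

(* Weak derivatives are unique up to null sets; one is selected. *)
Definition wd1 u : R -> R := xget (cst 0) [set w | weak_deriv1 u w].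

Definition H1_1 u : Prop := L2 mu1 Itv u /\ exists w, weak_deriv1 u w.

Definition H1norm1 u : R :=
  Num.sqrt (L2norm mu1 Itv u ^+ 2 + L2norm mu1 Itv (wd1 u) ^+ 2).

(* g is the trace of u at the end point a: the trace operator is the
   continuous extension to H^1 of the restriction of smooth functions. *)
Definition trace1 (a : R) u (g : R) : Prop :=
  exists un : nat -> R -> R,
    [/\ forall n, smooth (E := R) (un n),
        H1norm1 (fun x => un n x - u x) @[n --> \oo] --> (0 : R)
      & un n a @[n --> \oo] --> g].

Definition spaceW u : Prop := [/\ H1_1 u, trace1 0 u 0 & trace1 L u 0].

End interval.

Section rectangle.
Context (R : realType).
Variables (Lx Lz : R).
Implicit Types (u v w : R * R -> R).

Definition mu2 : {measure set (measurableTypeR R * measurableTypeR R)%type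
    -> \bar R} :=
  (@lebesgue_measure R \x @lebesgue_measure R)%E.

Definition Omega : set (R * R) := Itv Lx `*` Itv Lz.

Definition weak_deriv2 (dir : R * R) u w : Prop :=
  L2 mu2 Omega w /\
  forall eta : R * R -> R, test_fun Omega eta ->
    \int[mu2]_(p in Omega) (u p * 'D_dir eta p) =
    - \int[mu2]_(p in Omega) (w p * eta p).

Definition wdx u : R * R -> R := xget (cst 0) [set w | weak_deriv2 (1, 0) u w].
Definition wdz u : R * R -> R := xget (cst 0) [set w | weak_deriv2 (0, 1) u w].

Definition H1_2 u : Prop :=
  [/\ L2 mu2 Omega u, exists w, weak_deriv2 (1, 0) u w
    & exists w, weak_deriv2 (0, 1) u w].

Definition H1norm2 u : R :=
  Num.sqrt (L2norm mu2 Omega u ^+ 2 + L2norm mu2 Omega (wdx u) ^+ 2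
            + L2norm mu2 Omega (wdz u) ^+ 2).

(* g is the L^2 trace of u on the edge {a} x Omega_z. *)
Definition trace2 (a : R) u (g : R -> R) : Prop :=
  L2 (mu1 R) (Itv Lz) g /\
  exists un : nat -> R * R -> R,
    [/\ forall n, smooth (un n),
        H1norm2 (fun p => un n p - u p) @[n --> \oo] --> (0 : R)
      & L2norm (mu1 R) (Itv Lz) (fun z => un n (a, z) - g z) @[n --> \oo]
          --> (0 : R)].

Definition spaceV u : Prop :=
  [/\ H1_2 u, trace2 0 u (cst 0) & trace2 Lx u (cst 0)].

Definition meanz u : R -> R :=
  fun x => Lz^-1 * \int[mu1 R]_(z in Itv Lz) u (x, z).

Definition fluct u : R * R -> R := fun p => u p - meanz u p.1.

Record hypA (Aperp Az : R * R -> R) (cperp cz Mperp Mz : R) : Prop := HypA {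
  hypA_Aperp : Linfty mu2 Omega Aperp;
  hypA_Az : Linfty mu2 Omega Az;
  hypA_cperp : 0 < cperp;
  hypA_cz : 0 < cz;
  hypA_Mperp : 0 < Mperp;
  hypA_Mz : 0 < Mz;
  hypA_bound_perp :
    {ae mu2, forall p, Omega p -> cperp <= Aperp p /\ Aperp p <= Mperp};
  hypA_bound_z : {ae mu2, forall p, Omega p -> cz <= Az p /\ Az p <= Mz} }.

Variables (Aperp Az : R * R -> R).

Definition form_a0 u v : R :=
  \int[mu2]_(p in Omega) (Az p * wdz u p * wdz v p).

Definition form_a1 u v : R :=
  \int[mu2]_(p in Omega) (Aperp p * wdx u p * wdx v p).

Definition form_a2 (u v : R -> R) : R :=
  \int[mu1 R]_(x in Itv Lx) (meanz Aperp x * wd1 Lx u x * wd1 Lx v x).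

Definition form_c u (v : R -> R) : R :=
  \int[mu2]_(p in Omega) (fluct Aperp p * wdx u p * wd1 Lx v p.1).

Definition form_d u v : R :=
  Lz^-1 * \int[mu1 R]_(x in Itv Lx) \int[mu1 R]_(zeta in Itv Lz)
    \int[mu1 R]_(z in Itv Lz)
      (fluct Aperp (x, z) * wdx u (x, z) * wdx v (x, zeta)).

Definition form_b (P : R -> R) v : R :=
  \int[mu1 R]_(x in Itv Lx) (P x * \int[mu1 R]_(z in Itv Lz) v (x, z)).

Definition form_a (eps : R) u v : R :=
  form_a0 u v + eps * form_a1 u v - eps * form_d u v.

Variable (f : R * R -> R).

Definition mean_eq (phi' : R * R -> R) (phib : R -> R) : Prop :=
  forall psib, spaceW Lx psib ->
    form_a2 phib psib =
    L2prod (mu1 R) (Itv Lx) (meanz f) psib - Lz^-1 * form_c phi' psib.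

Definition sol_S (eps : R) (phi' : R * R -> R) (phib : R -> R) : Prop :=
  [/\ spaceV phi', spaceW Lx phib, mean_eq phi' phib
    & forall psi', spaceV psi' ->
        form_a eps phi' psi' =
        eps * L2prod mu2 Omega (fluct f) psi' - eps * form_c psi' phib].

Definition sol_AP (eps : R) (phi' : R * R -> R) (phib P : R -> R) : Prop :=
  [/\ [/\ spaceV phi', spaceW Lx phib & spaceW Lx P],
      mean_eq phi' phib,
      forall psi', spaceV psi' ->
        form_a eps phi' psi' + form_b P psi' =
        eps * L2prod mu2 Omega (fluct f) psi' - eps * form_c psi' phib
    & forall Q, spaceW Lx Q -> form_b Q phi' = 0].

(* Weak form of - d_x (Aperp d_x phi) - eps^-1 d_z (Az d_z phi) = f: the
   Neumann condition is natural, the Dirichlet condition is in the space. *)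
Definition sol_SP (eps : R) (phi : R * R -> R) : Prop :=
  spaceV phi /\
  forall psi, spaceV psi ->
    form_a1 phi psi + eps^-1 * form_a0 phi psi = L2prod mu2 Omega f psi.

(* Weak form of - (meanz Aperp * phib')' = meanz f on ]0, Lx[, with homogeneous
   Dirichlet conditions. *)
Definition sol_lim (phib : R -> R) : Prop :=
  spaceW Lx phib /\
  forall psib, spaceW Lx psib ->
    form_a2 phib psib = L2prod (mu1 R) (Itv Lx) (meanz f) psib.

End rectangle.

(* Main.v *)
(* With B_eps(u, v) = a_1(u, v) + a_0(u, v) / eps, the singular perturbation
   model reads B_eps(phi, psi) = (f, psi) for psi in V.  By the Poincare
   inequality in x and the completeness of V it has exactly one solution, the
   minimiser of B_eps(v, v) - 2 (f, v).  Taking the mean along z turns c, d and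
   a_2 into values of a_1: L_z a_2(h, k) = a_1(h, k), c(u, k) = a_1(u', k) and
   d(u, v) = a_1(u', mean v).  Hence the residual of the second equation of (S)
   at psi is eps times the residual of the singular perturbation model at psi
   minus eps times the residual of the first equation at mean psi, so that (S)
   is equivalent to that model; testing with functions of x only gives
   mean phi' = 0 and P = 0.
   For eps <= delta, B_delta(phi_eps - phi_delta, phi_eps - phi_delta) is at most
   (f, phi_delta) - (f, phi_eps).  The numbers (f, phi_eps) are nonnegative and
   nondecreasing in eps, so phi_eps is Cauchy in H^1; d_z phi_eps tends to 0, and by the
   Poincare-Wirtinger inequality in z the limit depends on x only.  All the
   convergences are therefore strong in H^1. *)

Require Import Defs.
From HB Require Import structures.
From mathcomp Require Import all_boot all_order all_algebra.
From mathcomp Require Import all_classical all_reals all_analysis measurable_realfun.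
From mathcomp Require Import ring lra.
Set Implicit Arguments.
Unset Strict Implicit.
Unset Printing Implicit Defensive.
Import Order.TTheory GRing.Theory Num.Theory.
Import numFieldNormedType.Exports.
Local Open Scope classical_set_scope.
Local Open Scope ring_scope.

(** Traces are defined by approximation with functions smooth on the whole plane, so every element
    of V comes with smooth approximants in H^1. This is the only source of density: the Poincare
    inequalities, and the fact that the mean along z maps V to W, are proved for smooth functions by
    the fundamental theorem of calculus on slices and then pass to the limit. Weak derivatives are
    selected representatives, hence linear only almost everywhere. Their uniqueness is the
    fundamental lemma of the calculus of variations, for which bumps are built from exp(-1/x). A
    function of x is lifted to the rectangle whenever possible: lifting multiplies the L^2 norm by
    sqrt Lz and the mean is a left inverse of it, so uniqueness of derivatives, linearity of W and
    equality almost everywhere in x are read off from the plane. The variational argument uses only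
    symmetry, linearity, coercivity and boundedness of a_0 and a_1, measured by d_z and d_x
    separately. Since a_0 sees d_z only, it vanishes on lifted functions, and the equation tested
    with these contains no eps. *)

Section almost_everywhere.
Context d (T : measurableType d) (R : realType) (mu : {measure set T -> \bar R}).
Implicit Types P Q S : T -> Prop.

Lemma aeS P Q : (forall x, P x -> Q x) ->
  {ae mu, forall x, P x} -> {ae mu, forall x, Q x}.
Proof. exact: filterS. Qed.

Lemma aeS2 P Q S : (forall x, P x -> Q x -> S x) ->
  {ae mu, forall x, P x} -> {ae mu, forall x, Q x} -> {ae mu, forall x, S x}.
Proof. exact: filterS2. Qed.

End almost_everywhere.

(** * The space L^2 *)

Section L2_space.
Context d (T : measurableType d) (R : realType).
Variables (mu : {measure set T -> \bar R}) (D : set T).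
Hypothesis mD : measurable D.
Implicit Types u v w : T -> R.

Local Notation intg u := (mu.-integrable D (EFin \o u)).
Local Notation L2 := (L2 mu D).
Local Notation N := (L2norm mu D).
Local Notation prod2 := (L2prod mu D).

Lemma restrict_sqr u :
  EFin \o (fun x => (u \_ D) x ^+ 2) = (EFin \o (fun x => u x ^+ 2)) \_ D.
Proof.
by apply/funext => x /=; rewrite /patch; case: ifP => //= _; rewrite expr0n.
Qed.

Lemma integral_restrict_sqr u :
  (\int[mu]_x (`|((u \_ D) x)%:E| `^ 2) = \int[mu]_(x in D) (u x ^+ 2)%:E)%E.
Proof.
under eq_integral => x _ do rewrite /= powR_mulrn// real_normK ?num_real//.
by rewrite [RHS]integral_mkcond -(restrict_sqr u).
Qed.

(** Trades the p-norm of the extension by zero for integrability of the square on [D]; all later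
    membership proofs go through this form. *)
Lemma L2P u : L2 u <-> measurable_fun D u /\ intg (fun x => u x ^+ 2).
Proof.
split=> [h|[mu_ iu]].
- split.
    by apply/measurable_restrictT => //; case/andP: h => /[!inE].
  by apply/(integrable_mkcond _ mD); rewrite -restrict_sqr; exact: Lfun2_integrable_sqr.
- have m1 : measurable_fun setT (u \_ D) by apply/(measurable_restrictT u mD).
  apply/andP; split; rewrite inE//= /finite_norm.
  rewrite (@lty_poweRy _ _ 2)// powR_Lnorm// integral_restrict_sqr.
  move/integrableP : iu => [_].
  by under eq_integral => x _ do rewrite /= ger0_norm ?sqr_ge0//.
Qed.

Lemma L2_measurable u : L2 u -> measurable_fun D u.
Proof. by move/L2P => []. Qed.

Lemma L2norm_ge0 u : 0 <= N u.
Proof. by rewrite /L2norm fine_ge0// Lnorm_ge0. Qed.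

Lemma L2norm_sqr u : L2 u -> N u ^+ 2 = prod2 u u.
Proof.
move=> Lu; have fN : 'N[mu]_2%:E[EFin \o (u \_ D)]%E \is a fin_num.
  rewrite ge0_fin_numE ?Lnorm_ge0//.
  by case/andP: Lu => _; rewrite inE.
have := @powR_Lnorm _ T R mu (EFin \o (u \_ D)) 2.
rewrite pnatr_eq0 => /(_ isT); rewrite (integral_restrict_sqr u).
rewrite -(fineK fN) poweR_EFin powR_mulrn; last exact: L2norm_ge0.
rewrite /L2prod/Rintegral => h.
rewrite [X in fine X](_ : _ = ((N u) ^+ 2)%:E)//.
Qed.

Lemma L2_sqr_integrable u : L2 u -> intg (fun x => u x ^+ 2).
Proof. by move/L2P => []. Qed.

Lemma ae_le_integrable u v : measurable_fun D u -> intg v ->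
  {ae mu, forall x, D x -> `|u x| <= `|v x|} -> intg u.
Proof.
move=> mfu /integrableP[mv iv] uv; apply/integrableP; split.
  exact/measurable_EFinP.
apply: le_lt_trans iv; apply: ae_ge0_le_integral => //.
- by apply: measurableT_comp => //; apply/measurable_EFinP.
- exact: measurableT_comp.
Qed.

Lemma intg_le u v : measurable_fun D u -> intg v ->
  (forall x, D x -> `|u x| <= `|v x|) -> intg u.
Proof.
by move=> mfu iv uv; apply: ae_le_integrable iv _ => //; apply: nearW.
Qed.

Lemma intgD u v : intg u -> intg v -> intg (fun x => u x + v x).
Proof. by move=> iu iv; have := integrableD mD iu iv. Qed.

Lemma intgZ k u : intg u -> intg (fun x => k * u x).
Proof. by move=> iu; have := integrableZl mD k iu. Qed.

Lemma intgN u : intg u -> intg (fun x => - u x).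
Proof.
move=> iu; have := intgZ (-1) iu.
by congr (_.-integrable _ _); apply/funext => x /=; rewrite mulN1r.
Qed.

Lemma intgB u v : intg u -> intg v -> intg (fun x => u x - v x).
Proof. by move=> iu iv; exact/intgD/intgN. Qed.

Lemma intg_measurable u : intg u -> measurable_fun D u.
Proof. by move/integrableP => [/measurable_EFinP]. Qed.

Lemma L2_intgM u v : L2 u -> L2 v -> intg (fun x => u x * v x).
Proof.
move=> /L2P[mfu iu] /L2P[mfv iv].
apply: (@intg_le _ (fun x => u x ^+ 2 + v x ^+ 2)); first exact: measurable_funM.
  exact: intgD.
move=> x _; rewrite [leRHS]ger0_norm ?addr_ge0 ?sqr_ge0//.
rewrite normrM -(real_normK (num_real (u x))) -(real_normK (num_real (v x))).
by set a := `|u x|; set b := `|v x|; nra.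
Qed.

Lemma L2Z k u : L2 u -> L2 (fun x => k * u x).
Proof.
move=> /L2P[mfu iu]; apply/L2P; split; first exact: measurable_funM.
under [X in _.-integrable _ (_ \o X)]eq_fun do rewrite exprMn.
exact: intgZ.
Qed.

Lemma L2D u v : L2 u -> L2 v -> L2 (fun x => u x + v x).
Proof.
move=> Lu Lv; have /L2P[mfu iu] := Lu; have /L2P[mfv iv] := Lv.
apply/L2P; split; first exact: measurable_funD.
under [X in _.-integrable _ (_ \o X)]eq_fun do rewrite sqrrD.
by apply: intgD => //; apply: intgD => //; apply: intgD => //; exact: L2_intgM.
Qed.

Lemma L2N u : L2 u -> L2 (fun x => - u x).
Proof.
by move=> /(L2Z (-1)); under [in X in X -> _]eq_fun do rewrite mulN1r.
Qed.

Lemma L2B u v : L2 u -> L2 v -> L2 (fun x => u x - v x).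
Proof. by move=> Lu Lv; exact/L2D/L2N. Qed.

Lemma L2_lin k u v : L2 u -> L2 v -> L2 (fun x => k * u x + v x).
Proof. by move=> Lu Lv; exact/L2D/Lv/L2Z. Qed.

Lemma L2_0 : L2 (fun=> 0).
Proof.
apply/L2P; split => //.
by under [X in _.-integrable _ (_ \o X)]eq_fun do rewrite expr0n/=; exact: integrable0.
Qed.

Lemma L2_boundedM (a : T -> R) u (M : R) : measurable_fun D a ->
  {ae mu, forall x, D x -> `|a x| <= M} -> L2 u -> L2 (fun x => a x * u x).
Proof.
move=> ma aM /L2P[mfu iu]; apply/L2P; split; first exact: measurable_funM.
apply: ae_le_integrable (intgZ (M ^+ 2) iu) _.
  by apply/measurable_funX/measurable_funM.
move: aM; apply: filterS => x aM Dx; have {aM} := aM Dx.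
rewrite exprMn !normrM => aM.
by rewrite ler_wpM2r// ler_pM// (le_trans aM)// ler_norm.
Qed.

Lemma ae_eq_L2norm u v : L2 u -> L2 v -> ae_eq mu D u v -> N u = N v.
Proof.
move=> Lu Lv uv; apply/eqP; rewrite -(@eqrXn2 _ 2)// ?L2norm_ge0// !L2norm_sqr//.
apply/eqP; congr fine; apply: ae_eq_integral => //.
- by apply/measurable_EFinP/measurable_funM; exact: L2_measurable.
- by apply/measurable_EFinP/measurable_funM; exact: L2_measurable.
- by apply: filterS uv => x h /h ->.
Qed.

Lemma ae_eq_L2prod u v w : L2 u -> L2 v -> L2 w -> ae_eq mu D u v ->
  prod2 u w = prod2 v w.
Proof.
move=> /L2_measurable mfu /L2_measurable mfv /L2_measurable mfw uv.
congr fine; apply: ae_eq_integral => //.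
- by apply/measurable_EFinP/measurable_funM.
- by apply/measurable_EFinP/measurable_funM.
- by apply: filterS uv => x h /h ->.
Qed.

Lemma L2prodC u v : prod2 u v = prod2 v u.
Proof. by apply: eq_Rintegral => x _; rewrite mulrC. Qed.

Lemma ae_eq_L2prodr u v w : L2 u -> L2 v -> L2 w -> ae_eq mu D u v ->
  prod2 w u = prod2 w v.
Proof. by move=> *; rewrite L2prodC (ae_eq_L2prod (v := v))// L2prodC. Qed.

Lemma L2prod_lin k u v w : L2 u -> L2 v -> L2 w ->
  prod2 (fun x => k * u x + v x) w = k * prod2 u w + prod2 v w.
Proof.
move=> Lu Lv Lw; rewrite /L2prod.
under eq_Rintegral => x _ do rewrite mulrDl -mulrA.
rewrite RintegralD//; last exact: L2_intgM; last exact/intgZ/L2_intgM.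
by rewrite RintegralZl//; exact: L2_intgM.
Qed.

Lemma L2prod_linr k u v w : L2 u -> L2 v -> L2 w ->
  prod2 w (fun x => k * u x + v x) = k * prod2 w u + prod2 w v.
Proof. by move=> *; rewrite L2prodC L2prod_lin// (L2prodC u) (L2prodC v). Qed.

Lemma L2prodDl u v w : L2 u -> L2 v -> L2 w ->
  prod2 (fun x => u x + v x) w = prod2 u w + prod2 v w.
Proof.
move=> Lu Lv Lw; have := L2prod_lin 1 Lu Lv Lw.
by under [in X in X = _ -> _]eq_fun do rewrite mul1r; rewrite mul1r.
Qed.

Lemma L2prodBl u v w : L2 u -> L2 v -> L2 w ->
  prod2 (fun x => u x - v x) w = prod2 u w - prod2 v w.
Proof.
move=> Lu Lv Lw; have := L2prod_lin (-1) Lv Lu Lw.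
by under [in X in X = _ -> _]eq_fun do rewrite mulN1r addrC; rewrite mulN1r addrC.
Qed.

Lemma L2prodDr u v w : L2 u -> L2 v -> L2 w ->
  prod2 w (fun x => u x + v x) = prod2 w u + prod2 w v.
Proof. by move=> *; rewrite L2prodC L2prodDl// (L2prodC u) (L2prodC v). Qed.

Lemma L2prodBr u v w : L2 u -> L2 v -> L2 w ->
  prod2 w (fun x => u x - v x) = prod2 w u - prod2 w v.
Proof. by move=> *; rewrite L2prodC L2prodBl// (L2prodC u) (L2prodC v). Qed.

Lemma L2prod_ge0 u : 0 <= prod2 u u.
Proof. by apply: Rintegral_ge0 => x _; rewrite -expr2 sqr_ge0. Qed.

(* The discriminant of k |-> |k u + v|^2 is nonpositive. *)
Lemma L2_CauchySchwarz u v : L2 u -> L2 v -> `|prod2 u v| <= N u * N v.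
Proof.
move=> Lu Lv.
have q k : 0 <= k ^+ 2 * N u ^+ 2 + 2 * k * prod2 u v + N v ^+ 2.
  have := L2prod_ge0 (fun x => k * u x + v x).
  rewrite L2prod_lin ?L2prod_linr//; last exact: L2_lin.
  rewrite !L2norm_sqr// (L2prodC v u).
  by move=> /le_trans; apply; rewrite le_eqVlt; apply/orP; left; apply/eqP; ring.
rewrite -ler_sqr ?nnegrE ?mulr_ge0 ?L2norm_ge0// ?normr_ge0//.
rewrite real_normK ?num_real// exprMn.
have [Nu0|Nu0] := eqVneq (N u ^+ 2) 0.
  have {}q k : 0 <= 2 * k * prod2 u v + N v ^+ 2 by have := q k; rewrite Nu0 mulr0 add0r.
  rewrite Nu0 mul0r; have [->|p0] := eqVneq (prod2 u v) 0; first by rewrite expr0n.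
  (* When [N u = 0] the polynomial is affine in k; if its slope were nonzero, this k would give it
     the value -1. *)
  have := q (- (N v ^+ 2 + 1) / (2 * prod2 u v)).
  have -> : 2 * (- (N v ^+ 2 + 1) / (2 * prod2 u v)) * prod2 u v = - (N v ^+ 2 + 1) by field.
  by rewrite opprD addrAC addNr add0r oppr_ge0 ler10.
have Nu_gt0 : 0 < N u ^+ 2 by rewrite lt_neqAle eq_sym Nu0 sqr_ge0.
have := q (- prod2 u v / N u ^+ 2).
have -> : (- prod2 u v / N u ^+ 2) ^+ 2 * N u ^+ 2 + 2 * (- prod2 u v / N u ^+ 2) * prod2 u v
  = - (prod2 u v ^+ 2 / N u ^+ 2) by field; move: Nu0; rewrite sqrf_eq0.
by rewrite addrC subr_ge0 ler_pdivrMr// mulrC.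
Qed.

Lemma L2norm_triangle u v : L2 u -> L2 v -> N (fun x => u x + v x) <= N u + N v.
Proof.
move=> Lu Lv; rewrite -ler_sqr ?nnegrE ?addr_ge0 ?L2norm_ge0//.
rewrite L2norm_sqr; last exact: L2D.
rewrite L2prodDl ?L2prodDr//; last exact: L2D.
have := L2_CauchySchwarz Lu Lv; rewrite ler_norml => /andP[_].
by rewrite (L2prodC v u) -!L2norm_sqr//; move: (N u) (N v) (prod2 u v) => a b c; nra.
Qed.

Lemma L2normZ k u : L2 u -> N (fun x => k * u x) = `|k| * N u.
Proof.
move=> Lu; apply/eqP; rewrite -(@eqrXn2 _ 2)// ?mulr_ge0 ?L2norm_ge0//.
rewrite exprMn !L2norm_sqr//; last exact: L2Z.
rewrite real_normK ?num_real// /L2prod.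
under eq_Rintegral => x _ do rewrite mulrACA -expr2.
by rewrite RintegralZl//; exact: L2_intgM.
Qed.

Lemma L2normN u : L2 u -> N (fun x => - u x) = N u.
Proof.
move=> Lu; have := L2normZ (-1) Lu; rewrite normrN1 mul1r => <-.
by under [in RHS]eq_fun do rewrite mulN1r.
Qed.

Lemma L2norm_triangleB u v : L2 u -> L2 v -> N (fun x => u x - v x) <= N u + N v.
Proof.
by move=> Lu Lv; rewrite -(L2normN Lv); apply: L2norm_triangle => //; exact: L2N.
Qed.

Lemma L2norm_triangle3 u v w : L2 u -> L2 v -> L2 w ->
  N (fun x => u x - w x) <= N (fun x => u x - v x) + N (fun x => v x - w x).
Proof.
move=> Lu Lv Lw.
have -> : (fun x => u x - w x) = fun x => (u x - v x) + (v x - w x).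
  by apply/funext => x; rewrite addrA subrK.
by apply: L2norm_triangle; exact: L2B.
Qed.

Lemma L2norm_distC u v : L2 u -> L2 v -> N (fun x => u x - v x) = N (fun x => v x - u x).
Proof.
move=> Lu Lv; rewrite -(@L2normN (fun x => u x - v x)); last exact: L2B.
by congr N; apply/funext => x; rewrite opprB.
Qed.

Lemma L2norm0 : N (fun=> 0) = 0.
Proof.
apply/eqP; rewrite -sqrf_eq0 L2norm_sqr; last exact: L2_0.
by rewrite /L2prod; under eq_Rintegral do rewrite mul0r; rewrite Rintegral_cst// mul0r.
Qed.

Lemma L2norm_eq0 u : L2 u -> N u = 0 <-> ae_eq mu D u (cst 0).
Proof.
move=> Lu; split=> [Nu0|u0]; last first.
  by rewrite (@ae_eq_L2norm u (fun=> 0))// ?L2norm0//; exact: L2_0.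
have mu2 : measurable_fun D (EFin \o (fun x => u x * u x)).
  by apply/measurable_EFinP/measurable_funM; exact: L2_measurable.
have := (@ae_eq_integral_abs _ _ _ mu _ mD _ mu2).1.
have fi : (\int[mu]_(x in D) (u x * u x)%:E)%E \is a fin_num.
  exact/integrable_fin_num/L2_intgM.
have /eqP : N u ^+ 2 = 0 by rewrite Nu0 expr0n.
rewrite L2norm_sqr// /L2prod/Rintegral fine_eq0// => /eqP i0.
rewrite (_ : (\int[mu]_(x in D) `|(EFin \o (fun x => u x * u x)%R) x|)%E = 0); last first.
  by rewrite -[RHS]i0; apply: eq_integral => x _ /=; rewrite ger0_norm// -expr2 sqr_ge0.
move=> /(_ erefl); apply: filterS => x h Dx; have := h Dx => /=.
by case => /eqP; rewrite mulf_eq0 orbb => /eqP.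
Qed.

Lemma L2norm_sub_eq0 u v : L2 u -> L2 v ->
  N (fun x => u x - v x) = 0 <-> ae_eq mu D u v.
Proof.
move=> Lu Lv; split=> [/L2norm_eq0 h|uv].
  by apply: filterS (h (L2B Lu Lv)) => x h1 Dx; apply/eqP; rewrite -subr_eq0 h1.
apply/L2norm_eq0; first exact: L2B.
by apply: filterS uv => x h Dx; rewrite h// subrr.
Qed.

Lemma L2prod_norm2D u v : L2 u -> L2 v ->
  N (fun x => u x + v x) ^+ 2 = N u ^+ 2 + 2 * prod2 u v + N v ^+ 2.
Proof.
move=> Lu Lv; rewrite !L2norm_sqr//; last exact: L2D.
by rewrite L2prodDl ?L2prodDr// ?(L2prodC v u); [ring|exact: L2D].
Qed.

End L2_space.

(** * Completeness of L^2 on a domain of finite measure *)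

Section L2_complete.
Context d (T : measurableType d) (R : realType).
Variables (mu : {measure set T -> \bar R}) (D : set T).
Hypothesis mD : measurable D.
Hypothesis finD : (mu D < +oo)%E.

Local Notation intg u := (mu.-integrable D (EFin \o u)).
Local Notation L2 := (L2 mu D).
Local Notation N := (L2norm mu D).

Lemma L2_cst (k : R) : L2 (fun=> k).
Proof.
apply/(L2P _ mD); split => //.
apply: (@eq_integrable _ _ _ mu D mD (cst (k ^+ 2)%:E)) => //.
apply/integrableP; split; first exact: measurable_cst.
by rewrite /= integral_cst// lte_mul_pinfty ?lee_fin.
Qed.

Lemma L2_intg (u : T -> R) : L2 u -> intg u.
Proof.
move=> Lu; have := L2_intgM mD Lu (L2_cst 1).
by congr (_.-integrable _ _); apply/funext => x /=; rewrite mulr1.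
Qed.

Lemma limn_einf_le_cst (u : (\bar R)^nat) (l : \bar R) :
  (forall n, u n <= l)%E -> (limn_einf u <= l)%E.
Proof.
move=> ul; rewrite limn_einf_lim; apply: lime_le; first exact: is_cvg_einfs.
apply: nearW => n; apply: le_trans (ul n); apply: ereal_inf_lbound.
by exists n => //=.
Qed.

(** Stated for the extended integral because this is what Fatou's lemma delivers: membership in L^2
    and the bound come together. *)
Lemma L2norm_le_sqr (u : T -> R) (e : R) : 0 <= e -> measurable_fun D u ->
  (\int[mu]_(x in D) (u x ^+ 2)%:E <= (e ^+ 2)%:E)%E -> L2 u /\ N u <= e.
Proof.
move=> e0 mfu ie.
have Lu : L2 u.
  apply/(L2P _ mD); split => //; apply/integrableP; split.
    exact/measurable_EFinP/measurable_funX.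
  under eq_integral => x _ do rewrite /= ger0_norm ?sqr_ge0//.
  by rewrite (le_lt_trans ie)// ltry.
split => //; rewrite -ler_sqr ?nnegrE ?L2norm_ge0// L2norm_sqr//.
rewrite -lee_fin /L2prod /Rintegral fineK; last exact/integrable_fin_num/L2_intgM.
by under eq_integral => x _ do rewrite -expr2.
Qed.

(* Riesz-Fischer: a subsequence with summable increments converges a.e., and
   Fatou's lemma turns this into convergence in norm. *)
Lemma L2_complete (u : nat -> T -> R) : (forall n, L2 (u n)) ->
  (forall e : R, 0 < e -> exists n0, forall m n, (n0 <= m)%N -> (n0 <= n)%N ->
     N (fun x => u m x - u n x) <= e) ->
  exists2 v, L2 v & N (fun x => u n x - v x) @[n --> \oo] --> (0 : R).
Proof.
move=> Lu cu.
have /choice[n0 n0P] : forall k, exists n0, forall m n, (n0 < m)%N -> (n0 < n)%N ->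
    N (fun x => u m x - u n x) <= 1 / (2 ^ (k + 1))%:R :> R.
  move=> k; have [|n0 h] := cu (1 / (2 ^ (k + 1))%:R).
    by rewrite divr_gt0// ltr0n expn_gt0.
  by exists n0 => m n /ltnW ? /ltnW ?; exact: h.
(* Partial sums make [phi k] and [phi k.+1] both exceed [n0 k], so consecutive terms of the
   subsequence are 2^-(k+1) close, and they also give [k <= phi k]. *)
pose phi k := (\sum_(i < k.+1) (n0 i).+1)%N.
have phi_n0 k : (n0 k < phi k)%N by rewrite /phi big_ord_recr /= leq_addl.
have phi_n0S k : (n0 k < phi k.+1)%N.
  by rewrite /phi 2!big_ord_recr /= addnAC leq_addl.
have phi_ge k : (k <= phi k)%N.
  elim: k => // k ih.
  by rewrite /phi big_ord_recr /= addnS ltnS (leq_trans ih)// leq_addr.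
pose g k x : R := `|u (phi k.+1) x - u (phi k) x|.
have Lg k : L2 (fun x => u (phi k.+1) x - u (phi k) x) by exact: L2B.
have mg k : measurable_fun D (EFin \o g k).
  by apply/measurable_EFinP/measurableT_comp => //; exact: L2_measurable.
(* Cauchy-Schwarz against the constant 1, which is square integrable because [D] has finite measure,
   turns the L^2 bound into an L^1 bound; the sum of the [g k] is then integrable, hence finite
   almost everywhere. *)
have ig k : (\int[mu]_(x in D) (g k x)%:E <= (N (fun=> 1) / (2 ^ (k + 1))%:R)%:E)%E.
  have Lgk : L2 (g k).
    apply/(L2P _ mD); split; first exact/measurable_EFinP.
    have := L2_sqr_integrable mD (Lg k); congr (_.-integrable _ _).
    by apply/funext => x /=; rewrite real_normK ?num_real.
  have -> : (\int[mu]_(x in D) (g k x)%:E = (L2prod mu D (fun=> 1) (g k))%:E)%E.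
    rewrite /L2prod/Rintegral fineK; last first.
      by apply: integrable_fin_num => //; apply: L2_intgM => //; exact: L2_cst.
    by under [RHS]eq_integral do rewrite mul1r.
  rewrite lee_fin (le_trans (ler_norm _))//.
  apply: le_trans (L2_CauchySchwarz mD (L2_cst 1) Lgk) _.
  rewrite ler_wpM2l ?L2norm_ge0// -div1r.
  have -> : N (g k) = N (fun x => u (phi k.+1) x - u (phi k) x).
    apply/eqP; rewrite -(@eqrXn2 _ 2)// ?L2norm_ge0// !L2norm_sqr//.
    apply/eqP/eq_Rintegral => x _; rewrite -!expr2 real_normK ?num_real//.
  exact: n0P.
have iG : (\int[mu]_(x in D) \sum_(0 <= k <oo) (g k x)%:E < +oo)%E.
  rewrite integral_nneseries//; last by move=> k x _; rewrite lee_fin normr_ge0.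
  apply: (@le_lt_trans _ _ (\sum_(0 <= k <oo) (N (fun=> 1) / (2 ^ (k + 1))%:R)%:E)%E).
    apply: lee_nneseries => [k _ _|k _]; last exact: ig.
    by apply: integral_ge0 => x _; rewrite lee_fin normr_ge0.
  have /cvg_lim := @cvg_geometric_eseries_half R (N (fun=> 1)) 0.
  by rewrite /eseries => ->//; rewrite ltry.
have mG : measurable_fun D (fun x => \sum_(0 <= k <oo) (g k x)%:E)%E.
  apply: (@ge0_emeasurable_sum _ _ _ D (fun k x => (g k x)%:E) xpredT) => // [k x _ _|k _].
    by rewrite lee_fin normr_ge0.
  exact: mg.
have aeG : {ae mu, forall x, D x -> (\sum_(0 <= k <oo) (g k x)%:E)%E \is a fin_num}.
  apply: integrable_ae => //; apply/integrableP; split => //.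
  rewrite (eq_integral (fun x => (\sum_(0 <= k <oo) (g k x)%:E)%E))// => x _.
  by rewrite gee0_abs// nneseries_ge0// => k _ _; rewrite lee_fin normr_ge0.
have cv x : (\sum_(0 <= k <oo) (g k x)%:E)%E \is a fin_num ->
    cvgn (fun k => u (phi k) x).
  move=> fx; pose h k := u (phi k) x.
  have : cvgn [normed series (telescope h)].
    apply: nondecreasing_is_cvgn.
      by apply: nondecreasing_series => k _ _; exact: normr_ge0.
    exists (fine (\sum_(0 <= k <oo) (g k x)%:E)%E) => _ [n _ <-].
    rewrite -lee_fin fineK// /series /= -sumEFin.
    by apply: nneseries_lim_ge => k _ _; rewrite lee_fin normr_ge0.
  move/normed_cvg; rewrite telescopeK => ch.
  have -> : (fun k => u (phi k) x) = (fun k => (h k - h 0%N) + h 0%N).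
    by apply/funext => k; rewrite subrK.
  by apply: is_cvgD => //; exact: is_cvg_cst.
(* An upper limit is measurable whether or not the subsequence converges at the point; off the
   convergence set the value produced by [fine] is irrelevant. *)
pose v x := fine (limn_esup (fun k => (u (phi k) x)%:E)).
have mv : measurable_fun D v.
  apply: (measurableT_comp (fine_measurable _)) => //.
  by apply: measurable_fun_limn_esup => k; exact/measurable_EFinP/L2_measurable.
have cuv : {ae mu, forall x, D x -> u (phi k) x @[k --> \oo] --> v x}.
  apply: filterS aeG => x fx Dx; have /cv/cvg_ex[l ul] := fx Dx.
  have : (u (phi k) x)%:E @[k --> \oo] --> l%:E.
    by apply: cvg_EFin => //; exact: nearW.
  by move=> /cvg_limn_einf_sup[_]; rewrite /v => ->.
(* Fatou in k with m fixed: a bound on the distance from [u m] to the tail of the subsequence passes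
   to [v]. Shifting by [K] makes the bound hold from index 0 on. *)
have est m (e : R) : 0 < e ->
    (\forall k \near \oo, N (fun x => u m x - u (phi k) x) <= e) ->
    L2 (fun x => u m x - v x) /\ N (fun x => u m x - v x) <= e.
  move=> e0 [K _ Ke]; apply: L2norm_le_sqr; first exact: ltW.
    by apply: measurable_funB => //; exact: L2_measurable.
  pose f k x := ((u m x - u (phi (k + K)%N) x) ^+ 2)%:E.
  have mf k : measurable_fun D (f k).
    by apply/measurable_EFinP/measurable_funX/measurable_funB; exact: L2_measurable.
  have -> : (\int[mu]_(x in D) ((u m x - v x) ^+ 2)%:E =
      \int[mu]_(x in D) limn_einf (f ^~ x))%E.
    apply: ae_eq_integral => //.
    - apply/measurable_EFinP/measurable_funX/measurable_funB => //.
      exact: L2_measurable.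
    - under eq_fun do rewrite -[limn_einf _]oppeK -limn_esupN.
      apply: measurableT_comp => //; apply: measurable_fun_limn_esup => k.
      exact: measurableT_comp.
    - apply: filterS cuv => x cx Dx; have {}cx := cx Dx.
      have : f k x @[k --> \oo] --> ((u m x - v x) ^+ 2)%:E.
        apply: cvg_EFin; first exact: nearW.
        rewrite /f /comp /=; under eq_fun do rewrite expr2.
        have c1 : u m x - u (phi (k + K)%N) x @[k --> \oo] --> u m x - v x.
          by apply: cvgB; [exact: cvg_cst|rewrite (cvg_shiftn K (fun k => u (phi k) x))].
        by rewrite expr2; exact: cvgM.
      by move=> /cvg_limn_einf_sup[-> _].
  apply: le_trans (fatou mu mD mf _) _ => [k x _|]; first by rewrite lee_fin sqr_ge0.
  apply: limn_einf_le_cst => k.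
  have Lk : L2 (fun x => u m x - u (phi (k + K)%N) x) by exact: L2B.
  have := Ke (k + K)%N (leq_addl _ _) => /= h.
  have : N (fun x => u m x - u (phi (k + K)%N) x) ^+ 2 <= e ^+ 2.
    by rewrite ler_sqr ?nnegrE ?L2norm_ge0// ltW.
  rewrite L2norm_sqr// -lee_fin /L2prod /Rintegral fineK; last exact/integrable_fin_num/L2_intgM.
  by under eq_integral => x _ do rewrite -expr2.
have ev (e : R) : 0 < e -> exists n1, forall m, (n1 <= m)%N ->
    L2 (fun x => u m x - v x) /\ N (fun x => u m x - v x) <= e.
  move=> e0; have [n1 h] := cu e e0; exists n1 => m n1m; apply: est => //.
  by exists n1 => // k /= n1k; apply: h => //; exact: leq_trans (phi_ge k).
have Lv : L2 v.
  have [n1 h] := ev 1 ltr01; have [h1 _] := h n1 (leqnn _).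
  have := L2B mD (Lu n1) h1; congr (Defs.L2 _ _ _).
  by apply/funext => x; rewrite opprB addrC subrK.
exists v => //; apply/cvgrPdist_le => e e0; have [n1 h] := ev e e0.
exists n1 => // m /= n1m; rewrite sub0r normrN ger0_norm ?L2norm_ge0//.
by have [] := h m n1m.
Qed.

End L2_complete.

(** A finite integral forces both the positive and the negative part to have finite integral, which
    is integrability; otherwise the value is infinite and [fine] sends it to 0. *)
Lemma not_integrable_Rintegral d (T : measurableType d) (R : realType)
    (mu : {measure set T -> \bar R}) (D : set T) (u : T -> R) :
  measurable D -> measurable_fun D u -> ~ mu.-integrable D (EFin \o u) ->
  \int[mu]_(x in D) u x = 0.
Proof.
move=> mD mfu nu; rewrite /Rintegral.
have mEu : measurable_fun D (EFin \o u) by exact/measurable_EFinP.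
suff : ~~ ((\int[mu]_(x in D) (u x)%:E)%E \is a fin_num).
  by case: (integral _ _ _) => //= r.
apply/negP => fu; apply: nu; apply/integrableP; split => //.
move: fu; rewrite integralE fin_numB => /andP[fp fn].
rewrite -[X in (\int[mu]_(x in D) X x)%E]/(abse \o (EFin \o u)) fune_abse ge0_integralD//.
- by rewrite lte_add_pinfty// ltey_eq ?fp ?fn.
- exact: measurable_funepos.
- exact: measurable_funeneg.
Qed.

(* No integrability is required: when [u] is not integrable and [k <> 0] both
   sides are the default value [0]. *)
Lemma RintegralZl_total d (T : measurableType d) (R : realType)
    (mu : {measure set T -> \bar R}) (D : set T) (u : T -> R) (k : R) :
  measurable D -> measurable_fun D u ->
  \int[mu]_(x in D) (k * u x) = k * \int[mu]_(x in D) u x.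
Proof.
move=> mD mfu; have [iu|niu] := pselect (mu.-integrable D (EFin \o u)).
  exact: RintegralZl.
have [->|k0] := eqVneq k 0.
  rewrite mul0r; under eq_Rintegral do rewrite mul0r.
  by rewrite Rintegral_cst// mul0r.
rewrite !not_integrable_Rintegral ?mulr0//; first exact: measurable_funM.
move=> iku; apply: niu; have := intgZ mD k^-1 iku.
by congr (_.-integrable _ _); apply/funext => x /=; rewrite mulKf.
Qed.

Lemma RintegralZr_total d (T : measurableType d) (R : realType)
    (mu : {measure set T -> \bar R}) (D : set T) (u : T -> R) (k : R) :
  measurable D -> measurable_fun D u ->
  \int[mu]_(x in D) (u x * k) = (\int[mu]_(x in D) u x) * k.
Proof.
move=> mD mfu; under eq_Rintegral do rewrite mulrC.
by rewrite RintegralZl_total// mulrC.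
Qed.

(** * Integration over the rectangle *)

Section Fubini_rectangle.
Context (R : realType) (Lx Lz : R).
Hypotheses (hLx : 0 < Lx) (hLz : 0 < Lz).

Local Notation RR := (measurableTypeR R * measurableTypeR R)%type.
Local Notation Ix := (Itv Lx).
Local Notation Iz := (Itv Lz).
Local Notation Om := (Omega Lx Lz).
Local Notation m1 := (mu1 R).
Local Notation m2 := (mu2 R).
Implicit Types (u v w : R * R -> R) (h g : R -> R).

Lemma measurable_Itv (L : R) : measurable (Itv L : set (measurableTypeR R)).
Proof. exact: measurable_itv. Qed.

Lemma measurable_Omega :
  measurable (Om : set RR).
Proof. by apply: measurableX; exact: measurable_itv. Qed.

Lemma mu1_Itv (L : R) : 0 < L -> m1 (Itv L) = L%:E.
Proof.
move=> L0; have -> : m1 (Itv L) = lebesgue_measure [set` `]0, L[] by [].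
by rewrite lebesgue_measure_itv/= lte_fin L0 oppr0 adde0.
Qed.

Lemma mu1_Itv_fin (L : R) : (m1 (Itv L) < +oo)%E.
Proof.
have -> : m1 (Itv L) = lebesgue_measure [set` `]0, L[] by [].
by rewrite lebesgue_measure_itv/=; case: ifPn => // _; rewrite oppr0 adde0 ltry.
Qed.

Lemma mu2_Omega_fin : (m2 Om < +oo)%E.
Proof.
rewrite /mu2 /= product_measure1E; try exact: measurable_itv.
by rewrite -/(mu1 R) !mu1_Itv// -EFinM ltry.
Qed.

(** Restriction to the rectangle is restriction in each variable in turn, so Fubini's theorem on the
    whole plane descends to nested integrals over the two intervals. *)
Lemma restrict_section u x z :
  (u \_ Om) (x, z) = ((fun x => ((fun z => u (x, z)) \_ Iz) z) \_ Ix) x.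
Proof.
rewrite /patch /Omega; case: ifPn => [/set_mem[/= hx hz]|].
  by rewrite !mem_set.
move=> h; case: ifPn => // hx; case: ifPn => // hz; exfalso.
by move/negP: h; apply; rewrite inE; split; [exact: set_mem hx|exact: set_mem hz].
Qed.

Lemma measurable_section u x : measurable_fun (Om : set RR) u ->
  Ix x -> measurable_fun (Iz : set (measurableTypeR R)) (fun z => u (x, z)).
Proof.
move=> /(measurable_restrictT _ measurable_Omega) mu Ixx.
apply/(measurable_restrictT _ (measurable_Itv Lz)).
have -> : ((fun z => u (x, z)) \_ Iz) = (u \_ Om) \o (fun z => (x, z)).
  by apply/funext => z /=; rewrite restrict_section [RHS]patchE mem_set.
by apply: measurableT_comp => //; exact: pair1_measurable.
Qed.

Lemma integrable_Omega u : m2.-integrable Om (EFin \o u) ->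
  m2.-integrable setT (EFin \o (u \_ Om)).
Proof. by move/(integrable_mkcond _ measurable_Omega); rewrite restrict_EFin. Qed.

Lemma section_integral u x :
  (\int[m1]_z (EFin \o (u \_ Om)) (x, z) =
   ((fun x => \int[m1]_(z in Iz) (u (x, z))%:E) \_ Ix) x)%E.
Proof.
rewrite [RHS]patchE; case: ifPn => hx.
  rewrite [RHS]integral_mkcond; apply: eq_integral => z _ /=.
  rewrite restrict_section [in LHS]patchE hx !patchE.
  by case: ifP.
rewrite -[RHS](integral0 m1 setT); apply: eq_integral => z _ /=.
by rewrite restrict_section patchE (negbTE hx).
Qed.

Lemma section_integral2 u z :
  (\int[m1]_x (EFin \o (u \_ Om)) (x, z) =
   ((fun z => \int[m1]_(x in Ix) (u (x, z))%:E) \_ Iz) z)%E.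
Proof.
rewrite [RHS]patchE; case: ifPn => hz.
  rewrite [RHS]integral_mkcond; apply: eq_integral => x _ /=.
  by rewrite restrict_section !patchE hz; case: ifP.
rewrite -[RHS](integral0 m1 setT); apply: eq_integral => x _ /=.
by rewrite restrict_section !patchE (negbTE hz); case: ifP.
Qed.

Lemma ae_section_integrable u : m2.-integrable Om (EFin \o u) ->
  {ae m1, forall x, Ix x -> m1.-integrable Iz (EFin \o (fun z => u (x, z)))}.
Proof.
move=> /integrable_Omega/ae_integrable1; apply: aeS => x ix Ixx.
apply/(integrable_mkcond _ (measurable_Itv Lz)).
move: ix; congr (_.-integrable _ _); apply/funext => z /=.
by rewrite restrict_section patchE mem_set// !patchE; case: ifP.
Qed.

Lemma section_integral_integrable u : m2.-integrable Om (EFin \o u) ->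
  m1.-integrable Ix (fun x => \int[m1]_(z in Iz) (u (x, z))%:E)%E.
Proof.
move=> iu; apply/(integrable_mkcond _ (measurable_Itv Lx)).
have := integrable_fubini_F (integrable_Omega iu).
by rewrite /fubini_F; under eq_fun do rewrite section_integral.
Qed.

(** The partial integrals are measurable, and their absolute values are dominated by the partial
    integrals of |u|, whose total is finite by Tonelli. *)
Lemma section_integral_integrable2 u : m2.-integrable Om (EFin \o u) ->
  m1.-integrable Iz (fun z => \int[m1]_(x in Ix) (u (x, z))%:E)%E.
Proof.
move=> iu; apply/(integrable_mkcond _ (measurable_Itv Lz)).
have iuT := integrable_Omega iu; have mfu := measurable_int _ iuT.
rewrite [X in _.-integrable _ X](_ : _ = fubini_G m1 (EFin \o (u \_ Om))); last first.
  by apply/funext => z; rewrite /fubini_G section_integral2.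
apply/integrableP; split; first exact: (measurable_fubini_G iuT).
apply: le_lt_trans ((integrable21ltyP _ _ mfu).1 iuT).
apply: ge0_le_integral => //.
- by apply: measurableT_comp => //; exact: (measurable_fubini_G iuT).
- apply: (measurable_fun_fubini_tonelli_G (m1 := m1) (abse \o (EFin \o (u \_ Om)))).
    exact: measurableT_comp.
  by move=> p; rewrite abse_ge0.
- move=> z _; apply: le_abse_integral => //.
  by apply: measurableT_comp => //; exact: pair2_measurable.
Qed.

(** The inner integral in Fubini's theorem is extended-valued and finite only almost everywhere;
    passing to its real part matches the nested real integrals in the definitions of the forms. *)
Lemma integrable_fine d (T : measurableType d) (mu : {measure set T -> \bar R})
    (D : set T) (F : T -> \bar R) : measurable D -> mu.-integrable D F ->
  mu.-integrable D (EFin \o (fun x => fine (F x))) /\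
  (\int[mu]_(x in D) F x = (\int[mu]_(x in D) fine (F x))%:E)%E.
Proof.
move=> mD iF; have [mF _] := integrableP _ _ _ iF.
have mfF : measurable_fun D (EFin \o (fun x => fine (F x))).
  by apply/measurable_EFinP/(measurableT_comp (fine_measurable _)).
have ifF : mu.-integrable D (EFin \o (fun x => fine (F x))).
  apply: le_integrable iF => // x Dx /=.
  by case: (F x) => [r| |] //=; rewrite normr0 ?leey.
split => //; rewrite /Rintegral fineK; last exact: integrable_fin_num.
apply: ae_eq_integral => //.
by apply: aeS (integrable_ae mD iF) => x h Dx /=; rewrite fineK// h.
Qed.

Lemma intg_section u : m2.-integrable Om (EFin \o u) ->
  m1.-integrable Ix (EFin \o (fun x => \int[m1]_(z in Iz) u (x, z))).
Proof.
by move=> /section_integral_integrable/(integrable_fine (measurable_Itv Lx))[].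
Qed.

Lemma Fubini_Omega u : m2.-integrable Om (EFin \o u) ->
  \int[m2]_(p in Om) u p = \int[m1]_(x in Ix) \int[m1]_(z in Iz) u (x, z).
Proof.
move=> iu; have := integral12_prod_meas1 (integrable_Omega iu).
rewrite /fubini_F.
under eq_integral do rewrite section_integral.
rewrite -integral_mkcond.
have [_ ->] := integrable_fine (measurable_Itv Lx) (section_integral_integrable iu).
move=> /(congr1 fine) e; transitivity (\int[m2]_p (u \_ Om) p).
  exact: Rintegral_mkcond.
exact/esym/e.
Qed.

Lemma Fubini_Omega2 u : m2.-integrable Om (EFin \o u) ->
  \int[m2]_(p in Om) u p = \int[m1]_(z in Iz) \int[m1]_(x in Ix) u (x, z).
Proof.
move=> iu; have := integral21_prod_meas1 (integrable_Omega iu).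
rewrite /fubini_G.
under eq_integral do rewrite section_integral2.
rewrite -integral_mkcond.
have [_ ->] := integrable_fine (measurable_Itv Lz) (section_integral_integrable2 iu).
move=> /(congr1 fine) e; transitivity (\int[m2]_p (u \_ Om) p).
  exact: Rintegral_mkcond.
exact/esym/e.
Qed.

(** On the section at x the factor [h x] is a constant. It can be pulled out at every x: where the
    section of [u] is not integrable, both sides are 0. *)
Lemma Fubini_fst h u : m2.-integrable Om (EFin \o (fun p => h p.1 * u p)) ->
  measurable_fun (Om : set RR) u ->
  \int[m2]_(p in Om) (h p.1 * u p) =
  Lz * \int[m1]_(x in Ix) (h x * meanz Lz u x).
Proof.
move=> ihu mfu; rewrite Fubini_Omega//.
rewrite -RintegralZl_total; last 2 first.
- exact: measurable_Itv.
- have := measurable_funM (measurable_cst (Lz^-1 : measurableTypeR R)) (intg_measurable (intg_section ihu)).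
  apply: eq_measurable_fun => x /set_mem Ixx /=.
  rewrite RintegralZl_total//; last exact: measurable_section.
    by rewrite /meanz mulrCA.
  exact: measurable_Itv.
apply: eq_Rintegral => x /set_mem Ixx /=.
rewrite RintegralZl_total//; last exact: measurable_section.
  by rewrite /meanz mulrCA mulVKf// gt_eqF.
exact: measurable_Itv.
Qed.

Lemma measurable_lift h : measurable_fun (Ix : set (measurableTypeR R)) h ->
  measurable_fun (Om : set RR) (fun p => h p.1).
Proof.
move=> /(measurable_restrictT _ (measurable_Itv Lx)) mh.
have : measurable_fun setT (fun p : RR => (h \_ Ix) p.1).
  exact: measurableT_comp.
move/(measurable_funS measurableT) => /(_ Om (@subsetT _ _)).
by apply: eq_measurable_fun => p /set_mem[/= Ip _]; rewrite patchE mem_set.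
Qed.

Lemma intg_lift h : m1.-integrable Ix (EFin \o h) ->
  m2.-integrable Om (EFin \o (fun p => h p.1)).
Proof.
move=> ih; have mh := intg_measurable ih.
apply/(integrable_mkcond _ measurable_Omega).
rewrite restrict_EFin; apply/integrable12ltyP.
  apply/measurable_EFinP; move/measurable_lift: mh.
  exact: (measurable_restrictT _ measurable_Omega).1.
have -> : (\int[m1]_x \int[m1]_y `|(EFin \o ((fun p => h p.1) \_ Om)) (x, y)| =
    \int[m1]_(x in Ix) (`|(h x)%:E| * Lz%:E))%E.
  rewrite [RHS]integral_mkcond; apply: eq_integral => x _.
  under eq_integral do rewrite /= restrict_section.
  rewrite !patchE; case: ifPn => hx; last first.
    by rewrite integral0_eq// => z _; rewrite patchE (negbTE hx) normr0.
  rewrite -(mu1_Itv hLz) -integral_cst; last exact: measurable_Itv.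
  rewrite [RHS]integral_mkcond; apply: eq_integral => z _.
  by rewrite /patch hx; case: ifP => //=; rewrite normr0.
rewrite integralZr; last 2 first.
- exact: measurable_Itv.
- by apply: integrable_abse.
move/integrableP: ih => [_ ih]; apply: lte_mul_pinfty => //; first exact: integral_ge0.
  by rewrite ge0_fin_numE ?integral_ge0.
by rewrite ltry.
Qed.

Lemma Rintegral_lift h : m1.-integrable Ix (EFin \o h) ->
  \int[m2]_(p in Om) h p.1 = Lz * \int[m1]_(x in Ix) h x.
Proof.
move=> ih; rewrite Fubini_Omega; last exact: intg_lift.
rewrite -RintegralZl//; last exact: measurable_Itv.
apply: eq_Rintegral => x _ /=; rewrite Rintegral_cst; last exact: measurable_Itv.
by rewrite mu1_Itv//= mulrC.
Qed.

Lemma L2_lift h : L2 m1 Ix h -> L2 m2 Om (fun p => h p.1).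
Proof.
move=> /(L2P _ (measurable_Itv Lx))[mh ih].
apply/(L2P _ measurable_Omega); split; first exact: measurable_lift.
exact: (intg_lift ih).
Qed.

Lemma L2prod_lift h g : L2 m1 Ix h -> L2 m1 Ix g ->
  L2prod m2 Om (fun p => h p.1) (fun p => g p.1) = Lz * L2prod m1 Ix h g.
Proof.
move=> Lh Lg; rewrite /L2prod -Rintegral_lift//.
exact: (L2_intgM (measurable_Itv Lx)).
Qed.

Lemma L2norm_lift h : L2 m1 Ix h ->
  L2norm m2 Om (fun p => h p.1) = Num.sqrt Lz * L2norm m1 Ix h.
Proof.
move=> Lh; apply/eqP; rewrite -(@eqrXn2 _ 2)// ?mulr_ge0 ?L2norm_ge0//.
rewrite exprMn sqr_sqrtr ?ltW// (L2norm_sqr (L2_lift Lh)).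
by rewrite (L2norm_sqr Lh) L2prod_lift.
Qed.

Lemma ae_section_L2 u : L2 m2 Om u ->
  {ae m1, forall x, Ix x -> L2 m1 Iz (fun z => u (x, z))}.
Proof.
move=> /(L2P _ measurable_Omega)[mfu /ae_section_integrable].
apply: aeS => x h Ixx; apply/(L2P _ (measurable_Itv Lz)); split.
  exact: measurable_section.
exact: h.
Qed.

(** Cauchy-Schwarz against 1 on almost every section bounds the square of the mean by the mean of
    the square, which is integrable in x. *)
Lemma L2_meanz u : L2 m2 Om u -> L2 m1 Ix (meanz Lz u).
Proof.
move=> Lu; have iu := L2_intg measurable_Omega mu2_Omega_fin Lu.
have iu2 := L2_sqr_integrable measurable_Omega Lu.
have mI := measurable_Itv Lx.
apply/(L2P _ mI); split.
  by apply: measurable_funM => //; exact: (intg_measurable (intg_section iu)).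
apply: (ae_le_integrable mI _ (intgZ mI Lz^-1 (intg_section iu2))).
  apply: measurable_funX; apply: measurable_funM => //.
  exact: (intg_measurable (intg_section iu)).
apply: aeS (ae_section_L2 Lu) => x h Ixx; have {}h := h Ixx.
have mIz := measurable_Itv Lz.
have := L2_CauchySchwarz mIz (L2_cst mIz (mu1_Itv_fin Lz) 1) h.
rewrite -ler_sqr ?nnegrE ?mulr_ge0 ?L2norm_ge0// ?normr_ge0//.
rewrite exprMn !L2norm_sqr//; last exact: (L2_cst mIz (mu1_Itv_fin Lz) 1).
rewrite /L2prod; under eq_Rintegral do rewrite mul1r.
under [X in _ <= X * _]eq_Rintegral do rewrite mul1r.
rewrite Rintegral_cst// mu1_Itv//= mul1r => le1.
rewrite real_normK ?num_real// in le1.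
rewrite (ger0_norm (sqr_ge0 _)) /meanz exprMn.
rewrite [leRHS]ger0_norm; last first.
  rewrite mulr_ge0 ?invr_ge0 ?(ltW hLz)//; apply: Rintegral_ge0 => z _; exact: sqr_ge0.
rewrite exprVn expr2 invfM -mulrA ler_wpM2l ?invr_ge0 ?(ltW hLz)//.
by rewrite ler_pdivrMl.
Qed.

Lemma L2prod_meanz h u : L2 m1 Ix h -> L2 m2 Om u ->
  L2prod m2 Om (fun p => h p.1) u = Lz * L2prod m1 Ix h (meanz Lz u).
Proof.
move=> Lh Lu; rewrite /L2prod Fubini_fst//.
  by apply: (L2_intgM measurable_Omega) => //; exact: L2_lift.
exact: (L2_measurable measurable_Omega Lu).
Qed.

(** The lifted mean is an orthogonal projection: its squared norm equals its product with [u], and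
    Cauchy-Schwarz lets one factor cancel. *)
Lemma L2norm_meanz u : L2 m2 Om u ->
  L2norm m2 Om (fun p => meanz Lz u p.1) <= L2norm m2 Om u.
Proof.
move=> Lu; have Lm := L2_meanz Lu; have Ll := L2_lift Lm.
have := L2_CauchySchwarz measurable_Omega Ll Lu.
rewrite L2prod_meanz// -L2prod_lift// -L2norm_sqr//.
set a := L2norm _ _ _; have a0 : 0 <= a by exact: L2norm_ge0.
rewrite ger0_norm ?sqr_ge0// expr2.
have [->|an0] := eqVneq a 0; first by rewrite L2norm_ge0.
by rewrite ler_pM2l// lt_neqAle eq_sym an0.
Qed.

Lemma meanz_lift h x : meanz Lz (fun p => h p.1) x = h x.
Proof.
rewrite /meanz /= Rintegral_cst; last exact: measurable_Itv.
by rewrite mu1_Itv//= mulrCA mulVf ?mulr1// gt_eqF.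
Qed.

(** Only almost everywhere in x, because an element of L^2 of the rectangle has integrable sections
    for almost every x only. *)
Lemma meanz_lin (k : R) u v : L2 m2 Om u -> L2 m2 Om v ->
  ae_eq m1 Ix (meanz Lz (fun p => k * u p + v p))
    (fun x => k * meanz Lz u x + meanz Lz v x).
Proof.
move=> Lu Lv; have iu := L2_intg measurable_Omega mu2_Omega_fin Lu.
have iv := L2_intg measurable_Omega mu2_Omega_fin Lv.
have mIz := measurable_Itv Lz.
apply: aeS2 (ae_section_integrable iu) (ae_section_integrable iv) => x ux vx Ixx.
have {}ux := ux Ixx; have {}vx := vx Ixx.
rewrite /meanz RintegralD//; last exact: (intgZ mIz).
by rewrite RintegralZl// mulrDr mulrCA.
Qed.

Lemma meanzB u v : L2 m2 Om u -> L2 m2 Om v ->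
  ae_eq m1 Ix (meanz Lz (fun p => u p - v p)) (fun x => meanz Lz u x - meanz Lz v x).
Proof.
move=> Lu Lv; have := meanz_lin (-1) Lv Lu.
rewrite (_ : (fun p => -1 * v p + u p) = (fun p => u p - v p)); last first.
  by apply/funext => p; rewrite mulN1r addrC.
by apply: aeS => x h /h ->; rewrite mulN1r addrC.
Qed.

(** Goes through norms: equality almost everywhere is the vanishing of the norm of the difference,
    and lifting multiplies that norm by sqrt Lz, which is not 0. No null set of the product is cut
    into sections. *)
Lemma ae_eq_lift h g : L2 m1 Ix h -> L2 m1 Ix g ->
  ae_eq m1 Ix h g <-> ae_eq m2 Om (fun p => h p.1) (fun p => g p.1).
Proof.
move=> Lh Lg.
rewrite -(L2norm_sub_eq0 (measurable_Itv Lx))// -(L2norm_sub_eq0 measurable_Omega); try exact: L2_lift.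
rewrite (@L2norm_lift (fun x => h x - g x)); last exact: (L2B (measurable_Itv Lx) Lh Lg).
split=> [->|/eqP]; first by rewrite mulr0.
by rewrite mulf_eq0 sqrtr_eq0 leNgt hLz/= => /eqP.
Qed.

Lemma ae_eq_meanz u v : L2 m2 Om u -> L2 m2 Om v -> ae_eq m2 Om u v ->
  ae_eq m1 Ix (meanz Lz u) (meanz Lz v).
Proof.
move=> Lu Lv uv.
have LB : L2 m2 Om (fun p => u p - v p) by exact: (L2B measurable_Omega).
have h0 : L2norm m2 Om (fun p => u p - v p) = 0.
  by apply/(L2norm_sub_eq0 measurable_Omega).
have : ae_eq m1 Ix (meanz Lz (fun p => u p - v p)) (fun=> 0).
  apply/(ae_eq_lift (L2_meanz LB) (L2_0 _ (measurable_Itv Lx))).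
  apply/(L2norm_eq0 measurable_Omega); first exact/L2_lift/L2_meanz.
  apply/eqP; rewrite eq_le L2norm_ge0 andbT -h0; exact: L2norm_meanz.
move=> h; apply: aeS2 h (meanzB Lu Lv) => x h1 h2 Ixx.
by apply/eqP; rewrite -subr_eq0 -h2// h1.
Qed.

(** The shape of the form d: at fixed x the double integral factors into two integrals along z, each
    equal to Lz times a mean. *)
Lemma triple_integral u v : L2 m2 Om u -> L2 m2 Om v ->
  Lz^-1 * \int[m1]_(x in Ix) \int[m1]_(y in Iz) \int[m1]_(z in Iz) (u (x, z) * v (x, y)) =
  L2prod m2 Om u (fun p => meanz Lz v p.1).
Proof.
move=> Lu Lv; rewrite [RHS]L2prodC L2prod_meanz//; last exact: L2_meanz.
have mfu := L2_measurable measurable_Omega Lu.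
have mfv := L2_measurable measurable_Omega Lv.
have mIz := measurable_Itv Lz.
transitivity (Lz^-1 * \int[m1]_(x in Ix) ((Lz * Lz) * (meanz Lz v x * meanz Lz u x))).
  congr (_ * _); apply: eq_Rintegral => x /set_mem Ixx.
  transitivity (\int[m1]_(y in Iz) ((\int[m1]_(z in Iz) u (x, z)) * v (x, y))).
    by apply: eq_Rintegral => y _; rewrite RintegralZr_total//; exact: measurable_section.
  rewrite RintegralZl_total//; last exact: measurable_section.
  rewrite /meanz mulrACA; set a := \int[_]_(_ in _) _; set b := \int[_]_(_ in _) _.
  by field; rewrite gt_eqF.
rewrite RintegralZl; last 2 first.
- exact: measurable_Itv.
- by apply: (L2_intgM (measurable_Itv Lx)); exact: L2_meanz.
by rewrite -!mulrA mulKf ?gt_eqF.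
Qed.

End Fubini_rectangle.

#[local] Hint Extern 0 (measurable _) =>
  solve [exact: measurable_Omega | exact: measurable_Itv] : core.

(** * Smooth functions and bumps *)

Section smooth_calculus.
Context (R : realType) (E : normedModType R).
Implicit Types f g : E -> R.

Lemma CkW n f : Ck n.+1 f -> Ck n f.
Proof.
elim: n f => [|n ih] f /= [cf h]; first by split.
by split => // v; have [h1 h2] := h v; split => //; exact: ih.
Qed.

Lemma Ck_derivable n f v p : Ck n.+1 f -> derivable f p v.
Proof. by move=> /= [_ /(_ v)[]]. Qed.

Lemma Ck_cst n (k : R) : Ck n ((fun=> k) : E -> R).
Proof.
elim: n k => [|n ih] k; first by split => // p; exact: cst_continuous.
split; first by move=> p; exact: cst_continuous.
move=> v; split => [p|]; first exact: derivable_cst.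
rewrite (_ : 'D_v _ = fun=> 0); first exact: ih.
by apply/funext => p; rewrite derive_cst.
Qed.

Lemma CkD n f g : Ck n f -> Ck n g -> Ck n (fun p => f p + g p).
Proof.
elim: n f g => [|n ih] f g [cf hf] [cg hg].
  by split => // p; apply: continuousD; [exact: cf|exact: cg].
split; first by move=> p; apply: continuousD; [exact: cf|exact: cg].
move=> v; have [df kf] := hf v; have [dg kg] := hg v; split => [p|].
  exact: derivableD.
rewrite (_ : 'D_v _ = fun p => 'D_v f p + 'D_v g p); first exact: ih.
by apply/funext => p; rewrite -deriveD.
Qed.

Lemma CkM n f g : Ck n f -> Ck n g -> Ck n (fun p => f p * g p).
Proof.
elim: n f g => [|n ih] f g; first by move=> [cf _] [cg _]; split => // p; apply: cvgM; [exact: cf|exact: cg].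
move=> kf kg; have [cf hf] := kf; have [cg hg] := kg.
split; first by move=> p; apply: cvgM; [exact: cf|exact: cg].
move=> v; have [df kdf] := hf v; have [dg kdg] := hg v; split => [p|].
  exact: derivableM.
rewrite (_ : 'D_v _ = fun p => f p * 'D_v g p + g p * 'D_v f p).
  by apply: CkD; apply: ih => //; exact: CkW.
by apply/funext => p; rewrite -[RHS]deriveM.
Qed.

Lemma smooth_cst (k : R) : smooth ((fun=> k) : E -> R).
Proof. by move=> n; exact: Ck_cst. Qed.

Lemma smoothD f g : smooth f -> smooth g -> smooth (fun p => f p + g p).
Proof. by move=> sf sg n; exact: CkD. Qed.

Lemma smoothM f g : smooth f -> smooth g -> smooth (fun p => f p * g p).
Proof. by move=> sf sg n; exact: CkM. Qed.

Lemma smoothZ k f : smooth f -> smooth (fun p => k * f p).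
Proof. by move=> sf; apply: smoothM => //; exact: smooth_cst. Qed.

Lemma smooth_continuous f : smooth f -> continuous f.
Proof. by move=> /(_ 0%N)[]. Qed.

Lemma smooth_derivable f p v : smooth f -> derivable f p v.
Proof. by move=> /(_ 1%N); exact: Ck_derivable. Qed.

Lemma smooth_derive f v : smooth f -> smooth ('D_v f).
Proof. by move=> sf n; have [_ /(_ v)[]] := sf n.+1. Qed.

End smooth_calculus.

(** With [A0] the linear part of [A], the two difference quotients are the same function of the
    increment, so no chain rule is involved. This serves slices, lifts and the arguments of the
    bumps. *)
Lemma derive_comp_affine (R : realType) (E F : normedModType R) (A A0 : E -> F) (g : F -> R) v p :
  (forall (h : R) v p, A (h *: v + p) = h *: A0 v + A p) ->
  'D_v (g \o A) p = 'D_(A0 v) g (A p) /\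
  (derivable g (A p) (A0 v) -> derivable (g \o A) p v).
Proof.
move=> hA; rewrite /derive /derivable.
have -> // : (fun h : R => h^-1 *: (((g \o A) \o shift p) (h *: v) - (g \o A) p)) =
             (fun h : R => h^-1 *: ((g \o shift (A p)) (h *: A0 v) - g (A p))).
by apply/funext => h /=; rewrite hA.
Qed.

Lemma Ck_comp_affine (R : realType) (E F : normedModType R) (A A0 : E -> F) n (g : F -> R) :
  (forall (h : R) v p, A (h *: v + p) = h *: A0 v + A p) -> continuous A ->
  Ck n g -> Ck n (g \o A).
Proof.
move=> hA cA; elim: n g => [|n ih] g [cg hg].
  by split => // p; apply: continuous_comp; [exact: cA|exact: cg].
split; first by move=> p; apply: continuous_comp; [exact: cA|exact: cg].
move=> v; have [dg kg] := hg (A0 v); split => [p|].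
  by have [_] := derive_comp_affine g v p hA; apply.
rewrite (_ : 'D_v (g \o A) = 'D_(A0 v) g \o A); first exact: ih.
by apply/funext => p; have [->] := derive_comp_affine g v p hA.
Qed.

Lemma smooth_comp_affine (R : realType) (E F : normedModType R) (A A0 : E -> F) (g : F -> R) :
  (forall (h : R) v p, A (h *: v + p) = h *: A0 v + A p) -> continuous A ->
  smooth g -> smooth (g \o A).
Proof. by move=> hA cA sg n; exact: Ck_comp_affine. Qed.

Section smooth_line.
Context (R : realType).
Implicit Types (f g : R -> R).

Lemma derive_R f v x : derivable f x 1 -> 'D_v f x = v * 'D_1 f x.
Proof.
move=> /derivable1_diffP df; rewrite !deriveE//.
by rewrite -[X in 'd f x X]mulr1 -[_ * 1]/(v *: (1 : R)) linearZ.
Qed.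

Lemma derivable_R f v x : derivable f x 1 -> derivable f x v.
Proof. by move=> /derivable1_diffP df; exact: diff_derivable. Qed.

Lemma derivable_continuous f : (forall x, derivable f x 1) -> continuous f.
Proof.
by move=> df x; apply: differentiable_continuous; exact/derivable1_diffP.
Qed.

(** On the line every directional derivative is a multiple of the one in direction 1, so a single
    direction has to be checked. *)
Lemma CkS_line n f : (forall x, derivable f x 1) -> Ck n ('D_1 f) -> Ck n.+1 f.
Proof.
move=> df kf; split; first exact: derivable_continuous.
move=> v; split => [x|]; first exact: derivable_R.
rewrite (_ : 'D_v f = fun x => v * 'D_1 f x); first by apply: CkM => //; exact: Ck_cst.
by apply/funext => x; exact: derive_R.
Qed.

(* Every [p.[1/x] * exp (- 1/x)] extended by [0] to [x <= 0]: this family is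
   stable under differentiation, whence smoothness. *)
Definition flat_exp (p : {poly R}) (x : R) : R :=
  if 0 < x then p.[x^-1] * expR (- x^-1) else 0.

(** Induction on [p] absorbs a factor y into the power, hence the arbitrary exponent [k]. The
    constant term is controlled by y^k <= (k+1)! exp y, which comes from the exponential series. *)
Lemma horner_exp_bounded (p : {poly R}) k : exists2 C : R, 0 <= C &
  forall y, 0 < y -> `|p.[y]| * y ^+ k * expR (- y) <= C.
Proof.
elim/poly_ind: p k => [|p c ih] k.
  by exists 0 => // y _; rewrite horner0 normr0 !mul0r.
have [C1 C10 h1] := ih k.+1.
exists (C1 + `|c| * (k.+1)`!%:R); first by rewrite addr_ge0// mulr_ge0.
move=> y y0; rewrite hornerMXaddC.
have le1 : `|p.[y] * y + c| <= `|p.[y]| * y + `|c|.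
  by rewrite (le_trans (ler_normD _ _))// lerD2r normrM (gtr0_norm y0).
apply: (@le_trans _ _ ((`|p.[y]| * y + `|c|) * y ^+ k * expR (- y))).
  by rewrite ler_wpM2r ?expR_ge0// ler_wpM2r ?exprn_ge0// ltW.
rewrite 2!mulrDl lerD//; first by rewrite -(mulrA _ y) -exprS h1.
rewrite -mulrA ler_wpM2l// expRN ler_pdivrMr ?expR_gt0//.
case: k {ih h1} => [|k].
  by rewrite expr0 mul1r (le_trans _ (expR_ge1Dx _))// lerDl ltW.
have := expR_ge1Dxn k (ltW y0) => h.
rewrite factS natrM -mulrA.
apply: (@le_trans _ _ ((k.+1)`!%:R * expR y)).
  rewrite -ler_pdivrMl ?ltr0n ?fact_gt0// mulrC (le_trans _ h)// lerDr//.
by rewrite ler_peMl ?ler1n// mulr_ge0// expR_ge0.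
Qed.

(** For x > 0 this is the chain rule: differentiating 1/x brings out y^2 with y = 1/x, and the
    product rule gives p - p'. At 0 the exponential beats every power of 1/x. *)
Lemma is_derive_flat_exp p x :
  is_derive x (1 : R) (flat_exp p) (flat_exp ('X^2 * (p - p^`())) x).
Proof.
have [x0|x0] := ltP 0 x.
- have : is_derive x (1 : R) (fun y => p.[y^-1] * expR (- y^-1))
      (flat_exp ('X^2 * (p - p^`())) x).
    have i1 : is_derive x (1 : R) (fun y : R => y^-1) (- x ^- 2 *: 1).
      by apply: (is_deriveV (f := id)); rewrite gt_eqF.
    have i2 : is_derive x (1 : R) (fun y : R => - y^-1) (- (- x ^- 2 *: 1)).
      exact: is_deriveN.
    have i3 := is_derive1_comp (g := fun y : R => - y^-1) (is_derive_expR (- x^-1)) i2.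
    have i4 := is_derive1_comp (g := fun y : R => y^-1) (is_derive_poly p x^-1) i1.
    have i5 := is_deriveM i4 i3.
    rewrite [X in is_derive _ _ _ X](_ : _ = p.[x^-1] * (expR (- x^-1) * - (- x ^- 2 * 1)) +
      expR (- x^-1) * (p^`().[x^-1] * (- x ^- 2 * 1))); first exact: i5.
    by rewrite /flat_exp x0 !hornerE exprVn /=; ring.
  apply: near_eq_is_derive.
  near=> y; rewrite /flat_exp.
  have -> // : 0 < y by near: y; apply: (@cvgr_gt _ _ _ _ id x) => //; exact: cvg_id.
- have -> : flat_exp ('X^2 * (p - p^`())) x = 0 by rewrite /flat_exp ltNge x0.
  move: x0; rewrite le_eqVlt => /orP[/eqP ->|x0]; last first.
    have : is_derive x (1 : R) (cst (0 : R)) 0 by exact: is_derive_cst.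
    apply: near_eq_is_derive.
    near=> y; rewrite /flat_exp.
    have y0 : y < 0 by near: y; apply: (@cvgr_lt _ _ _ _ id x) => //; exact: cvg_id.
    by rewrite ltNge (ltW y0).
  (* With the exponent 2 the difference quotient becomes h times a bounded quantity: one power of
     1/h is spent on the division by h, the other leaves the factor h. *)
  have [C C0 hC] := horner_exp_bounded p 2.
  have c0 : (fun h => h^-1 *: ((flat_exp p \o shift 0) (h *: 1) - flat_exp p 0)) @ 0^' --> (0 : R).
    apply/cvgr0Pnorm_le => e e0; near=> h.
    rewrite /= addr0 [in X in _ - X]/flat_exp ltxx subr0 -[h *: 1]/(h * 1) mulr1.
    have [h0|h0] := ltP 0 h; last by rewrite /flat_exp ltNge h0/= scaler0 normr0 ltW.
    rewrite /flat_exp h0 -[_ *: _]/(_ * _) !normrM (ger0_norm (expR_ge0 _)).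
    have hi0 : 0 < h^-1 by rewrite invr_gt0.
    have := hC _ hi0; rewrite (gtr0_norm hi0) => le1.
    have -> : h^-1 * (`|p.[h^-1]| * expR (- h^-1)) =
        h * (`|p.[h^-1]| * h^-1 ^+ 2 * expR (- h^-1)).
      by field; rewrite gt_eqF.
    apply: (@le_trans _ _ (h * C)); first by rewrite ler_wpM2l// ltW.
    have : `|h| <= e / (C + 1).
      by near: h; apply: dnbhs0_le; rewrite divr_gt0// ltr_wpDl.
    rewrite (gtr0_norm h0) ler_pdivlMr ?ltr_wpDl// => le2.
    by rewrite (le_trans _ le2)// ler_wpM2l ?lerDl// ltW.
  by split; [apply/cvg_ex; exists 0|exact/cvg_lim].
Unshelve. all: by end_near. Qed.

Lemma smooth_flat_exp p : smooth (flat_exp p).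
Proof.
move=> n; elim: n p => [|n ih] p.
  split => //; apply: derivable_continuous => x.
  by have [] := is_derive_flat_exp p x.
apply: CkS_line => [x|]; first by have [] := is_derive_flat_exp p x.
rewrite (_ : 'D_(1 : R) (flat_exp p) = flat_exp ('X^2 * (p - p^`()))); first exact: ih.
by apply/funext => x; have [_] := is_derive_flat_exp p x.
Qed.

(* A bump on ]a, b[: the arguments exceed [0] only on ]a + 1/n, b - 1/n[ and
   tend to +oo with n on ]a, b[. *)
Definition bump (a b : R) (n : nat) (x : R) : R :=
  flat_exp 1 (n%:R ^+ 2 * (x - a) - n%:R) * flat_exp 1 (n%:R ^+ 2 * (b - x) - n%:R).

Lemma flat_exp1_ge0 x : 0 <= flat_exp 1 x.
Proof. by rewrite /flat_exp; case: ifP => // _; rewrite hornerC mul1r expR_ge0. Qed.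

Lemma flat_exp1_le1 x : flat_exp 1 x <= 1.
Proof.
rewrite /flat_exp; case: ifPn => // x0.
by rewrite hornerC mul1r -expR0 ler_expR oppr_le0 invr_ge0 ltW.
Qed.

Lemma bump_ge0 a b n x : 0 <= bump a b n x.
Proof. by rewrite mulr_ge0 ?flat_exp1_ge0. Qed.

Lemma bump_le1 a b n x : bump a b n x <= 1.
Proof. by rewrite mulr_ile1 ?flat_exp1_ge0 ?flat_exp1_le1. Qed.

Lemma smooth_bump a b n : smooth (bump a b n).
Proof.
apply: smoothM.
- apply: (@smooth_comp_affine _ _ _ (fun x => n%:R ^+ 2 * (x - a) - n%:R) (fun v => n%:R ^+ 2 * v)).
  + by move=> h v p; rewrite -!/(_ * _) /=; rewrite -![_ *: _]/(_ * _); ring.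
  + by move=> x; apply: cvgB; [apply: cvgM; [exact: cvg_cst|apply: cvgB => //; exact: cvg_cst]|exact: cvg_cst].
  + exact: smooth_flat_exp.
- apply: (@smooth_comp_affine _ _ _ (fun x => n%:R ^+ 2 * (b - x) - n%:R) (fun v => - (n%:R ^+ 2 * v))).
  + by move=> h v p; rewrite -!/(_ * _) /=; rewrite -![_ *: _]/(_ * _); ring.
  + by move=> x; apply: cvgB; [apply: cvgM; [exact: cvg_cst|apply: cvgB => //; exact: cvg_cst]|exact: cvg_cst].
  + exact: smooth_flat_exp.
Qed.

Lemma bump_support a b n x : (0 < n)%N -> ~ `[a + n%:R^-1, b - n%:R^-1]%classic x ->
  bump a b n x = 0.
Proof.
move=> n0 nx; have n1 : (0 : R) < n%:R by rewrite ltr0n.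
have [h|h] := ltP 0 (n%:R ^+ 2 * (x - a) - n%:R); last first.
  by rewrite /bump /flat_exp ltNge h/= mul0r.
have [h'|h'] := ltP 0 (n%:R ^+ 2 * (b - x) - n%:R); last first.
  by rewrite /bump /flat_exp ltNge mulrC ltNge h'/= mul0r.
exfalso; apply: nx; rewrite /= in_itv/=; apply/andP; split.
  rewrite -lerBrDl -(ler_pM2l (exprn_gt0 2 n1)).
  by rewrite expr2 -mulrA mulfV ?gt_eqF// mulr1 -expr2 -subr_ge0 ltW.
rewrite lerBrDr -lerBrDl -(ler_pM2l (exprn_gt0 2 n1)).
by rewrite expr2 -mulrA mulfV ?gt_eqF// mulr1 -expr2 -subr_ge0 ltW.
Qed.

Lemma cvg_flat_exp1 (c : R) : 0 < c ->
  flat_exp 1 (n%:R ^+ 2 * c - n%:R) @[n --> \oo] --> (1 : R).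
Proof.
move=> c0; have c1 : (n%:R ^+ 2 * c - n%:R)^-1 @[n --> \oo] --> (0 : R).
  apply/(gtr0_cvgV0 (f := fun n : nat => n%:R ^+ 2 * c - n%:R)).
    near=> n.
    have n1 : c^-1 < n%:R by near: n; exact: nbhs_infty_gtr.
    have n0 : (0 : R) < n%:R by rewrite (lt_trans _ n1)// invr_gt0.
    by rewrite subr_gt0 expr2 -mulrA ltr_pMr// -ltr_pdivrMr// div1r.
  apply/cvgryPge => A; near=> n.
  have n1 : c^-1 * 2 <= n%:R by near: n; exact: nbhs_infty_ger.
  have n2 : A <= n%:R by near: n; exact: nbhs_infty_ger.
  apply: (le_trans n2); rewrite lerBrDr -mulr2n expr2 -mulrA -[leLHS]mulr_natr.
  by rewrite ler_wpM2l// mulrC -ler_pdivrMl.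
have : expR (- (n%:R ^+ 2 * c - n%:R)^-1) @[n --> \oo] --> expR (- 0 : R).
  by apply: continuous_cvg; [exact: continuous_expR|exact: cvgN].
rewrite oppr0 expR0; apply: cvg_trans; apply: near_eq_cvg; near=> n.
have n1 : c^-1 < n%:R by near: n; exact: nbhs_infty_gtr.
have n0 : (0 : R) < n%:R by rewrite (lt_trans _ n1)// invr_gt0.
rewrite /flat_exp subr_gt0 expr2 -mulrA ltr_pMr// -ltr_pdivrMr// div1r n1.
by rewrite hornerC mul1r.
Unshelve. all: by end_near. Qed.

Lemma flat_exp1_eq0 (c : R) (n : nat) : c <= 0 ->
  flat_exp 1 (n%:R ^+ 2 * c - n%:R) = 0.
Proof.
move=> c0; rewrite /flat_exp ltNge (_ : _ <= 0)// subr_le0.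
by rewrite (@le_trans _ _ 0)// mulr_ge0_le0// sqr_ge0.
Qed.

(** Convergence at every point and for all [a] and [b]. If b <= a the limit is the indicator of the
    empty set, which happens when a rectangle is clipped to the domain. *)
Lemma cvg_bump a b x : bump a b n x @[n --> \oo] --> (\1_(`]a, b[%classic) x : R).
Proof.
have [ax|xa] := ltP a x; last first.
  rewrite indicE memNset; last by rewrite /= in_itv/= ltNge xa.
  rewrite (_ : (fun n => _) = fun=> 0); first exact: cvg_cst.
  by apply/funext => n; rewrite /bump flat_exp1_eq0 ?mul0r// subr_le0.
have [xb|bx] := ltP x b; last first.
  rewrite indicE memNset; last by rewrite /= in_itv/= ax ltNge bx.
  rewrite (_ : (fun n => _) = fun=> 0); first exact: cvg_cst.
  by apply/funext => n; rewrite /bump mulrC flat_exp1_eq0 ?mul0r// subr_le0.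
rewrite indicE mem_set/=; last by rewrite /= in_itv/= ax xb.
rewrite -[X in _ --> X](mulr1 1); apply: cvgM; apply: cvg_flat_exp1; by rewrite subr_gt0.
Qed.

End smooth_line.

Lemma ItvE (R : realType) (L x : R) : Itv L x = (0 < x < L) :> Prop.
Proof. by rewrite /Itv /= in_itv. Qed.

(** * Continuous functions on the plane: measurability, bounds, slices *)

Section continuous_plane.
Context (R : realType).
Local Notation RR := (measurableTypeR R * measurableTypeR R)%type.

(** Links the topology of the plane to the product sigma-algebra: balls are squares, and an open set
    is the union of the countably many squares with rational centre and radius 1/(n+1) that it
    contains. *)
Lemma open_measurable_plane (U : set (R * R)) : open U -> measurable (U : set RR).
Proof.
move=> oU.
pose B (q : rat * rat * nat) : set RR :=
  ball (ratr q.1.1 : R) (q.2.+1%:R^-1 : R) `*` ball (ratr q.1.2 : R) (q.2.+1%:R^-1 : R).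
have -> : U = \bigcup_q (if `[< B q `<=` U >] then B q else set0).
  apply/seteqP; split => [p Up|p [q _]]; last first.
    by case: ifPn => // /asboolP qU /qU.
  have /nbhs_ballP[e /= e0 eU] : nbhs p U by exact: open_nbhs_nbhs.
  (* Half of [e], because a square of radius [d] centred within [d] of [p] reaches up to [2 * d]
     away from [p]. *)
  have [n ne] : exists n : nat, n.+1%:R^-1 < e / 2.
    have e2 : 0 < e / 2 by rewrite divr_gt0.
    have [n _ h] := near_infty_natSinv_lt (PosNum e2).
    by exists n; exact: (h n (leqnn n)).
  pose d : R := n.+1%:R^-1; have d0 : 0 < d by rewrite invr_gt0 ltr0n.
  have rat_near (x : R) : exists q : rat, ball (ratr q : R) d x.
    have [|q] := @rat_in_itvoo R (x - d) (x + d).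
      by rewrite ltrBlDr -addrA ltrDl addr_gt0.
    rewrite in_itv/= => /andP[h1 h2]; exists q.
    by rewrite /ball/= ltr_norml; apply/andP; split; lra.
  have [q1 b1] := rat_near p.1; have [q2 b2] := rat_near p.2.
  exists (q1, q2, n) => //; rewrite ifT; first by [].
  have near_near (q x x' : R) : ball q d x -> ball q d x' -> ball x e x'.
    rewrite /ball/= !ltr_norml => /andP[h1 h2] /andP[h3 h4].
    by move: (ne); rewrite -/d => nd; apply/andP; split; lra.
  by apply/asboolP => y [/= y1 y2]; apply: eU; split; [exact: near_near b1 y1|exact: near_near b2 y2].
apply: countable_bigcupT_measurable; first exact: countableP.
move=> q; case: ifPn => // _; apply: measurableX; exact: measurable_ball.
Qed.

Lemma continuous_measurable_plane (f : R * R -> R) : continuous f ->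
  measurable_fun setT (f : RR -> R).
Proof.
move=> /continuousP cf; apply: (measurability _ (RGenOpens.measurableE R)).
move=> _ [_ [a [b ->] <-]]; rewrite setTI; apply: open_measurable_plane.
exact/cf/interval_open.
Qed.

Lemma continuous_bounded_rectangle (f : R * R -> R) (a b c d : R) : continuous f ->
  exists2 M : R, 0 <= M & forall x z, a <= x <= b -> c <= z <= d -> `|f (x, z)| <= M.
Proof.
move=> cf; have /compact_bounded[M [_ hM]] :
    compact (f @` (`[a, b]%classic `*` `[c, d]%classic)).
  apply: continuous_compact; first exact: continuous_subspaceT.
  by apply: compact_setX; exact: segment_compact.
exists (`|M| + 1) => [|x z xab zcd]; first by rewrite addr_ge0.
apply: hM; first by rewrite (le_lt_trans (ler_norm _))// ltrDl.
by exists (x, z) => //; split; rewrite /= in_itv.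
Qed.

Lemma continuous_bounded_segment (f : R -> R) (a b : R) : continuous f ->
  exists2 M : R, 0 <= M & forall x, a <= x <= b -> `|f x| <= M.
Proof.
move=> cf; have /compact_bounded[M [_ hM]] : compact (f @` `[a, b]%classic).
  apply: continuous_compact; first exact: continuous_subspaceT.
  exact: segment_compact.
exists (`|M| + 1) => [|x xab]; first by rewrite addr_ge0.
apply: hM; first by rewrite (le_lt_trans (ler_norm _))// ltrDl.
by exists x => //; rewrite /= in_itv.
Qed.

Lemma L2_bounded d (T : measurableType d) (mu : {measure set T -> \bar R})
    (D : set T) (u : T -> R) (M : R) : measurable D -> (mu D < +oo)%E ->
  measurable_fun D u -> (forall x, D x -> `|u x| <= M) -> L2 mu D u.
Proof.
move=> mD fD mfu uM; apply/(L2P _ mD); split => //.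
apply: (intg_le mD _ (L2_sqr_integrable mD (L2_cst mD fD M))).
  exact: measurable_funX.
by move=> x Dx; rewrite !normrX lerXn2r ?nnegrE// (le_trans (uM _ Dx))// ler_norm.
Qed.

Lemma continuous_L2_Itv (f : R -> R) (L : R) : continuous f -> L2 (mu1 R) (Itv L) f.
Proof.
move=> cf; have [M _ fM] := continuous_bounded_segment 0 L cf.
apply: (@L2_bounded _ _ _ _ _ M).
- exact: measurable_Itv.
- exact: mu1_Itv_fin.
- by apply: measurable_funTS; exact: continuous_measurable_fun.
- by move=> x; rewrite ItvE => /andP[/ltW x0 /ltW xL]; apply: fM; rewrite x0.
Qed.

Lemma continuous_L2_Omega (f : R * R -> R) (Lx Lz : R) : 0 < Lx -> 0 < Lz ->
  continuous f -> L2 (mu2 R) (Omega Lx Lz) f.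
Proof.
move=> hLx hLz cf; have [M _ fM] := continuous_bounded_rectangle 0 Lx 0 Lz cf.
apply: (@L2_bounded _ _ _ _ _ M).
- exact: measurable_Omega.
- exact: mu2_Omega_fin.
- by apply: measurable_funTS; exact: continuous_measurable_plane.
- move=> [x z] [/=]; rewrite !ItvE => /andP[/ltW x0 /ltW xL] /andP[/ltW z0 /ltW zL].
  by apply: fM; [rewrite x0|rewrite z0].
Qed.

Lemma FTC_Itv (h : R -> R) (L : R) : 0 < L -> (forall x : R, derivable h x 1) ->
  continuous ('D_1 h) -> \int[mu1 R]_(x in Itv L) 'D_1 h x = h L - h 0.
Proof.
move=> L0 dh cdh; have ch := derivable_continuous dh.
have i1 : lebesgue_measure.-integrable `[0, L]%classic (EFin \o 'D_1 h).
  by apply: continuous_compact_integrable; [exact: segment_compact|exact: continuous_subspaceT].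
have -> : \int[mu1 R]_(x in Itv L) 'D_1 h x = \int[lebesgue_measure]_(x in `[0, L]) 'D_1 h x.
  rewrite -Rintegral_itv_obnd_cbnd; last first.
    apply: integrableS i1 => //.
    by move=> x /=; rewrite !in_itv/= => /andP[/ltW -> ->].
  rewrite -Rintegral_itv_bndo_bndc//.
  apply: integrableS i1 => //.
  by move=> x /=; rewrite !in_itv/= => /andP[/ltW -> /ltW ->].
rewrite /Rintegral (@continuous_FTC2 _ _ h) //.
- exact: continuous_subspaceT.
- split => [x _||]; first exact: dh.
  + exact/cvg_at_right_filter/ch.
  + exact/cvg_at_left_filter/ch.
- by move=> x _; rewrite derive1E.
Qed.

Lemma derive_slice1 (g : R * R -> R) (x z : R) : smooth g ->
  derivable (fun y => g (y, z)) x 1 /\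
  'D_1 (fun y => g (y, z)) x = 'D_(1, 0) g (x, z).
Proof.
move=> sg; have hA : forall (h : R) (v y : R),
    (h *: v + y, z) = h *: (v, 0 : R) + (y, z) :> R * R.
  by move=> h v y; congr (_, _) => /=; rewrite scaler0 add0r.
have [e1 e2] := @derive_comp_affine R R (R * R)%type (fun y : R => (y, z)) (fun v : R => (v, 0))
  g 1 x hA.
by split => //; apply: e2; exact: smooth_derivable.
Qed.

Lemma derive_slice2 (g : R * R -> R) (x z : R) : smooth g ->
  derivable (fun y => g (x, y)) z 1 /\
  'D_1 (fun y => g (x, y)) z = 'D_(0, 1) g (x, z).
Proof.
move=> sg; have hA : forall (h : R) (v y : R),
    (x, h *: v + y) = h *: (0 : R, v) + (x, y) :> R * R.
  by move=> h v y; congr (_, _) => /=; rewrite scaler0 add0r.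
have [e1 e2] := @derive_comp_affine R R (R * R)%type (fun y : R => (x, y)) (fun v : R => (0, v))
  g 1 z hA.
by split => //; apply: e2; exact: smooth_derivable.
Qed.

Lemma continuous_slice1 (g : R * R -> R) (z : R) : continuous g -> continuous (fun y => g (y, z)).
Proof.
move=> cg y; apply: (@continuous_comp _ _ _ (fun y : R => (y, z)) g y _ (cg _)).
by apply: (@cvg_pair _ _ _ (nbhs y) (nbhs y) (nbhs z) _ _ _ id (cst z)) => //; exact: cvg_cst.
Qed.

Lemma continuous_slice2 (g : R * R -> R) (x : R) : continuous g -> continuous (fun y => g (x, y)).
Proof.
move=> cg y; apply: (@continuous_comp _ _ _ (fun y : R => (x, y)) g y _ (cg _)).
by apply: (@cvg_pair _ _ _ (nbhs y) (nbhs x) (nbhs y) _ _ _ (cst x) id) => //; exact: cvg_cst.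
Qed.

Lemma FTC_slice1 (g : R * R -> R) (L z : R) : 0 < L -> smooth g ->
  \int[mu1 R]_(x in Itv L) 'D_(1, 0) g (x, z) = g (L, z) - g (0, z).
Proof.
move=> L0 sg; under eq_Rintegral => x _ do rewrite -(derive_slice1 x z sg).2.
rewrite FTC_Itv//; first by move=> x; exact: (derive_slice1 x z sg).1.
rewrite (_ : 'D_(1 : R) _ = fun x => 'D_(1, 0) g (x, z)).
  by apply: (@continuous_slice1 ('D_(1, 0) g)); apply: smooth_continuous; exact: smooth_derive.
by apply/funext => x; exact: (derive_slice1 x z sg).2.
Qed.

Lemma FTC_slice2 (g : R * R -> R) (L x : R) : 0 < L -> smooth g ->
  \int[mu1 R]_(z in Itv L) 'D_(0, 1) g (x, z) = g (x, L) - g (x, 0).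
Proof.
move=> L0 sg; under eq_Rintegral => z _ do rewrite -(derive_slice2 x z sg).2.
rewrite FTC_Itv//; first by move=> z; exact: (derive_slice2 x z sg).1.
rewrite (_ : 'D_(1 : R) _ = fun z => 'D_(0, 1) g (x, z)).
  by apply: (@continuous_slice2 ('D_(0, 1) g)); apply: smooth_continuous; exact: smooth_derive.
by apply/funext => z; exact: (derive_slice2 x z sg).2.
Qed.

End continuous_plane.

(** * The fundamental lemma of the calculus of variations *)

Section fundamental_lemma.
Context (R : realType) (Lx Lz : R).
Hypotheses (hLx : 0 < Lx) (hLz : 0 < Lz).
Local Notation RR := (measurableTypeR R * measurableTypeR R)%type.
Local Notation Om := (Omega Lx Lz).
Local Notation m2 := (mu2 R).
Local Notation mO := (measurable_Omega Lx Lz).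
Local Notation fO := (mu2_Omega_fin hLx hLz).

(** A pi-system generating the product sigma-algebra; smooth bumps approximate the indicators of its
    members. *)
Definition open_rectangle : set (set RR) :=
  [set A `*` B | A in @RGenOpens.G R & B in @RGenOpens.G R].

Lemma itvooI (a b c d : R) :
  `]a, b[%classic `&` `]c, d[%classic = `]Num.max a c, Num.min b d[%classic :> set R.
Proof.
apply/seteqP; split => x /=; rewrite !in_itv/= gt_max lt_min.
  by move=> [/andP[-> ->] /andP[-> ->]].
by move=> /andP[/andP[-> ->] /andP[-> ->]].
Qed.

Lemma open_rectangleI : setI_closed open_rectangle.
Proof.
move=> _ _ [_ [a1 [b1 ->]] [_ [c1 [d1 ->]] <-]] [_ [a2 [b2 ->]] [_ [c2 [d2 ->]] <-]].
rewrite -setXI !itvooI; eexists; first by do 2 eexists.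
by eexists; first by do 2 eexists.
Qed.

Lemma itvoo_bigcup : [set: R] = \bigcup_n `](- n%:R), n%:R[%classic.
Proof.
apply/seteqP; split => // x _.
have [n xn] : exists n : nat, `|x| < n%:R.
  by exists (Num.truncn `|x|).+1; rewrite truncnS_gt.
by exists n => //=; rewrite in_itv/= -ltr_norml.
Qed.

(** Both projections are measurable for the generated sigma-algebra, since a strip is the union of
    the rectangles obtained by cutting it at -n and n. *)
Lemma measurable_open_rectangle : measurable `<=` <<s open_rectangle >>.
Proof.
pose T' := g_sigma_algebraType open_rectangle.
have m1 : measurable_fun setT (fst : T' -> measurableTypeR R).
  apply: (measurability _ (RGenOpens.measurableE R)) => _ [_ [a [b ->] <-]].
  rewrite setTI; have -> : fst @^-1` `]a, b[%classic =
      \bigcup_n (`]a, b[%classic `*` `](- n%:R), n%:R[%classic) :> set T'.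
    apply/seteqP; split => [[x z] /= xab|[x z] [n _ [/= ]]//].
    have : [set: R] z by []. rewrite itvoo_bigcup => -[n _ zn]; by exists n.
  apply: bigcup_measurable => n _; apply: sub_sigma_algebra.
  exists (`]a, b[%classic); first by do 2 eexists.
  by eexists; first by do 2 eexists.
have m2 : measurable_fun setT (snd : T' -> measurableTypeR R).
  apply: (measurability _ (RGenOpens.measurableE R)) => _ [_ [a [b ->] <-]].
  rewrite setTI; have -> : snd @^-1` `]a, b[%classic =
      \bigcup_n (`](- n%:R), n%:R[%classic `*` `]a, b[%classic) :> set T'.
    apply/seteqP; split => [[x z] /= xab|[x z] [n _ [/= ]]//].
    have : [set: R] x by []. rewrite itvoo_bigcup => -[n _ zn]; by exists n.
  apply: bigcup_measurable => n _; apply: sub_sigma_algebra.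
  eexists; first by do 2 eexists.
  by eexists; first by do 2 eexists.
rewrite measurable_prod_measurableType; apply: smallest_sub.
  exact: smallest_sigma_algebra.
move=> _ [A mA [B mB <-]].
have -> : A `*` B = (setT `&` fst @^-1` A) `&` (setT `&` snd @^-1` B) :> set T'.
  by rewrite !setTI.
by apply: (@measurableI _ T'); [exact: m1|exact: m2].
Qed.

(** Dynkin's argument: the sets on which [w] integrates to 0 form a lambda-system containing the
    rectangles. The vanishing of the total integral is what gives stability under complement. *)
Lemma integral_eq0_all (w : RR -> R) : m2.-integrable setT (EFin \o w) ->
  (forall a b c d, \int[m2]_(p in `]a, b[%classic `*` `]c, d[%classic) w p = 0) ->
  \int[m2]_p w p = 0 ->
  forall E, measurable E -> \int[m2]_(p in E) w p = 0.
Proof.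
move=> iw w0 wT E mE.
pose H := [set A : set RR | measurable A /\ \int[m2]_(p in A) w p = 0].
have iwA A : measurable A -> m2.-integrable A (EFin \o w).
  by move=> mA; apply: integrableS iw.
suff : <<s open_rectangle >> `<=` H by move=> /(_ E (measurable_open_rectangle mE))[].
apply: (@lambda_system_subset _ _ open_rectangleI setT) => //.
- apply/dynkin_lambda_system; split => //.
  + move=> A [mA A0]; split; first exact: measurableC.
    have := @Rintegral_setU _ _ _ m2 A (~` A) w mA (measurableC mA).
    rewrite setUCr wT A0 add0r => <- //.
    exact/disj_setPCl.
  + move=> F tF hF; have mF k : measurable (F k) by have [] := hF k.
    have mUF : measurable (\bigcup_k F k) by exact: bigcup_measurable.
    split => //; rewrite /Rintegral (integral_bigcup tF mF); last exact: iwA.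
    rewrite eseries0// => i _ _; have [_] := hF i.
    rewrite /Rintegral => /eqP; rewrite fine_eq0 => [/eqP//|].
    by apply: integrable_fin_num => //; exact: iwA.
- move=> _ [_ [a [b ->]] [_ [c [d ->]] <-]]; split; last exact: w0.
  by apply: measurableX; exact: measurable_itv.
Qed.

Lemma smooth_fst (g : R -> R) : smooth g -> smooth (fun p : R * R => g p.1).
Proof.
apply: (@smooth_comp_affine _ _ _ (fst : R * R -> R) (fst : R * R -> R)) => //.
by move=> p; exact: cvg_fst.
Qed.

Lemma smooth_snd (g : R -> R) : smooth g -> smooth (fun p : R * R => g p.2).
Proof.
apply: (@smooth_comp_affine _ _ _ (snd : R * R -> R) (snd : R * R -> R)) => //.
by move=> p; exact: cvg_snd.
Qed.

Lemma bump_test_fun (a b c d : R) n : (0 < n)%N ->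
  0 <= a -> b <= Lx -> 0 <= c -> d <= Lz ->
  test_fun Om (fun p => bump a b n p.1 * bump c d n p.2).
Proof.
move=> n0 a0 bL c0 dL; split.
  by apply: smoothM; [apply: smooth_fst|apply: smooth_snd]; exact: smooth_bump.
have n1 : (0 : R) < n%:R^-1 by rewrite invr_gt0 ltr0n.
exists (`[a + n%:R^-1, b - n%:R^-1]%classic `*` `[c + n%:R^-1, d - n%:R^-1]%classic).
split; first by apply: compact_setX; exact: segment_compact.
  move=> [x z] [/=]; rewrite !in_itv/= => /andP[x1 x2] /andP[z1 z2].
  by split; rewrite ItvE/=; apply/andP; split; lra.
move=> p np; have [h1|h1] := pselect (`[a + n%:R^-1, b - n%:R^-1]%classic p.1).
  rewrite mulrC bump_support ?mul0r// => h2; exact: np.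
by rewrite bump_support ?mul0r.
Qed.

(** Products of bumps increase no integral beyond that of |w| and converge to indicators of
    rectangles, so dominated convergence makes [w] integrate to 0 on every open rectangle, then on
    every measurable set. *)
Lemma fundamental_lemma (w : R * R -> R) : L2 m2 Om w ->
  (forall eta, test_fun Om eta -> \int[m2]_(p in Om) (w p * eta p) = 0) ->
  ae_eq m2 Om w (cst 0).
Proof.
move=> Lw hw; have iw := L2_intg mO fO Lw.
have mw := L2_measurable mO Lw.
have iwT := integrable_Omega iw.
have rect a b c d : \int[m2]_(p in `]a, b[%classic `*` `]c, d[%classic) (w \_ Om) p = 0.
  have mR : measurable (`]a, b[%classic `*` `]c, d[%classic : set RR).
    by apply: measurableX; exact: measurable_itv.
  (* The rectangle is clipped to the domain so that the products of bumps are supported inside it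
     and are admissible test functions. *)
  pose a' := Num.max a 0; pose b' := Num.min b Lx.
  pose c' := Num.max c 0; pose d' := Num.min d Lz.
  pose f n p : R := w p * (bump a' b' n p.1 * bump c' d' n p.2).
  pose g p : R := w p * (\1_(`]a', b'[%classic) p.1 * \1_(`]c', d'[%classic) p.2).
  have fg : (\int[m2]_(p in Om) (f n p)%:E)%E @[n --> \oo] --> (\int[m2]_(p in Om) (g p)%:E)%E.
    apply: (@dominated_cvg _ _ _ m2 Om mO (fun n p => (f n p)%:E) _ (fun p => `|(w p)%:E|%E)) => //.
    - move=> n; apply/measurable_EFinP/measurable_funM => //.
      apply: measurable_funTS; apply: continuous_measurable_plane.
      apply: (@smooth_continuous _ _ (fun p : R * R => bump a' b' n p.1 * bump c' d' n p.2)).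
      by apply: smoothM; [apply: smooth_fst|apply: smooth_snd]; exact: smooth_bump.
    - move=> p _; apply: cvg_EFin; first exact: nearW.
      apply: cvgM; first exact: cvg_cst.
      by apply: cvgM; exact: cvg_bump.
    - exact: integrable_abse.
    - move=> n p _; rewrite /= lee_fin /f normrM ler_piMr//.
      rewrite ger0_norm; first by rewrite mulr_ile1 ?bump_ge0 ?bump_le1.
      by apply: mulr_ge0; exact: bump_ge0.
  have f0 n : (0 < n)%N -> (\int[m2]_(p in Om) (f n p)%:E)%E = 0.
    move=> n0; have tf : test_fun Om (fun p => bump a' b' n p.1 * bump c' d' n p.2).
      by apply: bump_test_fun; rewrite // ?le_max ?ge_min ?lexx ?orbT.
    have := hw _ tf; rewrite /Rintegral => /eqP; rewrite fine_eq0 => [/eqP//|].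
    have Lb : L2 m2 Om (fun p => bump a' b' n p.1 * bump c' d' n p.2).
      by apply: continuous_L2_Omega => //; apply: (@smooth_continuous _ (R * R)%type); exact: tf.1.
    exact: (integrable_fin_num mO (L2_intgM mO Lw Lb)).
  have g0 : (\int[m2]_(p in Om) (g p)%:E)%E = 0.
    apply: cvg_unique fg _ => //; apply: cvg_near_cst.
    by exists 1%N => // n /= n0; rewrite f0.
  rewrite (_ : \int[m2]_(p in _) _ = \int[m2]_(p in Om) g p); first by rewrite /Rintegral g0.
  rewrite Rintegral_mkcond [RHS]Rintegral_mkcond; apply: eq_Rintegral => -[x z] _.
  rewrite /patch; have [/set_mem[/= hx hz]|hO] := boolP ((x, z) \in Om); last by case: ifP.
  have -> : ((x, z) \in `]a, b[%classic `*` `]c, d[%classic) =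
      (x \in `]a, b[%classic) && (z \in `]c, d[%classic).
    apply/idP/andP => [/set_mem[/= xab zcd]|[/set_mem xab /set_mem zcd]]; last exact: mem_set.
    by split; exact: mem_set.
  rewrite /g !indicE /= -!itvooI !in_setI [x \in `]0, Lx[%classic]mem_set//.
  rewrite [z \in `]0, Lz[%classic]mem_set// !andbT.
  case: ifPn => [/andP[xab zcd]|/nandP[/negbTE xab|/negbTE zcd]].
  - by rewrite xab zcd !mulr1.
  - by rewrite xab mul0r mulr0.
  - by rewrite zcd !mulr0.
have hE E : measurable E -> \int[m2]_(p in E) (w \_ Om) p = 0.
  apply: integral_eq0_all => //.
  have := rect 0 Lx 0 Lz; rewrite Rintegral_mkcond => <-.
  by apply: eq_Rintegral => p _; rewrite /patch; case: ifP.
have : ae_eq m2 Om (EFin \o w) (EFin \o (fun=> 0)).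
  apply: (@integral_ae_eq _ _ _ m2 Om mO (EFin \o (fun=> 0)) (EFin \o w) iw) => [|E EO mE].
    exact: measurable_cst.
  rewrite [RHS]integral0.
  have : \int[m2]_(p in E) w p = 0.
    rewrite -(hE E mE); apply: eq_Rintegral => p /set_mem/EO Op.
    by rewrite patchE mem_set.
  rewrite /Rintegral => /eqP; rewrite fine_eq0 => [/eqP//|].
  by apply: integrable_fin_num => //; exact: integrableS iw.
by apply: aeS => p h /h /= [].
Qed.

End fundamental_lemma.

(** * Tools for limits, selected derivatives and bounded coefficients *)

Lemma cvg_L2prod d (T : measurableType d) (R : realType)
    (mu : {measure set T -> \bar R}) (D : set T) (u : nat -> T -> R) (v w : T -> R) :
  measurable D -> (forall n, L2 mu D (u n)) -> L2 mu D v -> L2 mu D w ->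
  L2norm mu D (fun x => u n x - v x) @[n --> \oo] --> (0 : R) ->
  L2prod mu D (u n) w @[n --> \oo] --> L2prod mu D v w.
Proof.
move=> mD Lu Lv Lw uv; apply/subr_cvg0.
apply: (@squeeze_cvgr _ _ _ _ (fun n => - (L2norm mu D (fun x => u n x - v x) * L2norm mu D w))
  (fun n => L2norm mu D (fun x => u n x - v x) * L2norm mu D w)).
- apply: nearW => n; rewrite -L2prodBl// -ler_norml.
  by apply: L2_CauchySchwarz => //; exact: L2B.
- by rewrite -oppr0; apply: cvgN; rewrite -(mul0r (L2norm mu D w)); apply: cvgM => //; exact: cvg_cst.
- by rewrite -(mul0r (L2norm mu D w)); apply: cvgM => //; exact: cvg_cst.
Qed.

(* Sealed copies of the selected weak derivatives: comparing [wdx u] with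
   [wdz u] by conversion does not terminate in practice. *)
Fact weak_dx_seal (R : realType) (Lx Lz : R) :
  {D : (R * R -> R) -> (R * R -> R) | D = wdx Lx Lz}.
Proof. by exists (wdx Lx Lz). Qed.

Fact weak_dz_seal (R : realType) (Lx Lz : R) :
  {D : (R * R -> R) -> (R * R -> R) | D = wdz Lx Lz}.
Proof. by exists (wdz Lx Lz). Qed.

Fact weak_d1_seal (R : realType) (Lx : R) : {D : (R -> R) -> (R -> R) | D = wd1 Lx}.
Proof. by exists (wd1 Lx). Qed.

Definition weak_dx (R : realType) (Lx Lz : R) := sval (weak_dx_seal Lx Lz).
Definition weak_dz (R : realType) (Lx Lz : R) := sval (weak_dz_seal Lx Lz).
Definition weak_d1 (R : realType) (Lx : R) := sval (weak_d1_seal Lx).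

Lemma weak_dxE (R : realType) (Lx Lz : R) : wdx Lx Lz = weak_dx Lx Lz.
Proof. by rewrite /weak_dx; case: weak_dx_seal. Qed.

Lemma weak_dzE (R : realType) (Lx Lz : R) : wdz Lx Lz = weak_dz Lx Lz.
Proof. by rewrite /weak_dz; case: weak_dz_seal. Qed.

Lemma weak_d1E (R : realType) (Lx : R) : wd1 Lx = weak_d1 Lx.
Proof. by rewrite /weak_d1; case: weak_d1_seal. Qed.

Lemma weak_dx_spec (R : realType) (Lx Lz : R) u w :
  weak_deriv2 Lx Lz (1, 0) u w -> weak_deriv2 Lx Lz (1, 0) u (weak_dx Lx Lz u).
Proof. by move=> h; rewrite -weak_dxE; exact: (xgetPex (cst 0) (ex_intro _ w h)). Qed.

Lemma weak_dz_spec (R : realType) (Lx Lz : R) u w :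
  weak_deriv2 Lx Lz (0, 1) u w -> weak_deriv2 Lx Lz (0, 1) u (weak_dz Lx Lz u).
Proof. by move=> h; rewrite -weak_dzE; exact: (xgetPex (cst 0) (ex_intro _ w h)). Qed.

Lemma weak_d1_spec (R : realType) (Lx : R) u w :
  weak_deriv1 Lx u w -> weak_deriv1 Lx u (weak_d1 Lx u).
Proof. by move=> h; rewrite -weak_d1E; exact: (xgetPex (cst 0) (ex_intro _ w h)). Qed.

(** Closes the approximation arguments: [C] collects the coefficients of all the errors, and none
    has to be tuned beforehand. *)
Lemma le_of_le_addM (R : realType) (a b C : R) : 0 <= C ->
  (forall e : R, 0 < e -> a <= b + C * e) -> a <= b.
Proof.
move=> C0 h; apply/ler_addgt0Pr => e e0.
have C1 : 0 < C + 1 by rewrite ltr_wpDl.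
apply: le_trans (h (e / (C + 1)) _) _; first by rewrite divr_gt0.
by rewrite lerD2l mulrCA ler_piMr ?(ltW e0)// ler_pdivrMr// mul1r lerDl ler01.
Qed.

Lemma cvg0_choice (R : realType) (T : Type) (P : R -> T -> Prop) :
  (forall e : R, 0 < e -> exists x, P e x) ->
  exists x : nat -> T, forall n, P (n.+1%:R^-1) (x n).
Proof. move=> h; have /choice[x hx] : forall n : nat, exists x, P n.+1%:R^-1 x; last by exists x.
by move=> n; apply: h; rewrite invr_gt0 ltr0n. Qed.

Lemma cvg0_le_inv (R : realType) (u : nat -> R) (C : R) :
  (forall n, 0 <= u n) -> (forall n, u n <= C * n.+1%:R^-1) -> u n @[n --> \oo] --> 0.
Proof.
move=> u0 uC; apply: (@squeeze_cvgr _ _ _ _ (cst 0) (fun n => C * n.+1%:R^-1)).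
- by apply: nearW => n; rewrite u0 uC.
- exact: cvg_cst.
- rewrite -(mulr0 C); apply: cvgM; first exact: cvg_cst.
  exact: cvg_harmonic.
Qed.

Lemma cvg0_le (R : realType) (u : nat -> R) (e : R) : u n @[n --> \oo] --> 0 -> 0 < e ->
  exists n0, forall n, (n0 <= n)%N -> `|u n| <= e.
Proof.
move=> /cvgr0Pnorm_le + e0 => /(_ _ e0)[n0 _ h].
by exists n0 => n /h.
Qed.

Lemma L2norm_lin_sub d (T : measurableType d) (R : realType)
    (mu : {measure set T -> \bar R}) (D : set T) (k : R) (a b a' b' : T -> R) :
  measurable D -> L2 mu D a -> L2 mu D b -> L2 mu D a' -> L2 mu D b' ->
  L2norm mu D (fun x => (k * a x + b x) - (k * a' x + b' x)) <=
  `|k| * L2norm mu D (fun x => a x - a' x) + L2norm mu D (fun x => b x - b' x).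
Proof.
move=> mD La Lb La' Lb'; rewrite -L2normZ//; last exact: L2B.
rewrite [X in L2norm _ _ X <= _](_ : _ = fun x => k * (a x - a' x) + (b x - b' x)).
  by apply: L2norm_triangle => //; [apply: L2Z => //; exact: L2B|exact: L2B].
by apply/funext => x; ring.
Qed.

Lemma subE (R : realType) (S : Type) (u v : S -> R) : (fun p => u p - v p) = (fun p => -1 * v p + u p).
Proof. by apply/funext => p; rewrite mulN1r addrC. Qed.

Lemma addE (R : realType) (S : Type) (u v : S -> R) : (fun p => u p + v p) = (fun p => 1 * u p + v p).
Proof. by apply/funext => p; rewrite mul1r. Qed.

Section bounded_multiplier.
Context d (T : measurableType d) (R : realType).
Variables (mu : {measure set T -> \bar R}) (D : set T).
Hypothesis mD : measurable D.
Implicit Types u v a : T -> R.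

Lemma ae_le_Rintegral u v : mu.-integrable D (EFin \o u) -> mu.-integrable D (EFin \o v) ->
  {ae mu, forall x, D x -> u x <= v x} -> \int[mu]_(x in D) u x <= \int[mu]_(x in D) v x.
Proof.
move=> iu iv uv; rewrite -subr_ge0 -RintegralB//.
have iw := intgB mD iv iu; have mw := intg_measurable iw.
have -> : \int[mu]_(x in D) (v x - u x) = \int[mu]_(x in D) `|v x - u x|.
  congr fine; apply: ae_eq_integral => //.
  - exact/measurable_EFinP.
  - by apply/measurable_EFinP; exact: measurableT_comp.
  - by apply: aeS uv => x h Dx /=; rewrite ger0_norm// subr_ge0 h.
exact: Rintegral_ge0.
Qed.

Lemma L2norm_boundedM a u (M : R) : measurable_fun D a -> 0 <= M ->
  {ae mu, forall x, D x -> `|a x| <= M} -> L2 mu D u ->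
  L2norm mu D (fun x => a x * u x) <= M * L2norm mu D u.
Proof.
move=> ma M0 aM Lu; have Lau := L2_boundedM mD ma aM Lu.
rewrite -ler_sqr ?nnegrE ?mulr_ge0 ?L2norm_ge0// exprMn !L2norm_sqr// /L2prod.
have iu := L2_intgM mD Lu Lu.
rewrite -RintegralZl//; apply: ae_le_Rintegral.
- exact: (L2_intgM mD Lau Lau).
- exact: (intgZ mD (M ^+ 2) iu).
- apply: aeS aM => x h Dx; rewrite mulrACA -!expr2 ler_wpM2r ?sqr_ge0//.
  by rewrite -(real_normK (num_real (a x))) ler_sqr ?nnegrE// h.
Qed.

End bounded_multiplier.

Lemma derive_mul (R : realType) (E : normedModType R) (f g : E -> R) (p v : E) :
  derivable f p v -> derivable g p v ->
  'D_v (fun x => f x * g x) p = f p * 'D_v g p + g p * 'D_v f p.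
Proof. by move=> df dg; exact: (deriveM df dg). Qed.

Lemma derive_shift (R : realType) (L x : R) : 'D_(1 : R) (fun y : R => y - L) x = 1.
Proof. by rewrite -[LHS]/('D_(1 : R) (id - cst L) x) deriveB// derive_id derive_cst subr0. Qed.

Lemma smooth_shift (R : realType) (L : R) : smooth (E := R) (fun x => x - L).
Proof.
case=> [|n]; first by split => // x; apply: cvgB => //; exact: cvg_cst.
apply: CkS_line => [x|]; first exact: derivableB.
rewrite (_ : 'D_(1 : R) (fun y : R => y - L) = fun=> 1); first exact: smooth_cst.
by apply/funext => x; exact: derive_shift.
Qed.

(** Truncation between -M and M. A bound valid everywhere is inherited by every section, which a
    bound valid almost everywhere in the plane is not. *)
Lemma ae_bounded_repr d (T : measurableType d) (R : realType) (mu : {measure set T -> \bar R})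
    (D : set T) (a : T -> R) (M : R) :
  measurable_fun D a -> 0 <= M -> {ae mu, forall x, D x -> `|a x| <= M} ->
  exists b : T -> R, [/\ measurable_fun D b, forall x, `|b x| <= M & ae_eq mu D a b].
Proof.
move=> ma M0 aM; exists (fun p => Num.max (- M) (Num.min (a p) M)); split.
- exact: (measurable_maxr (measurable_cst (- M)) (measurable_minr ma (measurable_cst M))).
- by move=> x; rewrite ler_norml le_max lexx/= ge_max ge_min lexx orbT andbT; lra.
- apply: aeS aM => x h Dx; move: (h Dx); rewrite ler_norml => /andP[h1 h2].
  by rewrite (min_l h2) (max_r h1).
Qed.

(** * Riesz representation *)

Section riesz.
Context (R : realType) (T : Type).
Variables (V : set (T -> R)) (B : (T -> R) -> (T -> R) -> R) (l : (T -> R) -> R).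
Implicit Types (u v w : T -> R).

Definition subspace := V (fun=> 0) /\
  forall (k : R) u v, V u -> V v -> V (fun x => k * u x + v x).

Definition linear_on := forall (k : R) u v, V u -> V v ->
  l (fun x => k * u x + v x) = k * l u + l v.

Definition semi_inner := [/\ forall u v, V u -> V v -> B u v = B v u,
  forall (k : R) u v w, V u -> V v -> V w ->
    B (fun x => k * u x + v x) w = k * B u w + B v w
  & forall u, V u -> 0 <= B u u].

(** One good index per [e] is enough for the minimisation; the clause [n.+1%:R^-1 <= e] makes that
    index late enough for [u n] to be almost minimising as well. *)
Definition form_complete := forall u : nat -> T -> R, (forall n, V (u n)) ->
  (forall e : R, 0 < e -> exists n0, forall m n, (n0 <= m)%N -> (n0 <= n)%N ->
    B (fun x => u m x - u n x) (fun x => u m x - u n x) <= e) ->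
  exists2 v, V v & forall e : R, 0 < e -> exists n,
    B (fun x => u n x - v x) (fun x => u n x - v x) <= e /\ n.+1%:R^-1 <= e.

Hypothesis Vs : subspace.
Hypothesis Bs : semi_inner.

Lemma sub_subspace u v : V u -> V v -> V (fun x => u x - v x).
Proof. by move=> Vu Vv; rewrite subE; exact: Vs.2. Qed.

Lemma form_sqr k u v : V u -> V v ->
  B (fun x => k * u x + v x) (fun x => k * u x + v x) =
  k ^+ 2 * B u u + 2 * k * B u v + B v v.
Proof.
have [sB lB _] := Bs; move=> Vu Vv; have Vw := Vs.2 k _ _ Vu Vv.
by rewrite lB// (sB u)// (sB v)// !lB// (sB v u)//; ring.
Qed.

(** The first-order condition at a minimum. The test value t = -x / (a + 1) makes the expression a
    negative multiple of x^2, and adding 1 avoids dividing by zero when a = 0. *)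
Lemma linear_eq0 (x a : R) : 0 <= a -> (forall t, 0 <= 2 * t * x + t ^+ 2 * a) -> x = 0.
Proof.
move=> a0 h; apply/eqP; rewrite -sqrf_eq0 eq_le sqr_ge0 andbT.
have a1 : 0 < a + 1 by rewrite ltr_wpDl.
have := h (- x / (a + 1)).
have -> : 2 * (- x / (a + 1)) * x + (- x / (a + 1)) ^+ 2 * a =
  - (x ^+ 2 * (a + 2) / (a + 1) ^+ 2) by field; rewrite gt_eqF.
rewrite oppr_ge0 pmulr_lle0 ?invr_gt0 ?exprn_gt0// pmulr_lle0//.
by rewrite ltr_wpDl.
Qed.

(* The solution minimises J(v) = B(v, v) - 2 l(v). *)
Lemma riesz_representation (K : R) : linear_on -> form_complete ->
  (forall v, V v -> - K <= B v v - 2 * l v) ->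
  exists2 u, V u & forall v, V v -> B u v = l v.
Proof.
have [sB lB pB] := Bs; move=> ll cB JK; pose J v := B v v - 2 * l v.
pose E := J @` V; have E0 : has_inf E.
  split; first by exists (J (fun=> 0)); exists (fun=> 0) => //; exact: Vs.1.
  by exists (- K) => _ [v Vv <-]; exact: JK.
pose m := inf E.
have mJ v : V v -> m <= J v by move=> Vv; apply: ge_inf; [exact: E0.2|exists v].
have /choice[u hu] : forall n : nat, exists v, V v /\ J v <= m + n.+1%:R^-1.
  move=> n; have n0 : 0 < n.+1%:R^-1 :> R by rewrite invr_gt0.
  by have [_ [v Vv <-] /ltW] := inf_adherent n0 E0; exists v.
have Vu n := (hu n).1.
have J_lin k v w : V v -> V w ->
    J (fun x => k * v x + w x) = k ^+ 2 * B v v + 2 * k * (B v w - l v) + J w.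
  by move=> Vv Vw; rewrite /J form_sqr// ll//; ring.
have [|v Vv cv] := cB u Vu.
  move=> e e0.
  have [n0 hn] : exists n0, forall n, (n0 <= n)%N -> n.+1%:R^-1 <= e / 4.
    have [n0 _ h] := near_infty_natSinv_lt (PosNum (divr_gt0 e0 (ltr0Sn R 3))).
    by exists n0 => n n0n; apply: ltW; exact: (h n n0n).
  exists n0 => i j /hn hi /hn hj.
  have [_ Ji] := hu i; have [_ Jj] := hu j.
  have Vd := sub_subspace (Vu i) (Vu j).
  (* The midpoint of [u i] and [u j], expanded around [u i]. Its value is at least the infimum,
     which by the parallelogram identity bounds B of the difference by 2/(i+1) + 2/(j+1); hence the
     threshold e / 4. *)
  have par : J (fun x => - 2^-1 * (u i x - u j x) + u i x) =
      4^-1 * B (fun x => u i x - u j x) (fun x => u i x - u j x)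
      - (B (fun x => u i x - u j x) (u i) - l (fun x => u i x - u j x)) + J (u i).
    by rewrite J_lin//; field.
  have pj : J (u j) = B (fun x => u i x - u j x) (fun x => u i x - u j x)
      - 2 * (B (fun x => u i x - u j x) (u i) - l (fun x => u i x - u j x)) + J (u i).
    rewrite -[in LHS](_ : (fun x => -1 * (u i x - u j x) + u i x) = u j).
      by rewrite J_lin//; ring.
    by apply/funext => x; ring.
  have := mJ _ (Vs.2 (- 2^-1) _ _ Vd (Vu i)); rewrite par.
  move: Ji Jj pj hi hj.
  move: (B (fun x => u i x - u j x) (u i) - l (fun x => u i x - u j x)) => y.
  move: (B (fun x => u i x - u j x) (fun x => u i x - u j x)) => x.
  move: (J (u i)) (J (u j)) (i.+1%:R^-1 : R) (j.+1%:R^-1 : R); clearbody m; clear => p q i' j'; lra.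
exists v => // w Vw; apply/eqP; rewrite -subr_eq0; apply/eqP.
(* The coefficient 2 comes from adding two inequalities: [u n + t w] cannot lie more than 1/(n+1)
   below [u n] for the functional, and B is nonnegative at [(u n - v) - t w]. In the sum the terms
   in B(w, u n) cancel, which replaces a passage to the limit in B. *)
apply: (@linear_eq0 _ (2 * B w w)); first by rewrite mulr_ge0// pB.
move=> t; apply/ler_addgt0Pr => e e0.
have [n [h1 h2]] := cv (e / 2) (divr_gt0 e0 (ltr0Sn R 1)).
have Vd := sub_subspace (Vu n) Vv.
have := pB _ (Vs.2 (- t) _ _ Vw Vd); rewrite form_sqr//.
have := mJ _ (Vs.2 t _ _ Vw (Vu n)); rewrite J_lin//.
have -> : B w (fun x => u n x - v x) = B w (u n) - B w v.
  by rewrite sB// subE lB// (sB v)// (sB (u n))//; ring.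
have [_ Jn] := hu n; rewrite (sB v)//.
move: h1 h2 Jn; clearbody m.
move: (B w (u n)) (B w v) (B w w) (l w) (J (u n)) n.+1%:R^-1 (B (fun x => _) _) => a b c d j k x.
by clear; nra.
Qed.

End riesz.

Lemma cvg_at_right0 (R : realType) (G : R -> R) :
  (forall e : R, 0 < e -> exists2 eps0 : R, 0 < eps0 &
     forall eps : R, 0 < eps < eps0 -> `|G eps| <= e) ->
  G eps @[eps --> 0^'+] --> (0 : R).
Proof.
move=> h; apply/cvgr0Pnorm_le => e /h[eps0 e0 he]; near=> eps; apply: he.
by apply/andP; split; [near: eps; exact: nbhs_right_gt|near: eps; exact: nbhs_right_lt].
Unshelve. all: by end_near. Qed.

(** Bounded functionals are continuous, so the weak convergences follow from the norm convergences
    that the energy estimate yields. The constant |K| + 1 is positive even if [K] is not. *)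
Lemma weak_cvg0_strong (R : realType) (T : Type) (H : set (T -> R)) (Nm : (T -> R) -> R)
    (u : R -> T -> R) (u0 : T -> R) :
  (forall v, 0 <= Nm v) -> (forall eps : R, 0 < eps -> H (u eps)) -> H u0 ->
  (forall v w, H v -> H w -> H (fun x => v x - w x)) ->
  (forall e : R, 0 < e -> exists2 eps0 : R, 0 < eps0 &
     forall eps : R, 0 < eps < eps0 -> Nm (fun x => u eps x - u0 x) <= e) ->
  weak_cvg0 H Nm u u0.
Proof.
move=> Nm0 Hu H0 Hsub h ell lin [K hK]; apply/subr_cvg0; apply: cvg_at_right0 => e e0.
have K1 : 0 < `|K| + 1 by rewrite ltr_wpDl.
have [eps0 p0 he] := h _ (divr_gt0 e0 K1); exists eps0 => // eps heps.
have [eps_gt0 _] := andP heps; have Hd := Hsub _ _ (Hu _ eps_gt0) H0.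
have -> : ell (u eps) - ell u0 = ell (fun x => u eps x - u0 x).
  by rewrite subE lin ?mulN1r 1?addrC//; exact: Hu.
apply: le_trans (hK _ Hd) _; have := he _ heps.
set a := Nm _ => ha; have a0 : 0 <= a by exact: Nm0.
apply: (@le_trans _ _ ((`|K| + 1) * a)).
  by rewrite ler_wpM2r// (le_trans (ler_norm K))// lerDl.
by rewrite mulrC -ler_pdivlMr.
Qed.

(** * Weak derivatives and the spaces V and W *)

Section rectangle.
Context (R : realType) (Lx Lz : R).
Hypotheses (hLx : 0 < Lx) (hLz : 0 < Lz).
Local Notation Iz := (Itv Lz).
Local Notation Om := (Omega Lx Lz).
Local Notation m1 := (mu1 R).
Local Notation m2 := (mu2 R).
Local Notation mO := (measurable_Omega Lx Lz).
Local Notation wd2 := (weak_deriv2 Lx Lz).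
Local Notation dx := (weak_dx Lx Lz).
Local Notation dz := (weak_dz Lx Lz).
Local Notation N := (L2norm m2 Om).
Local Notation Nz := (L2norm m1 Iz).
Local Notation V := (spaceV Lx Lz).
Local Notation ex := ((1, 0) : R * R).
Local Notation ez := ((0, 1) : R * R).
Local Notation H1 := (H1_2 Lx Lz).
Local Notation "u =m2 v" := (ae_eq m2 Om u v) (at level 70).
Local Notation Ix := (Itv Lx).
Local Notation mI := (measurable_Itv Lx).
Local Notation mIz := (measurable_Itv Lz).
Local Notation d1 := (weak_d1 Lx).
Local Notation N1 := (L2norm m1 Ix).
Local Notation W := (spaceW Lx).
Local Notation mean := (meanz Lz).
Local Notation "u =m1 v" := (ae_eq m1 Ix u v) (at level 70).
Local Notation RR := (measurableTypeR R * measurableTypeR R)%type.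
Local Notation fl := (fluct Lz).
Local Notation fO := (mu2_Omega_fin hLx hLz).
Implicit Types (u v w g phi psi : R * R -> R) (h : R -> R).

Definition axis (dir : R * R) := dir = (1, 0) \/ dir = (0, 1).

Lemma test_fun_eq0 eta p : test_fun Om eta -> ~ Om p -> eta p = 0.
Proof. by move=> [_ [K [_ KO K0]]] Op; apply: K0 => /KO. Qed.

Lemma smooth_L2 g : smooth g -> L2 m2 Om g.
Proof. by move=> /smooth_continuous; exact: continuous_L2_Omega. Qed.

Lemma test_fun_L2 eta : test_fun Om eta -> L2 m2 Om eta.
Proof. by move=> [/smooth_L2]. Qed.

Lemma test_fun_derive_L2 dir eta : test_fun Om eta -> L2 m2 Om ('D_dir eta).
Proof. by move=> [/(smooth_derive dir)/smooth_L2]. Qed.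

(** Integrate first along [dir]: the fundamental theorem leaves values at the end points, which lie
    outside the open rectangle, where [g] vanishes. *)
Lemma integral_derive_eq0 dir g : axis dir -> smooth g ->
  (forall p, ~ Om p -> g p = 0) -> \int[m2]_(p in Om) 'D_dir g p = 0.
Proof.
move=> ax sg g0; have iD := L2_intg mO fO (smooth_L2 (smooth_derive dir sg)).
have edge0 (L : R) : ~ Itv L L by rewrite ItvE ltxx andbF.
have edge1 (L : R) : ~ Itv L 0 by rewrite ItvE ltxx.
case: ax => e; rewrite e in iD *.
- rewrite Fubini_Omega2// (@eq_Rintegral _ _ _ _ _ (cst 0)); last first.
    move=> z _; rewrite FTC_slice1// !g0 ?subrr//.
    + by move=> [/= /edge1].
    + by move=> [/= /edge0].
  by rewrite /= Rintegral_cst ?mul0r//; exact: measurable_Itv.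
- rewrite Fubini_Omega// (@eq_Rintegral _ _ _ _ _ (cst 0)); last first.
    move=> x _; rewrite FTC_slice2// !g0 ?subrr//.
    + by move=> [_ /= /edge1].
    + by move=> [_ /= /edge0].
  by rewrite /= Rintegral_cst ?mul0r//; exact: measurable_Itv.
Qed.

Lemma smooth_weak_deriv dir g : axis dir -> smooth g -> wd2 dir g ('D_dir g).
Proof.
move=> ax sg; have LDg := smooth_L2 (smooth_derive dir sg).
split => // eta te; have [se _] := te.
have := integral_derive_eq0 ax (smoothM sg se) _.
have -> : \int[m2]_(p in Om) 'D_dir (fun p => g p * eta p) p =
    \int[m2]_(p in Om) (g p * 'D_dir eta p + 'D_dir g p * eta p).
  apply: eq_Rintegral => p _; rewrite -[LHS]/('D_dir (g * eta) p) deriveM; try exact: smooth_derivable.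
  by rewrite [_ *: 'D_dir g p]mulrC.
rewrite RintegralD//; last 2 first.
- exact: (L2_intgM mO (smooth_L2 sg) (test_fun_derive_L2 dir te)).
- exact: (L2_intgM mO LDg (test_fun_L2 te)).
move=> h; apply/eqP; rewrite -addr_eq0; apply/eqP; apply: h => p Op.
by rewrite (test_fun_eq0 te Op) mulr0.
Qed.

Lemma weak_deriv2_uniq dir u w1 w2 : wd2 dir u w1 -> wd2 dir u w2 -> ae_eq m2 Om w1 w2.
Proof.
move=> [L1 h1] [L2' h2]; apply/(L2norm_sub_eq0 mO) => //; apply/(L2norm_eq0 mO).
  exact: L2B.
apply: fundamental_lemma => //; first exact: L2B.
move=> eta te; have Le := test_fun_L2 te.
rewrite -[LHS]/(L2prod m2 Om (fun p => w1 p - w2 p) eta) L2prodBl//.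
apply/eqP; rewrite subr_eq0 -eqr_opp; apply/eqP.
by rewrite /L2prod -(h1 _ te) -(h2 _ te).
Qed.

Lemma weak_deriv2_lin dir k u v wu wv : L2 m2 Om u -> L2 m2 Om v ->
  wd2 dir u wu -> wd2 dir v wv ->
  wd2 dir (fun p => k * u p + v p) (fun p => k * wu p + wv p).
Proof.
move=> Lu Lv [Lwu hu] [Lwv hv]; split; first exact: L2_lin.
move=> eta te; have Le := test_fun_L2 te; have LDe := test_fun_derive_L2 dir te.
have := L2prod_lin mO k Lu Lv LDe; have := L2prod_lin mO k Lwu Lwv Le.
by rewrite /L2prod => -> ->; rewrite hu// hv// opprD mulrN.
Qed.

Lemma weak_deriv2_ae dir u v wu wv : L2 m2 Om u -> L2 m2 Om v -> L2 m2 Om wv ->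
  ae_eq m2 Om u v -> ae_eq m2 Om wu wv -> wd2 dir u wu -> wd2 dir v wv.
Proof.
move=> Lu Lv Lwv uv wuv [Lwu hu]; split => // eta te.
have Le := test_fun_L2 te; have LDe := test_fun_derive_L2 dir te.
have := ae_eq_L2prod mO Lu Lv LDe uv; have := ae_eq_L2prod mO Lwu Lwv Le wuv.
by rewrite /L2prod => <- <-; exact: hu.
Qed.

Lemma weak_deriv2_cvg dir (un wn : nat -> R * R -> R) u w :
  (forall n, L2 m2 Om (un n)) -> (forall n, wd2 dir (un n) (wn n)) ->
  L2 m2 Om u -> L2 m2 Om w ->
  L2norm m2 Om (fun p => un n p - u p) @[n --> \oo] --> (0 : R) ->
  L2norm m2 Om (fun p => wn n p - w p) @[n --> \oo] --> (0 : R) ->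
  wd2 dir u w.
Proof.
move=> Lun hun Lu Lw cu cw; split => // eta te.
have Le := test_fun_L2 te; have LDe := test_fun_derive_L2 dir te.
have c1 := cvg_L2prod mO Lun Lu LDe cu.
have c2 := cvg_L2prod mO (fun n => (hun n).1) Lw Le cw.
apply: (cvg_unique _ c1) => //.
rewrite (_ : (fun n => _) = fun n => - L2prod m2 Om (wn n) eta); first exact: cvgN.
by apply/funext => n; exact: (hun n).2.
Qed.

Lemma test_slice1 eta z : test_fun Om eta -> test_fun (E := R) Ix (fun x => eta (x, z)).
Proof.
move=> [se [K [cK KO K0]]]; split.
  apply: (@smooth_comp_affine _ _ _ (fun x : R => (x, z)) (fun v : R => (v, 0))) => //.
    by move=> h v y; congr (_, _) => /=; rewrite scaler0 add0r.
  move=> y; apply: (@cvg_pair _ _ _ (nbhs y) (nbhs y) (nbhs z) _ _ _ id (cst z)) => //; exact: cvg_cst.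
exists (fst @` K); split.
- apply: continuous_compact => //; apply: continuous_subspaceT => p; exact: cvg_fst.
- by move=> _ [p /KO[pI _] <-].
- by move=> x nx; apply: K0 => Kxz; apply: nx; exists (x, z).
Qed.

(** For fixed z the slice of a test function is a test function on the interval, its support lying
    in the projection of the compact set; integrate the one-dimensional identity over z. *)
Lemma weak_deriv_lift_x (h w : R -> R) : L2 m1 Ix h -> weak_deriv1 Lx h w ->
  wd2 (1, 0) (fun p => h p.1) (fun p => w p.1).
Proof.
move=> Lh [Lw hw]; split; first exact: L2_lift.
move=> eta te; have [se _] := te.
rewrite Fubini_Omega2; last exact: (L2_intgM mO (L2_lift _ Lh) (test_fun_derive_L2 _ te)).
rewrite Fubini_Omega2; last exact: (L2_intgM mO (L2_lift _ Lw) (test_fun_L2 te)).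
rewrite -mulN1r -RintegralZl; last 2 first.
- exact: measurable_Itv.
- have := section_integral_integrable2 (L2_intgM mO (L2_lift hLz Lw) (test_fun_L2 te)).
  by move=> /(integrable_fine mIz)[].
apply: eq_Rintegral => z _ /=; rewrite mulN1r -(hw _ (test_slice1 z te)).
by apply: eq_Rintegral => x _; rewrite (derive_slice1 x z se).2.
Qed.

Lemma weak_deriv_lift_z (h : R -> R) : L2 m1 Ix h ->
  wd2 (0, 1) (fun p => h p.1) (fun=> 0).
Proof.
move=> Lh; split; first exact: L2_0.
move=> eta te; have [se _] := te.
rewrite Fubini_Omega; last exact: (L2_intgM mO (L2_lift _ Lh) (test_fun_derive_L2 _ te)).
under [in RHS]eq_Rintegral do rewrite mul0r.
rewrite Rintegral_cst; last exact: measurable_Omega.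
rewrite mul0r oppr0 (@eq_Rintegral _ _ _ _ _ (cst 0)); last first.
  move=> x /set_mem Ixx /=; rewrite RintegralZl_total; last 2 first.
  - exact: measurable_Itv.
  - exact: (@measurable_section _ _ _ ('D_(0, 1) eta) x (L2_measurable mO (test_fun_derive_L2 _ te)) Ixx).
  rewrite FTC_slice2// !(test_fun_eq0 te) ?subrr ?mulr0//.
  - by move=> [_ /=]; rewrite ItvE ltxx.
  - by move=> [_ /=]; rewrite ItvE ltxx andbF.
by rewrite /= Rintegral_cst ?mul0r//; exact: measurable_Itv.
Qed.

(** Lifted to the rectangle, both candidates are weak x-derivatives of the same function, so the
    two-dimensional uniqueness decides. *)
Lemma weak_deriv1_uniq (h w1 w2 : R -> R) : L2 m1 Ix h ->
  weak_deriv1 Lx h w1 -> weak_deriv1 Lx h w2 -> ae_eq m1 Ix w1 w2.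
Proof.
move=> Lh h1 h2; apply/(ae_eq_lift hLz h1.1 h2.1).
by apply: weak_deriv2_uniq; exact: (weak_deriv_lift_x Lh).
Qed.

Lemma test1_eq0 (eta : R -> R) x : test_fun (E := R) Ix eta -> ~ Ix x -> eta x = 0.
Proof. by move=> [_ [K [_ KI K0]]] nx; apply: K0 => /KI. Qed.

Lemma smooth_L2_1 (h : R -> R) : smooth (E := R) h -> L2 m1 Ix h.
Proof. by move=> /smooth_continuous; exact: continuous_L2_Itv. Qed.

Lemma smooth_weak_deriv1 (h : R -> R) : smooth (E := R) h -> weak_deriv1 Lx h ('D_1 h).
Proof.
move=> sh; have LD := smooth_L2_1 (smooth_derive (1 : R) sh).
split => // eta te; have [se _] := te.
have Le := smooth_L2_1 se; have LDe := smooth_L2_1 (smooth_derive (1 : R) se).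
have := @FTC_Itv R (fun x => h x * eta x) Lx hLx _ _.
have -> : \int[m1]_(x in Ix) 'D_1 (fun x => h x * eta x) x =
    \int[m1]_(x in Ix) (h x * 'D_1 eta x + 'D_1 h x * eta x).
  apply: eq_Rintegral => x _; rewrite -[LHS]/('D_1 (h * eta) x) deriveM; try exact: smooth_derivable.
  by rewrite [_ *: 'D_1 h x]mulrC.
rewrite RintegralD//; last 2 first.
- exact: (L2_intgM mI (smooth_L2_1 sh) LDe).
- exact: (L2_intgM mI LD Le).
rewrite (test1_eq0 (x := Lx) te) ?(test1_eq0 (x := 0) te) ?mulr0 ?subrr; last 2 first.
- by rewrite ItvE ltxx.
- by rewrite ItvE ltxx andbF.
move=> h0; apply/eqP; rewrite -addr_eq0; apply/eqP; apply: h0.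
- by move=> x; apply: smooth_derivable; exact: smoothM.
- by apply: smooth_continuous; apply: smooth_derive; exact: smoothM.
Qed.

Lemma weak_deriv1_lin k (u v wu wv : R -> R) : L2 m1 Ix u -> L2 m1 Ix v ->
  weak_deriv1 Lx u wu -> weak_deriv1 Lx v wv ->
  weak_deriv1 Lx (fun x => k * u x + v x) (fun x => k * wu x + wv x).
Proof.
move=> Lu Lv [Lwu hu] [Lwv hv]; split; first exact: (L2_lin mI k Lwu Lwv).
move=> eta te; have Le := smooth_L2_1 te.1; have LDe := smooth_L2_1 (smooth_derive (1 : R) te.1).
have := L2prod_lin mI k Lu Lv LDe; have := L2prod_lin mI k Lwu Lwv Le.
by rewrite /L2prod => -> ->; rewrite hu// hv// opprD mulrN.
Qed.

(** Differentiation under the integral sign, dominated by the maximum of the x-derivative over the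
    compact rectangle [x-1, x+1] x [0, Lz]. *)
Lemma derive_meanz g x : smooth g ->
  is_derive x (1 : R) (meanz Lz g) (meanz Lz ('D_(1, 0) g) x).
Proof.
move=> sg; have sD := smooth_derive ((1, 0) : R * R) sg.
have [M M0 hM] := continuous_bounded_rectangle (x - 1) (x + 1) 0 Lz (smooth_continuous sD).
have mIz := measurable_Itv Lz.
have c0 := @cvg_differentiation_under_integral R _ _ m1 (fun x z => g (x, z)) Iz mIz
  x (x - 1) (x + 1) _ _ _ (fun=> M) _ _ _.
have {}c0 : h^-1 *: ((fun x => \int[m1]_(z in Iz) g (x, z)) (h + x) -
    (fun x => \int[m1]_(z in Iz) g (x, z)) x) @[h --> 0^'] -->
    \int[m1]_(z in Iz) 'D_(1, 0) g (x, z).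
  have -> : \int[m1]_(z in Iz) 'D_(1, 0) g (x, z) =
      \int[m1]_(z in Iz) partial1of2 (fun x z => g (x, z)) x z.
    by apply: eq_Rintegral => z _; rewrite partial1of2E (derive_slice1 x z sg).2.
  apply: c0 => //.
  - by rewrite /= in_itv/=; apply/andP; split; lra.
  - move=> y _; apply: (L2_intg mIz (mu1_Itv_fin Lz)).
    by apply: continuous_L2_Itv; apply: continuous_slice2; exact: smooth_continuous.
  - by move=> y z _ _; exact: (derive_slice1 y z sg).1.
  - exact: (L2_intg mIz (mu1_Itv_fin Lz) (L2_cst mIz (mu1_Itv_fin Lz) M)).
  - move=> y z /=; rewrite in_itv/= ItvE => /andP[/ltW y1 /ltW y2] /andP[/ltW z1 /ltW z2].
    rewrite partial1of2E (derive_slice1 y z sg).2; apply: hM; first by rewrite y1.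
    by rewrite z1.
have {}c0 : h^-1 *: ((meanz Lz g \o shift x) (h *: 1) - meanz Lz g x) @[h --> 0^'] -->
    meanz Lz ('D_(1, 0) g) x.
  have : Lz^-1 * (h^-1 *: ((fun x => \int[m1]_(z in Iz) g (x, z)) (h + x) -
      (fun x => \int[m1]_(z in Iz) g (x, z)) x)) @[h --> 0^'] -->
      meanz Lz ('D_(1, 0) g) x by apply: cvgM => //; exact: cvg_cst.
  apply: cvg_trans; apply: near_eq_cvg; apply: nearW => h /=.
  by rewrite /meanz -[h *: 1]/(h * 1) mulr1 -![_ *: _]/(_ * _) -mulrBr mulrCA.
by split; [apply/cvg_ex; eexists; exact: c0|exact/cvg_lim].
Qed.

Lemma smooth_meanz g : smooth g -> smooth (E := R) (meanz Lz g).
Proof.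
move=> + n; elim: n g => [|n ih] g sg.
  split => //; apply: derivable_continuous => x; by have [] := derive_meanz x sg.
apply: CkS_line => [x|]; first by have [] := derive_meanz x sg.
rewrite (_ : 'D_(1 : R) (meanz Lz g) = meanz Lz ('D_(1, 0) g)).
  exact/ih/smooth_derive.
by apply/funext => x; have [_] := derive_meanz x sg.
Qed.

Lemma L2norm_meanz_sub u v : L2 m2 Om u -> L2 m2 Om v ->
  L2norm m1 Ix (fun x => meanz Lz u x - meanz Lz v x) <=
  (Num.sqrt Lz)^-1 * L2norm m2 Om (fun p => u p - v p).
Proof.
move=> Lu Lv; have LB := L2B mO Lu Lv.
rewrite (ae_eq_L2norm mI (L2B mI (L2_meanz hLx hLz Lu) (L2_meanz hLx hLz Lv))
  (L2_meanz hLx hLz LB)); last first.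
  by apply: aeS (meanzB hLx hLz Lu Lv) => x h Ixx; rewrite h.
rewrite ler_pdivlMl ?sqrtr_gt0//.
have := L2norm_meanz hLx hLz LB.
by rewrite (L2norm_lift hLz (L2_meanz hLx hLz LB)).
Qed.

Lemma cvg_meanz (un : nat -> R * R -> R) u : (forall n, L2 m2 Om (un n)) -> L2 m2 Om u ->
  L2norm m2 Om (fun p => un n p - u p) @[n --> \oo] --> (0 : R) ->
  L2norm m1 Ix (fun x => meanz Lz (un n) x - meanz Lz u x) @[n --> \oo] --> (0 : R).
Proof.
move=> Lun Lu cu.
apply: (@squeeze_cvgr _ _ _ _ (cst 0)
  (fun n => (Num.sqrt Lz)^-1 * L2norm m2 Om (fun p => un n p - u p))).
- by apply: nearW => n; rewrite L2norm_ge0/= L2norm_meanz_sub.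
- exact: cvg_cst.
- by rewrite -(mulr0 (Num.sqrt Lz)^-1); apply: cvgM => //; exact: cvg_cst.
Qed.

(** Mean and x-derivative commute for smooth functions; tested against [eta], both sides of the
    integration by parts are continuous for the two L^2 convergences. *)
Lemma weak_deriv_meanz (un : nat -> R * R -> R) u w :
  (forall n, smooth (un n)) -> L2 m2 Om u -> L2 m2 Om w ->
  L2norm m2 Om (fun p => un n p - u p) @[n --> \oo] --> (0 : R) ->
  L2norm m2 Om (fun p => 'D_(1, 0) (un n) p - w p) @[n --> \oo] --> (0 : R) ->
  weak_deriv1 Lx (meanz Lz u) (meanz Lz w).
Proof.
move=> sun Lu Lw cu cw; have Lun n := smooth_L2 (sun n).
have sD n := smooth_derive ((1, 0) : R * R) (sun n).
split; first exact: L2_meanz.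
move=> eta te; have Le := smooth_L2_1 te.1; have LDe := smooth_L2_1 (smooth_derive (1 : R) te.1).
have c1 := cvg_L2prod mI (fun n => L2_meanz hLx hLz (Lun n)) (L2_meanz hLx hLz Lu) LDe (cvg_meanz Lun Lu cu).
have c2 := cvg_L2prod mI (fun n => L2_meanz hLx hLz (smooth_L2 (sD n))) (L2_meanz hLx hLz Lw) Le
  (cvg_meanz (fun n => smooth_L2 (sD n)) Lw cw).
apply: (cvg_unique _ c1) => //.
rewrite (_ : (fun n => _) = fun n => - L2prod m1 Ix (meanz Lz ('D_(1, 0) (un n))) eta).
  exact: cvgN.
apply/funext => n; have := (smooth_weak_deriv1 (smooth_meanz (sun n))).2 _ te.
rewrite /L2prod => ->; congr (- _); apply: eq_Rintegral => x _; congr (_ * _).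
by have [_] := derive_meanz x (sun n).
Qed.

(** * The space H^1 of the rectangle, zero traces and completeness of V *)

Lemma H1_L2 u : H1 u -> L2 m2 Om u. Proof. by case. Qed.

Lemma H1_wdx u : H1 u -> wd2 ex u (dx u).
Proof. by case=> _ [w /weak_dx_spec]. Qed.

Lemma H1_wdz u : H1 u -> wd2 ez u (dz u).
Proof. by case=> _ _ [w /weak_dz_spec]. Qed.

Lemma L2_wdx u : H1 u -> L2 m2 Om (dx u).
Proof. by move=> /H1_wdx[]. Qed.

Lemma L2_wdz u : H1 u -> L2 m2 Om (dz u).
Proof. by move=> /H1_wdz[]. Qed.

Lemma wdxE u w : wd2 ex u w -> dx u =m2 w.
Proof.
by move=> h; exact: (weak_deriv2_uniq (weak_dx_spec h) h).
Qed.

Lemma wdzE u w : wd2 ez u w -> dz u =m2 w.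
Proof.
by move=> h; exact: (weak_deriv2_uniq (weak_dz_spec h) h).
Qed.

Lemma H1_lin k u v : H1 u -> H1 v -> H1 (fun p => k * u p + v p).
Proof.
move=> Hu Hv; split; first exact: (L2_lin mO k (H1_L2 Hu) (H1_L2 Hv)).
- exists (fun p => k * dx u p + dx v p).
  by apply: weak_deriv2_lin; [..|exact: H1_wdx|exact: H1_wdx] => //; exact: H1_L2.
- exists (fun p => k * dz u p + dz v p).
  by apply: weak_deriv2_lin; [..|exact: H1_wdz|exact: H1_wdz] => //; exact: H1_L2.
Qed.

Lemma wdx_lin k u v : H1 u -> H1 v ->
  dx (fun p => k * u p + v p) =m2 (fun p => k * dx u p + dx v p).
Proof.
move=> Hu Hv; apply: wdxE; apply: weak_deriv2_lin => //; try exact: H1_wdx.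
- exact: H1_L2.
- exact: H1_L2.
Qed.

Lemma wdz_lin k u v : H1 u -> H1 v ->
  dz (fun p => k * u p + v p) =m2 (fun p => k * dz u p + dz v p).
Proof.
move=> Hu Hv; apply: wdzE; apply: weak_deriv2_lin => //; try exact: H1_wdz.
- exact: H1_L2.
- exact: H1_L2.
Qed.

Lemma H1_sub u v : H1 u -> H1 v -> H1 (fun p => u p - v p).
Proof. by move=> Hu Hv; rewrite subE; exact: H1_lin. Qed.

Lemma wdx_sub u v : H1 u -> H1 v -> dx (fun p => u p - v p) =m2 (fun p => dx u p - dx v p).
Proof. by move=> Hu Hv; rewrite subE [X in _ =m2 X]subE; exact: wdx_lin. Qed.

Lemma wdz_sub u v : H1 u -> H1 v -> dz (fun p => u p - v p) =m2 (fun p => dz u p - dz v p).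
Proof. by move=> Hu Hv; rewrite subE [X in _ =m2 X]subE; exact: wdz_lin. Qed.

Lemma axis_x : axis ex. Proof. by left. Qed.
Lemma axis_z : axis ez. Proof. by right. Qed.

Lemma smooth_H1 g : smooth g -> H1 g.
Proof.
move=> sg; split; first exact: smooth_L2.
- by exists ('D_ex g); apply: smooth_weak_deriv => //; exact: axis_x.
- by exists ('D_ez g); apply: smooth_weak_deriv => //; exact: axis_z.
Qed.

Lemma wdx_smooth g : smooth g -> dx g =m2 'D_ex g.
Proof. by move=> sg; apply: wdxE; apply: smooth_weak_deriv => //; exact: axis_x. Qed.

Lemma wdz_smooth g : smooth g -> dz g =m2 'D_ez g.
Proof. by move=> sg; apply: wdzE; apply: smooth_weak_deriv => //; exact: axis_z. Qed.

Lemma H1norm2_ge u : [/\ N u <= H1norm2 Lx Lz u, N (dx u) <= H1norm2 Lx Lz u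
  & N (dz u) <= H1norm2 Lx Lz u].
Proof.
rewrite /H1norm2 weak_dxE weak_dzE; set a := N u; set b := N (dx u); set c := N (dz u).
have [a0 b0 c0] : [/\ 0 <= a, 0 <= b & 0 <= c] by split; exact: L2norm_ge0.
have s0 : 0 <= a ^+ 2 + b ^+ 2 + c ^+ 2 by rewrite !addr_ge0 ?sqr_ge0.
by split; rewrite -ler_sqr ?nnegrE ?sqrtr_ge0// sqr_sqrtr//; nra.
Qed.

Lemma H1norm2_le u : H1norm2 Lx Lz u <= N u + N (dx u) + N (dz u).
Proof.
rewrite /H1norm2 weak_dxE weak_dzE; set a := N u; set b := N (dx u); set c := N (dz u).
have [a0 b0 c0] : [/\ 0 <= a, 0 <= b & 0 <= c] by split; exact: L2norm_ge0.
have s0 : 0 <= a ^+ 2 + b ^+ 2 + c ^+ 2 by rewrite !addr_ge0 ?sqr_ge0.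
by rewrite -ler_sqr ?nnegrE ?sqrtr_ge0 ?addr_ge0// sqr_sqrtr//; nra.
Qed.

(** Zero trace on the edge x = a, with the H^1 norm split into three L^2 norms and the derivatives
    of [g] taken classically. The same approximants serve as the density tool in the Poincare
    inequalities and in the study of the mean. *)
Definition smooth_approx (a : R) u : Prop := forall e : R, 0 < e -> exists g : R * R -> R,
  smooth g /\ [/\ N (fun p => g p - u p) <= e, N (fun p => 'D_ex g p - dx u p) <= e,
  N (fun p => 'D_ez g p - dz u p) <= e & Nz (fun z => g (a, z)) <= e].

Lemma L2_slice g a : smooth g -> L2 m1 Iz (fun z => g (a, z)).
Proof.
by move=> sg; apply: continuous_L2_Itv; apply: continuous_slice2; exact: smooth_continuous.
Qed.

Lemma wdx_smooth_sub g u : smooth g -> H1 u ->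
  N (dx (fun p => g p - u p)) = N (fun p => 'D_ex g p - dx u p).
Proof.
move=> sg Hu; have Hg := smooth_H1 sg.
apply: (ae_eq_L2norm mO).
- exact: (L2_wdx (H1_sub Hg Hu)).
- exact: (L2B mO (smooth_L2 (smooth_derive _ sg)) (L2_wdx Hu)).
- by apply: aeS2 (wdx_sub Hg Hu) (wdx_smooth sg) => p h1 h2 Op; rewrite h1// h2.
Qed.

Lemma wdz_smooth_sub g u : smooth g -> H1 u ->
  N (dz (fun p => g p - u p)) = N (fun p => 'D_ez g p - dz u p).
Proof.
move=> sg Hu; have Hg := smooth_H1 sg.
apply: (ae_eq_L2norm mO).
- exact: (L2_wdz (H1_sub Hg Hu)).
- exact: (L2B mO (smooth_L2 (smooth_derive _ sg)) (L2_wdz Hu)).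
- by apply: aeS2 (wdz_sub Hg Hu) (wdz_smooth sg) => p h1 h2 Op; rewrite h1// h2.
Qed.

Lemma trace2P a u : H1 u -> trace2 Lx Lz a u (cst 0) <-> smooth_approx a u.
Proof.
move=> Hu; split.
- move=> [_ [un [sun /cvgrPdist_le c1 /cvgrPdist_le c2]]] e e0.
  have [n1 _ h1] := c1 e e0; have [n2 _ h2] := c2 e e0.
  pose n := maxn n1 n2; exists (un n); split => //.
  have := h1 n (leq_maxl _ _); have := h2 n (leq_maxr _ _) => /=.
  rewrite !sub0r !normrN ger0_norm ?L2norm_ge0// ger0_norm ?sqrtr_ge0// => le2 le1.
  have [a1 a2 a3] := H1norm2_ge (fun p => un n p - u p).
  rewrite -wdx_smooth_sub// -wdz_smooth_sub//; split; try exact: le_trans le1.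
  by move: le2; rewrite (_ : (fun z => un n (a, z) - 0) = fun z => un n (a, z))//;
    apply/funext => z; rewrite subr0.
- move=> /cvg0_choice[un hun]; split; first exact: L2_0.
  exists un; split; first by move=> n; have [] := hun n.
  + apply: (@cvg0_le_inv _ _ 3) => n; first exact: sqrtr_ge0.
    have [sn [h1 h2 h3 _]] := hun n.
    apply: le_trans (H1norm2_le _) _; rewrite wdx_smooth_sub// wdz_smooth_sub//.
    by rewrite -natr1 2!mulrDl mul1r !lerD// -[2]/(1 + 1) mulrDl !mul1r lerD.
  + apply: (@cvg0_le_inv _ _ 1) => n; first exact: L2norm_ge0.
    have [sn [_ _ _ h4]] := hun n; rewrite mul1r.
    by rewrite (_ : (fun z => un n (a, z) - 0) = fun z => un n (a, z))//;
      apply/funext => z; rewrite subr0.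
Qed.

Lemma spaceVP u : V u <-> [/\ H1 u, smooth_approx 0 u & smooth_approx Lx u].
Proof.
split=> [[Hu h1 h2]|[Hu h1 h2]]; split => //; exact/trace2P.
Qed.

Lemma V_H1 u : V u -> H1 u. Proof. by case. Qed.

Lemma smooth_approx_lin a k u v : H1 u -> H1 v -> smooth_approx a u -> smooth_approx a v ->
  smooth_approx a (fun p => k * u p + v p).
Proof.
move=> Hu Hv au av e e0; have k1 : 0 < `|k| + 1 by rewrite ltr_wpDl.
have e1 : 0 < e / (`|k| + 1) by rewrite divr_gt0.
have [g [sg [g1 g2 g3 g4]]] := au _ e1; have [h [sh [h1 h2 h3 h4]]] := av _ e1.
have sum_le (x y : R) : x <= e / (`|k| + 1) -> y <= e / (`|k| + 1) -> `|k| * x + y <= e.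
  move=> hx hy; apply: (@le_trans _ _ (`|k| * (e / (`|k| + 1)) + e / (`|k| + 1))).
    by rewrite lerD// ler_wpM2l.
  by rewrite -[X in _ + X]mul1r -mulrDl mulrCA mulfV ?mulr1// gt_eqF.
have [Lg Lh] := (smooth_L2 sg, smooth_L2 sh).
have LD (f : R * R -> R) dir : smooth f -> L2 m2 Om ('D_dir f).
  by move=> sf; apply: smooth_L2 => //; exact: smooth_derive.
have D_lin dir : 'D_dir (fun p => k * g p + h p) = fun p => k * 'D_dir g p + 'D_dir h p.
  apply/funext => p; rewrite -[LHS]/('D_dir (k \*: g + h) p) deriveD; last 2 first.
  - by apply: derivableZ; exact: smooth_derivable.
  - exact: smooth_derivable.
  by rewrite deriveZ//; exact: smooth_derivable.
have sgh : smooth (fun p => k * g p + h p) by apply: smoothD => //; exact: smoothZ.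
exists (fun p => k * g p + h p); split => //.
split.
- apply: le_trans (sum_le _ _ g1 h1).
  exact: (L2norm_lin_sub k mO Lg Lh (H1_L2 Hu) (H1_L2 Hv)).
- apply: le_trans (sum_le _ _ g2 h2).
  apply: le_trans (L2norm_lin_sub k mO (LD _ _ sg) (LD _ _ sh) (L2_wdx Hu) (L2_wdx Hv)).
  rewrite le_eqVlt; apply/orP; left; apply/eqP; apply: (ae_eq_L2norm mO).
  + by apply: (L2B mO); [exact: LD|exact: (L2_wdx (H1_lin k Hu Hv))].
  + by apply: (L2B mO); [exact: (L2_lin mO k (LD _ _ sg) (LD _ _ sh))|exact: (L2_lin mO k (L2_wdx Hu) (L2_wdx Hv))].
  + by apply: aeS (wdx_lin k Hu Hv) => p hp Op; rewrite hp//; congr (_ - _); exact: (congr1 (fun F => F p) (D_lin ex)).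
- apply: le_trans (sum_le _ _ g3 h3).
  apply: le_trans (L2norm_lin_sub k mO (LD _ _ sg) (LD _ _ sh) (L2_wdz Hu) (L2_wdz Hv)).
  rewrite le_eqVlt; apply/orP; left; apply/eqP; apply: (ae_eq_L2norm mO).
  + by apply: (L2B mO); [exact: LD|exact: (L2_wdz (H1_lin k Hu Hv))].
  + by apply: (L2B mO); [exact: (L2_lin mO k (LD _ _ sg) (LD _ _ sh))|exact: (L2_lin mO k (L2_wdz Hu) (L2_wdz Hv))].
  + by apply: aeS (wdz_lin k Hu Hv) => p hp Op; rewrite hp//; congr (_ - _); exact: (congr1 (fun F => F p) (D_lin ez)).
- apply: le_trans (sum_le _ _ g4 h4).
  have [Lg0 Lh0] := (L2_slice a sg, L2_slice a sh).
  rewrite -(L2normZ mIz k Lg0).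
  exact: (L2norm_triangle mIz (L2Z mIz k Lg0) Lh0).
Qed.

Lemma V_lin k u v : V u -> V v -> V (fun p => k * u p + v p).
Proof.
move=> /spaceVP[Hu u1 u2] /spaceVP[Hv v1 v2]; apply/spaceVP; split.
- exact: H1_lin.
- exact: smooth_approx_lin.
- exact: smooth_approx_lin.
Qed.

Lemma V_sub u v : V u -> V v -> V (fun p => u p - v p).
Proof. by move=> Vu Vv; rewrite subE; exact: V_lin. Qed.

Lemma V_add u v : V u -> V v -> V (fun p => u p + v p).
Proof. by move=> Vu Vv; rewrite addE; exact: V_lin. Qed.

Lemma V_complete (u : nat -> R * R -> R) : (forall n, V (u n)) ->
  (forall e : R, 0 < e -> exists n0, forall m n, (n0 <= m)%N -> (n0 <= n)%N ->
     [/\ N (fun p => u m p - u n p) <= e, N (fun p => dx (u m) p - dx (u n) p) <= e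
       & N (fun p => dz (u m) p - dz (u n) p) <= e]) ->
  exists2 v, V v & [/\ N (fun p => u n p - v p) @[n --> \oo] --> (0 : R),
    N (fun p => dx (u n) p - dx v p) @[n --> \oo] --> (0 : R)
  & N (fun p => dz (u n) p - dz v p) @[n --> \oo] --> (0 : R)].
Proof.
move=> Vu cu; have Hu n := V_H1 (Vu n).
have fO := mu2_Omega_fin hLx hLz.
have [|v Lv cv] := L2_complete mO fO (fun n => H1_L2 (Hu n)).
  by move=> e /cu[n0 h]; exists n0 => m n /h{}h /h[].
have [|wx Lwx cwx] := L2_complete mO fO (fun n => L2_wdx (Hu n)).
  by move=> e /cu[n0 h]; exists n0 => m n /h{}h /h[].
have [|wz Lwz cwz] := L2_complete mO fO (fun n => L2_wdz (Hu n)).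
  by move=> e /cu[n0 h]; exists n0 => m n /h{}h /h[].
have hx : wd2 ex v wx.
  exact: (weak_deriv2_cvg (fun n => H1_L2 (Hu n)) (fun n => H1_wdx (Hu n))).
have hz : wd2 ez v wz.
  exact: (weak_deriv2_cvg (fun n => H1_L2 (Hu n)) (fun n => H1_wdz (Hu n))).
have Hv : H1 v by split => //; [exists wx|exists wz].
have {cwx} cx : N (fun p => dx (u n) p - dx v p) @[n --> \oo] --> (0 : R).
  rewrite (_ : (fun n => _) = fun n => N (fun p => dx (u n) p - wx p))//.
  apply/funext => n; apply: (ae_eq_L2norm mO).
  - exact: (L2B mO (L2_wdx (Hu n)) (L2_wdx Hv)).
  - exact: (L2B mO (L2_wdx (Hu n)) Lwx).
  - by apply: aeS (wdxE hx) => p h Op; rewrite h.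
have {cwz} cz : N (fun p => dz (u n) p - dz v p) @[n --> \oo] --> (0 : R).
  rewrite (_ : (fun n => _) = fun n => N (fun p => dz (u n) p - wz p))//.
  apply/funext => n; apply: (ae_eq_L2norm mO).
  - exact: (L2B mO (L2_wdz (Hu n)) (L2_wdz Hv)).
  - exact: (L2B mO (L2_wdz (Hu n)) Lwz).
  - by apply: aeS (wdzE hz) => p h Op; rewrite h.
(* An approximant of [u n] within e / 2 is one of [v] within [e] as soon as [u n] is e / 2 close to
   [v]. The boundary value is measured on [g] itself, so zero traces are preserved by limits. *)
have approx a : (forall n, smooth_approx a (u n)) -> smooth_approx a v.
  move=> au e e0; have e2 : 0 < e / 2 by rewrite divr_gt0.
  have [n1 h1] := cvg0_le cv e2.
  have [n2 h2] := cvg0_le cx e2.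
  have [n3 h3] := cvg0_le cz e2.
  pose n := maxn n1 (maxn n2 n3).
  have := h1 n (leq_maxl _ _); have := h2 n (leq_trans (leq_maxl _ _) (leq_maxr _ _)).
  have := h3 n (leq_trans (leq_maxr _ _) (leq_maxr _ _)) => /=.
  rewrite !ger0_norm ?L2norm_ge0// => a3 a2 a1.
  have [g [sg [g1 g2 g3 g4]]] := au n _ e2; exists g; split => //; split.
  - apply: le_trans (L2norm_triangle3 mO (smooth_L2 sg) (H1_L2 (Hu n)) Lv) _.
    by rewrite (splitr e) lerD.
  - apply: le_trans (L2norm_triangle3 mO (smooth_L2 (smooth_derive _ sg)) (L2_wdx (Hu n)) (L2_wdx Hv)) _.
    by rewrite (splitr e) lerD.
  - apply: le_trans (L2norm_triangle3 mO (smooth_L2 (smooth_derive _ sg)) (L2_wdz (Hu n)) (L2_wdz Hv)) _.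
    by rewrite (splitr e) lerD.
  - by rewrite (le_trans g4)// ler_pdivrMr// ler_peMr ?ler1n// ltW.
exists v; last by split.
apply/spaceVP; split => //; apply: approx => n; by have /spaceVP[] := Vu n.
Qed.

(** * Functions of x alone, and the correspondence between W and V *)

Definition lift h : R * R -> R := fun p => h p.1.

Lemma mean_lift h : mean (lift h) = h.
Proof. by apply/funext => x; exact: meanz_lift. Qed.

Lemma H11_L2 h : H1_1 Lx h -> L2 m1 Ix h. Proof. by case. Qed.

Lemma H11_wd1 h : H1_1 Lx h -> weak_deriv1 Lx h (d1 h).
Proof. by case=> _ [w /weak_d1_spec]. Qed.

Lemma L2_wd1 h : H1_1 Lx h -> L2 m1 Ix (d1 h).
Proof. by move=> /H11_wd1[]. Qed.

Lemma wd1E h (w : R -> R) : L2 m1 Ix h -> weak_deriv1 Lx h w -> d1 h =m1 w.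
Proof. by move=> Lh hw; exact: (weak_deriv1_uniq Lh (weak_d1_spec hw) hw). Qed.

Lemma lift_L2 h : L2 m1 Ix h -> L2 m2 Om (lift h).
Proof. exact: L2_lift. Qed.

Lemma lift_H1 h : H1_1 Lx h -> H1 (lift h).
Proof.
move=> Hh; split; first exact/lift_L2/H11_L2.
- exists (lift (d1 h)); apply: weak_deriv_lift_x => //; first exact: H11_L2.
  exact: H11_wd1.
- by exists (fun=> 0); apply: weak_deriv_lift_z => //; exact: H11_L2.
Qed.

Lemma wdx_lift h : H1_1 Lx h -> dx (lift h) =m2 lift (d1 h).
Proof.
move=> Hh; apply: (wdxE); apply: weak_deriv_lift_x => //; first exact: H11_L2.
exact: H11_wd1.
Qed.

Lemma wdz_lift h : H1_1 Lx h -> dz (lift h) =m2 cst 0.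
Proof.
move=> Hh; apply: (wdzE); apply: weak_deriv_lift_z => //; exact: H11_L2.
Qed.

Lemma N_lift h : L2 m1 Ix h -> N (lift h) = Num.sqrt Lz * N1 h.
Proof. by move=> Lh; exact: L2norm_lift. Qed.

Lemma H1norm1_ge h : N1 h <= H1norm1 Lx h /\ N1 (d1 h) <= H1norm1 Lx h.
Proof.
rewrite /H1norm1 weak_d1E; set a := N1 h; set b := N1 (d1 h).
have [a0 b0] : 0 <= a /\ 0 <= b by split; exact: L2norm_ge0.
have s0 : 0 <= a ^+ 2 + b ^+ 2 by rewrite addr_ge0 ?sqr_ge0.
by split; rewrite -ler_sqr ?nnegrE ?sqrtr_ge0// sqr_sqrtr//; nra.
Qed.

Lemma H1norm1_le h : H1norm1 Lx h <= N1 h + N1 (d1 h).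
Proof.
rewrite /H1norm1 weak_d1E; set a := N1 h; set b := N1 (d1 h).
have [a0 b0] : 0 <= a /\ 0 <= b by split; exact: L2norm_ge0.
have s0 : 0 <= a ^+ 2 + b ^+ 2 by rewrite addr_ge0 ?sqr_ge0.
by rewrite -ler_sqr ?nnegrE ?sqrtr_ge0 ?addr_ge0// sqr_sqrtr//; nra.
Qed.

Lemma H11_lin k (h h' : R -> R) : H1_1 Lx h -> H1_1 Lx h' -> H1_1 Lx (fun x => k * h x + h' x).
Proof.
move=> Hh Hh'; split; first exact: (L2_lin mI k (H11_L2 Hh) (H11_L2 Hh')).
exists (fun x => k * d1 h x + d1 h' x).
by apply: weak_deriv1_lin; [exact: H11_L2|exact: H11_L2|exact: H11_wd1|exact: H11_wd1].
Qed.

Lemma H11_sub (h h' : R -> R) : H1_1 Lx h -> H1_1 Lx h' -> H1_1 Lx (fun x => h x - h' x).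
Proof. by move=> Hh Hh'; rewrite subE; exact: H11_lin. Qed.

Lemma wd1_sub (h h' : R -> R) : H1_1 Lx h -> H1_1 Lx h' ->
  d1 (fun x => h x - h' x) =m1 (fun x => d1 h x - d1 h' x).
Proof.
move=> Hh Hh'; apply: wd1E; first exact: (H11_L2 (H11_sub Hh Hh')).
rewrite subE [X in weak_deriv1 _ _ X]subE.
by apply: weak_deriv1_lin; [exact: H11_L2|exact: H11_L2|exact: H11_wd1|exact: H11_wd1].
Qed.

Lemma smooth_H11 (g : R -> R) : smooth (E := R) g -> H1_1 Lx g.
Proof.
by move=> sg; split; [exact: smooth_L2_1|exists ('D_1 g); exact: smooth_weak_deriv1].
Qed.

Lemma N1_wd1_smooth_sub (g h : R -> R) : smooth (E := R) g -> H1_1 Lx h ->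
  N1 (d1 (fun x => g x - h x)) = N1 (fun x => 'D_1 g x - d1 h x).
Proof.
move=> sg Hh; have Hg := smooth_H11 sg.
have Dg := smooth_weak_deriv1 sg.
apply: (ae_eq_L2norm mI).
- exact: (L2_wd1 (H11_sub Hg Hh)).
- exact: (L2B mI Dg.1 (L2_wd1 Hh)).
- by apply: aeS2 (wd1_sub Hg Hh) (wd1E (H11_L2 Hg) Dg) => x h1 h2 Ixx; rewrite h1// h2.
Qed.

Lemma derive_lift (h : R -> R) (v p : R * R) : smooth (E := R) h ->
  'D_v (lift h) p = v.1 * 'D_1 h p.1.
Proof.
move=> sh; have [-> _] := @derive_comp_affine R (R * R)%type R fst fst h v p (fun=> fun=> fun=> erefl).
by apply: derive_R; exact: smooth_derivable.
Qed.

(** Lifting the one-dimensional approximants multiplies the interval norms by sqrt Lz, and on the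
    edge the lift is the constant [un n a], of norm sqrt Lz times its modulus; hence the division of
    [e] by sqrt Lz. *)
Lemma trace1_approx (a : R) h : H1_1 Lx h -> trace1 Lx a h 0 -> smooth_approx a (lift h).
Proof.
move=> Hh [un [sun c1 c2]] e e0; pose s := Num.sqrt Lz.
have s0 : 0 < s by rewrite sqrtr_gt0.
have e1 : 0 < e / s by rewrite divr_gt0.
have [n1 h1] := cvg0_le c1 e1; have [n2 h2] := cvg0_le c2 e1.
pose n := maxn n1 n2; have {}h1 := h1 n (leq_maxl _ _); have {}h2 := h2 n (leq_maxr _ _).
rewrite ger0_norm ?sqrtr_ge0// in h1.
have Hn := smooth_H11 (sun n); have HB := H11_sub Hn Hh.
have [a1 a2] := H1norm1_ge (fun x => un n x - h x).
have sl : smooth (lift (un n)) by exact: smooth_fst.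
have se (x : R) : x <= e / s -> s * x <= e by rewrite ler_pdivlMr// mulrC.
exists (lift (un n)); split => //; split.
- have := N_lift (H11_L2 HB); rewrite /lift => ->.
  by apply: se; exact: le_trans h1.
- rewrite (ae_eq_L2norm (v := lift (fun x => 'D_1 (un n) x - d1 h x)) mO).
  + rewrite N_lift; last exact: (L2B mI (smooth_L2_1 (smooth_derive _ (sun n))) (L2_wd1 Hh)).
    by rewrite -N1_wd1_smooth_sub//; apply: se; exact: le_trans h1.
  + exact: (L2B mO (smooth_L2 (smooth_derive _ sl)) (L2_wdx (lift_H1 Hh))).
  + apply: lift_L2; exact: (L2B mI (smooth_L2_1 (smooth_derive _ (sun n))) (L2_wd1 Hh)).
  + apply: aeS (wdx_lift Hh) => p hp Op.
    by rewrite hp// (derive_lift _ _ (sun n))/= mul1r.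
- rewrite (ae_eq_L2norm (v := fun=> 0) mO).
  + by rewrite L2norm0// ltW.
  + exact: (L2B mO (smooth_L2 (smooth_derive _ sl)) (L2_wdz (lift_H1 Hh))).
  + exact: L2_0.
  + apply: aeS (wdz_lift Hh) => p hp Op.
    by rewrite hp// (derive_lift _ _ (sun n))/= mul0r subr0.
- rewrite /lift/=; apply: le_trans (se _ h2).
  rewrite -ler_sqr ?nnegrE ?L2norm_ge0 ?mulr_ge0 ?(ltW s0)//.
  rewrite L2norm_sqr; last exact: (L2_cst mIz (mu1_Itv_fin Lz)).
  rewrite /L2prod Rintegral_cst// mu1_Itv//= exprMn sqr_sqrtr ?(ltW hLz)//.
  by rewrite real_normK ?num_real// mulrC expr2.
Qed.

Lemma W_V h : W h -> V (lift h).
Proof.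
move=> [Hh h0 hL]; apply/(spaceVP); split; first exact: lift_H1.
- exact: trace1_approx.
- exact: trace1_approx.
Qed.

(** The approximants attached to the trace serve here only through their convergence in L^2 together
    with the x-derivative. *)
Lemma V_mean u : H1 u -> smooth_approx 0 u ->
  H1_1 Lx (mean u) /\ d1 (mean u) =m1 mean (dx u).
Proof.
move=> Hu /cvg0_choice[g hg].
have sg n : smooth (g n) by have [] := hg n.
have wm : weak_deriv1 Lx (mean u) (mean (dx u)).
  apply: (weak_deriv_meanz sg (H1_L2 Hu) (L2_wdx Hu)).
  - apply: (@cvg0_le_inv _ _ 1) => n; first exact: L2norm_ge0.
    by rewrite mul1r; have [_ []] := hg n.
  - apply: (@cvg0_le_inv _ _ 1) => n; first exact: L2norm_ge0.
    by rewrite mul1r; have [_ []] := hg n.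
have Lm : L2 m1 Ix (mean u) by exact: (L2_meanz hLx hLz (H1_L2 Hu)).
by split; [split => //; exists (mean (dx u))|exact: wd1E].
Qed.

(** The means of the approximants of [u] approximate the mean of [u], and Cauchy-Schwarz on the edge
    bounds their value at [a] by the edge norm of the approximants. *)
Lemma trace1_mean (a : R) u : H1 u -> H1_1 Lx (mean u) -> d1 (mean u) =m1 mean (dx u) ->
  smooth_approx a u -> trace1 Lx a (mean u) 0.
Proof.
move=> Hu Hm dm /cvg0_choice[g hg].
have sg n : smooth (g n) by have [] := hg n.
have s0 : 0 < (Num.sqrt Lz)^-1 by rewrite invr_gt0 sqrtr_gt0.
exists (fun n => mean (g n)); split.
- by move=> n; exact: smooth_meanz.
- apply: (@cvg0_le_inv _ _ ((Num.sqrt Lz)^-1 * 2)) => n; first exact: sqrtr_ge0.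
  have [_ [h1 h2 _ _]] := hg n.
  have sm := smooth_meanz (sg n).
  apply: le_trans (H1norm1_le _) _; rewrite mulr_natr mulr2n mulrDl lerD//.
    apply: le_trans (L2norm_meanz_sub (smooth_L2 (sg n)) (H1_L2 Hu)) _.
    by rewrite ler_wpM2l// ltW.
  rewrite N1_wd1_smooth_sub//.
  have LD := smooth_L2 (smooth_derive ex (sg n)).
  rewrite (ae_eq_L2norm (v := fun x => mean ('D_ex (g n)) x - mean (dx u) x) mI).
  + apply: le_trans (L2norm_meanz_sub LD (L2_wdx Hu)) _.
    by rewrite ler_wpM2l// ltW.
  + exact: (L2B mI (smooth_L2_1 (smooth_derive _ sm)) (L2_wd1 Hm)).
  + exact: (L2B mI (L2_meanz hLx hLz LD) (L2_meanz hLx hLz (L2_wdx Hu))).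
  + apply: aeS dm => x hx Ixx; rewrite hx//.
    by have [_ ->] := derive_meanz x (sg n).
- apply/cvgr0Pnorm_le => e e0; have c0 : 0 < Lz^-1 * Num.sqrt Lz.
    by rewrite mulr_gt0 ?invr_gt0 ?sqrtr_gt0.
  have c1 : (fun n : nat => Lz^-1 * Num.sqrt Lz * n.+1%:R^-1) @ \oo --> (0 : R).
    rewrite -(mulr0 (Lz^-1 * Num.sqrt Lz)); apply: cvgM; first exact: cvg_cst.
    exact: cvg_harmonic.
  have [n0 hn] := cvg0_le c1 e0; exists n0 => // n /= /hn.
  rewrite ger0_norm ?mulr_ge0 ?invr_ge0 ?sqrtr_ge0 ?(ltW hLz)//; apply: le_trans.
  have [_ [_ _ _ h4]] := hg n.
  have Lg := L2_slice a (sg n).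
  have LC := L2_CauchySchwarz mIz (L2_cst mIz (mu1_Itv_fin Lz) 1) Lg.
  rewrite /meanz normrM gtr0_norm ?invr_gt0// -mulrA ler_wpM2l ?invr_ge0 ?(ltW hLz)//.
  apply: (@le_trans _ _ (Nz (fun=> 1) * Nz (fun z => g n (a, z)))).
    by move: LC; rewrite /L2prod; under eq_Rintegral do rewrite mul1r.
  rewrite ler_pM ?L2norm_ge0// -ler_sqr ?nnegrE ?L2norm_ge0 ?sqrtr_ge0//.
  rewrite L2norm_sqr; last exact: (L2_cst mIz (mu1_Itv_fin Lz)).
  by rewrite /L2prod Rintegral_cst// mu1_Itv//= !mul1r sqr_sqrtr// ltW.
Qed.

Lemma V_W u : V u -> W (mean u).
Proof.
move=> /(spaceVP)[Hu a0 aL]; have [Hm dm] := V_mean Hu a0.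
by split => //; exact: trace1_mean.
Qed.

Lemma wd1_mean u : V u -> d1 (mean u) =m1 mean (dx u).
Proof. by move=> /(spaceVP)[Hu a0 _]; have [] := V_mean Hu a0. Qed.

(** The mean is a left inverse of the lift and maps V to W, so the linear structure of W is
    inherited from that of V. *)
Lemma W_iff_V h : W h <-> V (lift h).
Proof. by split => [/W_V//|/V_W]; rewrite mean_lift. Qed.

Lemma W_lin k (h h' : R -> R) : W h -> W h' -> W (fun x => k * h x + h' x).
Proof.
move=> /W_V Vh /W_V Vh'; apply/W_iff_V; exact: (V_lin k Vh Vh').
Qed.

Lemma W_sub (h h' : R -> R) : W h -> W h' -> W (fun x => h x - h' x).
Proof. by move=> Wh Wh'; rewrite subE; exact: W_lin. Qed.

Lemma V_0 : V (fun=> 0 : R).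
Proof.
have s0 := @smooth_cst R (R * R)%type 0.
have H0 : H1 (fun=> 0 : R) := smooth_H1 s0.
have ap a : smooth_approx a (fun=> 0 : R).
  move=> e e0; exists (fun=> 0); split; first exact: s0.
  split.
  - by rewrite (_ : (fun p : R * R => 0 - 0 : R) = fun=> 0); [rewrite L2norm0// ltW|apply/funext => p; rewrite subrr].
  - rewrite (ae_eq_L2norm (v := fun=> 0) mO); first by rewrite L2norm0// ltW.
    + exact: (L2B mO (smooth_L2 (smooth_derive _ s0)) (L2_wdx H0)).
    + exact: L2_0.
    + by apply: aeS (wdx_smooth s0) => p hp Op; rewrite hp// subrr.
  - rewrite (ae_eq_L2norm (v := fun=> 0) mO); first by rewrite L2norm0// ltW.
    + exact: (L2B mO (smooth_L2 (smooth_derive _ s0)) (L2_wdz H0)).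
    + exact: L2_0.
    + by apply: aeS (wdz_smooth s0) => p hp Op; rewrite hp// subrr.
  - by rewrite L2norm0// ltW.
by apply/(spaceVP); split.
Qed.

(* The weight [l] is the coordinate shifted to vanish on the edge opposite to
   the one where [g] is controlled; [c] is the boundary term. *)
Lemma smooth_poincare g (l : R * R -> R) (dir : R * R) (L c : R) : smooth g -> smooth l ->
  (forall p, 'D_dir l p = 1) -> (forall p, Om p -> `|l p| <= L) -> 0 <= L ->
  \int[m2]_(p in Om) 'D_dir (fun p => l p * (g p * g p)) p = c ^+ 2 -> 0 <= c ->
  N g <= 2 * L * N ('D_dir g) + c.
Proof.
move=> sg sl l1 lL L0 Dc c0; have sD := smooth_derive dir sg.
have [Lg LD] := (smooth_L2 sg, smooth_L2 sD).
have Llg := smooth_L2 (smoothM sl sg).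
have DE p : 'D_dir (fun p => l p * (g p * g p)) p = g p * g p + 2 * (l p * g p * 'D_dir g p).
  have dg : derivable g p dir by exact: smooth_derivable.
  have dl : derivable l p dir by exact: smooth_derivable.
  have dgg : derivable (fun q => g q * g q) p dir by exact: (derivableM dg dg).
  have := derive_mul dl dgg; rewrite (derive_mul dg dg) l1 => ->; ring.
have E : N g ^+ 2 + 2 * L2prod m2 Om (fun p => l p * g p) ('D_dir g) = c ^+ 2.
  rewrite -Dc L2norm_sqr// /L2prod.
  have i1 := L2_intgM mO Lg Lg; have i2 := L2_intgM mO Llg LD.
  rewrite -RintegralZl// -RintegralD//; last exact: (intgZ mO 2 i2).
  by apply: eq_Rintegral => p _; rewrite DE.
have b1 : N (fun p => l p * g p) <= L * N g.
  apply: (L2norm_boundedM mO _ L0 _ Lg).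
  - exact: (L2_measurable mO (smooth_L2 sl)).
  - exact: nearW.
have CS := L2_CauchySchwarz mO Llg LD.
have b2 : `|L2prod m2 Om (fun p => l p * g p) ('D_dir g)| <= L * N g * N ('D_dir g).
  by apply: le_trans CS _; rewrite ler_wpM2r ?L2norm_ge0.
move: b2 E; rewrite ler_norml => /andP[+ _].
have := L2norm_ge0 m2 Om g; have := L2norm_ge0 m2 Om ('D_dir g).
move: (N g) (N ('D_dir g)) (L2prod _ _ _ _) => a b q b0 a0 h E.
have k0 : 0 <= L * b by rewrite mulr_ge0.
have h' : a ^+ 2 <= c ^+ 2 + 2 * (L * b) * a by nra.
(* If a > 2Lb + c then a^2 > 2Lba + ca >= 2Lba + c^2, against [h']. *)
rewrite leNgt; apply/negP => lt; nra.
Qed.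

Lemma smooth_slice g (z : R) : smooth g -> smooth (fun p : R * R => g (p.1, z)).
Proof.
apply: (@smooth_comp_affine _ _ _ (fun p : R * R => (p.1, z)) (fun p : R * R => (p.1, 0))).
- by move=> k v p; congr (_, _) => /=; rewrite scaler0 add0r.
- move=> p; apply: (@cvg_pair _ _ _ (nbhs p) (nbhs p.1) (nbhs z) _ _ _ fst (cst z)) => //.
    exact: cvg_fst.
  exact: cvg_cst.
Qed.

Lemma derive_snd h (v p : R * R) : smooth (E := R) h ->
  'D_v (fun p : R * R => h p.2) p = v.2 * 'D_1 h p.2.
Proof.
move=> sh; have [-> _] := @derive_comp_affine R (R * R)%type R snd snd h v p (fun=> fun=> fun=> erefl).
by apply: derive_R; exact: smooth_derivable.
Qed.

Lemma derive_slice g (z : R) p : 'D_ez (fun q : R * R => g (q.1, z)) p = 0.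
Proof.
have [|-> _] := @derive_comp_affine R (R * R)%type (R * R)%type (fun q : R * R => (q.1, z))
  (fun q : R * R => (q.1, 0)) g ez p; last by rewrite derive0.
by move=> k v q; congr (_, _) => /=; rewrite scaler0 add0r.
Qed.

(** The weight x - Lx vanishes on the edge x = Lx, so only the edge x = 0 contributes: Lx times the
    squared norm of [g] there. *)
Lemma smooth_poincare_x g : smooth g ->
  N g <= 2 * Lx * N ('D_ex g) + Num.sqrt Lx * Nz (fun z => g (0, z)).
Proof.
move=> sg; have ss := smooth_shift Lx; have sl := smooth_fst ss.
apply: (smooth_poincare sg sl).
- by move=> p; apply: (etrans (derive_lift ex p ss)); rewrite mul1r; exact: derive_shift.
- by move=> p [/=]; rewrite ItvE => /andP[h1 h2] _; rewrite ler_norml; apply/andP; split; lra.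
- exact: ltW.
- have sG := smoothM sl (smoothM sg sg).
  rewrite Fubini_Omega2; last first.
    exact: (L2_intg mO fO (smooth_L2 (smooth_derive ex sG))).
  rewrite exprMn sqr_sqrtr ?(ltW hLx)// L2norm_sqr; last exact: L2_slice.
  have Lg := L2_slice 0 sg.
  rewrite /L2prod -RintegralZl//; last exact: (L2_intgM mIz Lg Lg).
  by apply: eq_Rintegral => z _; rewrite (FTC_slice1 z hLx sG) /=; ring.
- by rewrite mulr_ge0 ?sqrtr_ge0 ?L2norm_ge0.
Qed.

(** No boundary term survives: the weight z - Lz vanishes at z = Lz and the function, from which its
    value at z = 0 is subtracted, vanishes at z = 0. *)
Lemma smooth_poincare_z g : smooth g ->
  N (fun p => g p - g (p.1, 0)) <= 2 * Lz * N ('D_ez g).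
Proof.
move=> sg; have ss := smooth_shift Lz; have sl := smooth_snd ss.
have sb := smooth_slice 0 sg.
have sk : smooth (fun p => g p - g (p.1, 0)).
  by rewrite subE; apply: smoothD => //; exact: smoothZ.
have Dk : 'D_ez (fun p => g p - g (p.1, 0)) = 'D_ez g.
  apply/funext => p; rewrite -[LHS]/('D_ez (g - (fun q => g (q.1, 0))) p) deriveB; last 2 first.
  - exact: smooth_derivable.
  - exact: smooth_derivable.
  by rewrite derive_slice subr0.
rewrite -(addr0 (_ * _)) -Dk; apply: (smooth_poincare sk sl).
- by move=> p; apply: (etrans (derive_snd ez p ss)); rewrite mul1r; exact: derive_shift.
- by move=> p [/= _]; rewrite ItvE => /andP[h1 h2]; rewrite ler_norml; apply/andP; split; lra.
- exact: ltW.
- have sG := smoothM sl (smoothM sk sk).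
  rewrite Fubini_Omega; last first.
    exact: (L2_intg mO fO (smooth_L2 (smooth_derive ez sG))).
  rewrite expr0n/=; under eq_Rintegral => x _.
    rewrite (FTC_slice2 x hLz sG) /= !subrr !mulr0 mul0r subr0; over.
  by rewrite Rintegral_cst// mul0r.
- by [].
Qed.

Lemma poincare u : V u -> N u <= 2 * Lx * N (dx u).
Proof.
move=> /(spaceVP)[Hu u0 _].
(* The three summands are the errors on [g], on its x-derivative after multiplication by 2 Lx, and
   on the edge. *)
apply: (@le_of_le_addM _ _ _ (1 + 2 * Lx + Num.sqrt Lx)).
  by rewrite !addr_ge0 ?sqrtr_ge0// mulr_ge0// ltW.
move=> e /u0[g [sg [g1 g2 _ g4]]].
have [Lg LD] := (smooth_L2 sg, smooth_L2 (smooth_derive ex sg)).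
have t1 : N u <= N g + N (fun p => g p - u p).
  rewrite {1}(_ : u = fun p => g p - (g p - u p)); last by apply/funext => p; ring.
  exact: (L2norm_triangleB mO Lg (L2B mO Lg (H1_L2 Hu))).
have t2 : N ('D_ex g) <= N (dx u) + N (fun p => 'D_ex g p - dx u p).
  rewrite {1}(_ : 'D_ex g = fun p => dx u p + ('D_ex g p - dx u p)); last by apply/funext => p; ring.
  exact: (L2norm_triangle mO (L2_wdx Hu) (L2B mO LD (L2_wdx Hu))).
apply: le_trans t1 _; have := smooth_poincare_x sg.
have s1 : Num.sqrt Lx * Nz (fun z => g (0, z)) <= Num.sqrt Lx * e.
  by rewrite ler_wpM2l ?sqrtr_ge0.
have s2 : 2 * Lx * N ('D_ex g) <= 2 * Lx * (N (dx u) + e).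
  by rewrite ler_wpM2l ?mulr_ge0 ?(ltW hLx)//; lra.
by move=> s3; nra.
Qed.

(** * Fluctuations and the Poincare-Wirtinger inequality *)

Lemma L2_fluct u : L2 m2 Om u -> L2 m2 Om (fluct Lz u).
Proof. by move=> Lu; exact: (L2B mO Lu (L2_lift hLz (L2_meanz hLx hLz Lu))). Qed.

Lemma L2prod_lift_fluct h u : L2 m1 Ix h -> L2 m2 Om u -> L2prod m2 Om (lift h) (fluct Lz u) = 0.
Proof.
move=> Lh Lu; have Lm := L2_meanz hLx hLz Lu.
have LmO : L2 m2 Om (lift (mean u)) by exact: (L2_lift hLz).
rewrite (L2prodBr mO Lu LmO (L2_lift hLz Lh)) L2prod_meanz// (L2prod_meanz hLz Lh LmO).
by rewrite mean_lift// subrr.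
Qed.

(** The mean is the best approximation by functions of x: the fluctuation is orthogonal to lifted
    functions, and Pythagoras applies. *)
Lemma fluct_min h u : L2 m1 Ix h -> L2 m2 Om u -> N (fluct Lz u) <= N (fun p => u p - h p.1).
Proof.
move=> Lh Lu; have Lm := L2_meanz hLx hLz Lu.
have Lk := L2B mI Lm Lh.
have -> : (fun p => u p - h p.1) = fun p => lift (fun x => mean u x - h x) p + fluct Lz u p.
  by apply/funext => p; rewrite /lift /fluct; ring.
rewrite -ler_sqr ?nnegrE ?L2norm_ge0//.
rewrite (L2prod_norm2D mO (L2_lift hLz Lk) (L2_fluct Lu)).
by rewrite (L2prod_lift_fluct Lk Lu) mulr0 addr0 lerDr sqr_ge0.
Qed.

(** By minimality the mean may be replaced by the value at z = 0 of a smooth approximant, for which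
    the inequality without boundary term holds. *)
Lemma poincare_wirtinger u : V u -> N (fluct Lz u) <= 2 * Lz * N (dz u).
Proof.
move=> /(spaceVP)[Hu u0 _].
apply: (@le_of_le_addM _ _ _ (1 + 2 * Lz)); first by rewrite !addr_ge0// mulr_ge0// ltW.
move=> e /u0[g [sg [g1 _ g3 _]]].
have [Lg LD] := (smooth_L2 sg, smooth_L2 (smooth_derive ez sg)).
have Ls : L2 m1 Ix (fun x => g (x, 0)).
  by apply: continuous_L2_Itv; apply: continuous_slice1; exact: smooth_continuous.
have Lgs := L2_lift hLz Ls.
apply: le_trans (fluct_min Ls (H1_L2 Hu)) _.
apply: le_trans (L2norm_triangle3 mO (H1_L2 Hu) Lg Lgs) _.
have := smooth_poincare_z sg.
have t2 : N ('D_ez g) <= N (dz u) + N (fun p => 'D_ez g p - dz u p).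
  rewrite {1}(_ : 'D_ez g = fun p => dz u p + ('D_ez g p - dz u p)); last by apply/funext => p; ring.
  exact: (L2norm_triangle mO (L2_wdz Hu) (L2B mO LD (L2_wdz Hu))).
have s2 : 2 * Lz * N ('D_ez g) <= 2 * Lz * (N (dz u) + e).
  by rewrite ler_wpM2l ?mulr_ge0 ?(ltW hLz)//; lra.
rewrite (L2norm_distC mO (H1_L2 Hu) Lg) => s3.
by rewrite [X in _ <= X](_ : _ = e + 2 * Lz * (N (dz u) + e)); [rewrite lerD// (le_trans s3)|ring].
Qed.

(** Shown for the truncated representative, whose sections are all bounded by [M]; its mean agrees
    almost everywhere with that of [a]. *)
Lemma meanz_bounded (a : R * R -> R) (M : R) : measurable_fun (Om : set RR) a -> 0 <= M ->
  {ae m2, forall p, Om p -> `|a p| <= M} -> {ae m1, forall x, Ix x -> `|mean a x| <= M}.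
Proof.
move=> ma M0 aM; have [b [mb bM ab]] := ae_bounded_repr ma M0 aM.
have La : L2 m2 Om a.
  have L1 : L2 m2 Om (fun=> 1 : R) by exact: (L2_cst mO fO 1).
  by have := L2_boundedM mO ma aM L1; rewrite (_ : (fun x => a x * 1) = a)//; apply/funext => p; rewrite mulr1.
have Lb : L2 m2 Om b by exact: (L2_bounded mO fO mb (fun p _ => bM p)).
apply: aeS (ae_eq_meanz hLx hLz La Lb ab) => x h Ixx; rewrite h//.
have mbx := measurable_section mb Ixx.
have ibx : m1.-integrable Iz (EFin \o (fun z => b (x, z))).
  exact: (L2_intg mIz (mu1_Itv_fin Lz) (L2_bounded mIz (mu1_Itv_fin Lz) mbx (fun z _ => bM (x, z)))).
rewrite /meanz normrM gtr0_norm ?invr_gt0// ler_pdivrMl//.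
apply: le_trans (le_normr_Rintegral mIz ibx) _.
have -> : Lz * M = \int[m1]_(z in Iz) (cst M : R -> R) z.
  by rewrite Rintegral_cst// mu1_Itv//= mulrC.
apply: le_Rintegral => //.
  by have := integrable_norm ibx.
exact: (L2_intg mIz (mu1_Itv_fin Lz) (L2_cst mIz (mu1_Itv_fin Lz) M)).
Qed.

(** * Bilinear forms *)

Section coefficient.
Variables (a : R * R -> R) (m M : R).
Hypotheses (ma : measurable_fun (Om : set RR) a) (m0 : 0 < m) (M0 : 0 < M).
Hypothesis aM : {ae m2, forall p, Om p -> m <= a p /\ a p <= M}.

Lemma coef_bound : {ae m2, forall p, Om p -> `|a p| <= M}.
Proof.
by apply: aeS aM => p h /h[h1 h2]; rewrite ger0_norm// (le_trans _ h1)// ltW.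
Qed.

Lemma L2_coef u : L2 m2 Om u -> L2 m2 Om (fun p => a p * u p).
Proof. by move=> Lu; exact: (L2_boundedM mO ma coef_bound Lu). Qed.

Lemma coef_sym u v : L2prod m2 Om (fun p => a p * u p) v = L2prod m2 Om (fun p => a p * v p) u.
Proof. by apply: eq_Rintegral => p _; rewrite mulrAC. Qed.

Lemma coef_coercive u : L2 m2 Om u -> m * N u ^+ 2 <= L2prod m2 Om (fun p => a p * u p) u.
Proof.
move=> Lu; have iu := L2_intgM mO Lu Lu; rewrite L2norm_sqr// /L2prod -RintegralZl//.
apply: (ae_le_Rintegral mO).
- exact: (intgZ mO m iu).
- exact: (L2_intgM mO (L2_coef Lu) Lu).
- by apply: aeS aM => p h /h[h1 _]; rewrite -mulrA ler_wpM2r// -expr2 sqr_ge0.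
Qed.

Lemma coef_le u v : L2 m2 Om u -> L2 m2 Om v ->
  `|L2prod m2 Om (fun p => a p * u p) v| <= M * N u * N v.
Proof.
move=> Lu Lv; apply: le_trans (L2_CauchySchwarz mO (L2_coef Lu) Lv) _.
rewrite ler_wpM2r ?L2norm_ge0//.
exact: (L2norm_boundedM mO ma (ltW M0) coef_bound Lu).
Qed.

Lemma coef_linl (k : R) u v w : L2 m2 Om u -> L2 m2 Om v -> L2 m2 Om w ->
  L2prod m2 Om (fun p => a p * (k * u p + v p)) w =
  k * L2prod m2 Om (fun p => a p * u p) w + L2prod m2 Om (fun p => a p * v p) w.
Proof.
move=> Lu Lv Lw; rewrite -(L2prod_lin mO k (L2_coef Lu) (L2_coef Lv) Lw).
by apply: eq_Rintegral => p _; ring.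
Qed.

Lemma coef_aeql u v w : L2 m2 Om u -> L2 m2 Om v -> L2 m2 Om w -> ae_eq m2 Om u v ->
  L2prod m2 Om (fun p => a p * u p) w = L2prod m2 Om (fun p => a p * v p) w.
Proof.
move=> Lu Lv Lw uv; apply: (ae_eq_L2prod mO (L2_coef Lu) (L2_coef Lv) Lw).
by apply: aeS uv => p h Op; rewrite h.
Qed.

Lemma L2_coefficient : L2 m2 Om a.
Proof.
have := L2_coef (L2_cst mO fO 1).
by rewrite (_ : (fun p => a p * 1) = a)//; apply/funext => p; rewrite mulr1.
Qed.

Lemma meanz_coef_measurable : measurable_fun (Ix : set (measurableTypeR R)) (mean a).
Proof. exact: (L2_measurable mI (L2_meanz hLx hLz L2_coefficient)). Qed.

Lemma L2_meanz_coef h : L2 m1 Ix h -> L2 m1 Ix (fun x => mean a x * h x).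
Proof.
exact: (L2_boundedM mI meanz_coef_measurable (meanz_bounded ma (ltW M0) coef_bound)).
Qed.

(** Integrated against functions of x only, a coefficient acts through its mean along z; this is the
    link between a_2 and a_1. *)
Lemma coef_lift h k : L2 m1 Ix h -> L2 m1 Ix k ->
  Lz * \int[m1]_(x in Ix) (mean a x * h x * k x) =
  L2prod m2 Om (fun p => a p * lift h p) (lift k).
Proof.
move=> Lh Lk; have [LH LK] := (lift_L2 Lh, lift_L2 Lk).
have i := L2_intgM mO (L2_coef LH) LK.
rewrite /L2prod (_ : (fun p => _) = fun p => (fun x => h x * k x) p.1 * a p) in i *; last first.
  by apply/funext => p; rewrite /lift; ring.
rewrite [RHS](@Fubini_fst _ Lx Lz hLz (fun x => h x * k x) a i ma); congr (_ * _); apply: eq_Rintegral => x _; ring.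
Qed.

(** The fluctuation moves from the coefficient to the function: against [h], both [mean a * u] and
    [a * mean u] integrate to Lz times the integral of [mean a * mean u * h]. This underlies the
    rewriting of c and d by a_1. *)
Lemma coef_fluct u h : L2 m2 Om u -> L2 m1 Ix h ->
  L2 m2 Om (fun p => fluct Lz a p * u p) /\
  L2prod m2 Om (fun p => fluct Lz a p * u p) (lift h) =
  L2prod m2 Om (fun p => a p * (u p - lift (mean u) p)) (lift h).
Proof.
move=> Lu Lh; have LH := lift_L2 Lh; have Lm := L2_meanz hLx hLz Lu.
have LM := lift_L2 Lm.
have ma_lift : measurable_fun (Om : set RR) (lift (mean a)).
  exact: (L2_measurable mO (lift_L2 (L2_meanz hLx hLz L2_coefficient))).
have bm : {ae m2, forall p, Om p -> `|lift (mean a) p| <= M}.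
  have [b [mb bM ab]] :=
    ae_bounded_repr meanz_coef_measurable (ltW M0) (meanz_bounded ma (ltW M0) coef_bound).
  have Lb := L2_bounded mI (mu1_Itv_fin Lx) mb (fun p _ => bM p).
  have La := L2_meanz hLx hLz L2_coefficient.
  have /(ae_eq_lift hLz La Lb) := ab.
  by apply: aeS => p + Op => /(_ Op) /= ab_p; rewrite /lift ab_p.
have Lau := L2_boundedM mO ma_lift bm Lu.
split.
  rewrite (_ : (fun p => _) = fun p => a p * u p - lift (mean a) p * u p).
    exact: (L2B mO (L2_coef Lu) Lau).
  by apply/funext => p; rewrite /fluct /lift; ring.
have -> : L2prod m2 Om (fun p => fluct Lz a p * u p) (lift h) =
  L2prod m2 Om (fun p => a p * u p) (lift h) - L2prod m2 Om (fun p => lift (mean a) p * u p) (lift h).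
  rewrite -(L2prodBl mO (L2_coef Lu) Lau LH).
  by apply: eq_Rintegral => p _; rewrite /fluct /lift; ring.
have -> : L2prod m2 Om (fun p => a p * (u p - lift (mean u) p)) (lift h) =
  L2prod m2 Om (fun p => a p * u p) (lift h) - L2prod m2 Om (fun p => a p * lift (mean u) p) (lift h).
  rewrite -(L2prodBl mO (L2_coef Lu) (L2_coef LM) LH).
  by apply: eq_Rintegral => p _; ring.
congr (_ - _); rewrite -(coef_lift Lm Lh).
have -> : L2prod m2 Om (fun p => lift (mean a) p * u p) (lift h) =
  L2prod m2 Om (lift (fun x => mean a x * h x)) u.
  by apply: eq_Rintegral => p _; rewrite /lift; ring.
rewrite (L2prod_meanz hLz (L2_meanz_coef Lh) Lu); congr (_ * _).
by apply: eq_Rintegral => x _; ring.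
Qed.

End coefficient.

Section bilinear_forms.
Variables (Aperp Az : R * R -> R) (cperp cz Mperp Mz : R).
Hypothesis hA : hypA Lx Lz Aperp Az cperp cz Mperp Mz.
Local Notation a0 := (form_a0 Lx Lz Az).
Local Notation a1 := (form_a1 Lx Lz Aperp).
Local Notation a2 := (form_a2 Lx Lz Aperp).
Local Notation c := (form_c Lx Lz Aperp).
Local Notation d := (form_d Lx Lz Aperp).
Local Notation b := (form_b Lx Lz).
Implicit Types k : R -> R.

Lemma Linfty_measurable (a : R * R -> R) : Linfty m2 Om a -> measurable_fun (Om : set RR) a.
Proof. by move=> La; apply/measurable_restrictT => //; case/andP: La => /[!inE]. Qed.

Lemma a0E u v : a0 u v = L2prod m2 Om (fun p => Az p * dz u p) (dz v).
Proof. by rewrite /form_a0 weak_dzE. Qed.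

Lemma a1E u v : a1 u v = L2prod m2 Om (fun p => Aperp p * dx u p) (dx v).
Proof. by rewrite /form_a1 weak_dxE. Qed.

Lemma a0_sym u v : a0 u v = a0 v u.
Proof. by rewrite !a0E coef_sym. Qed.

Lemma a1_sym u v : a1 u v = a1 v u.
Proof. by rewrite !a1E coef_sym. Qed.

Let mA := Linfty_measurable (hypA_Aperp hA).
Let mAz := Linfty_measurable (hypA_Az hA).
Let c0 := hypA_cperp hA.
Let cz0 := hypA_cz hA.
Let M0 := hypA_Mperp hA.
Let Mz0 := hypA_Mz hA.
Let AM := hypA_bound_perp hA.
Let AzM := hypA_bound_z hA.
Let DX u (Vu : V u) := L2_wdx (V_H1 Vu).
Let DZ u (Vu : V u) := L2_wdz (V_H1 Vu).

Lemma a0_lin (k : R) u v w : V u -> V v -> V w ->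
  a0 (fun p => k * u p + v p) w = k * a0 u w + a0 v w.
Proof.
move=> Vu Vv Vw; rewrite !a0E -(coef_linl mAz cz0 AzM k (DZ Vu) (DZ Vv) (DZ Vw)).
apply: (coef_aeql mAz cz0 AzM (DZ (V_lin k Vu Vv)) _ (DZ Vw)).
- exact: (L2_lin mO k (DZ Vu) (DZ Vv)).
- exact: (wdz_lin k (V_H1 Vu) (V_H1 Vv)).
Qed.

Lemma a1_lin (k : R) u v w : V u -> V v -> V w ->
  a1 (fun p => k * u p + v p) w = k * a1 u w + a1 v w.
Proof.
move=> Vu Vv Vw; rewrite !a1E -(coef_linl mA c0 AM k (DX Vu) (DX Vv) (DX Vw)).
apply: (coef_aeql mA c0 AM (DX (V_lin k Vu Vv)) _ (DX Vw)).
- exact: (L2_lin mO k (DX Vu) (DX Vv)).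
- exact: (wdx_lin k (V_H1 Vu) (V_H1 Vv)).
Qed.

Lemma a0_coercive u : V u -> cz * N (dz u) ^+ 2 <= a0 u u.
Proof. by move=> Vu; rewrite a0E; exact: (coef_coercive mAz cz0 AzM (DZ Vu)). Qed.

Lemma a1_coercive u : V u -> cperp * N (dx u) ^+ 2 <= a1 u u.
Proof. by move=> Vu; rewrite a1E; exact: (coef_coercive mA c0 AM (DX Vu)). Qed.

Lemma a0_le u v : V u -> V v -> `|a0 u v| <= Mz * N (dz u) * N (dz v).
Proof. by move=> Vu Vv; rewrite a0E; exact: (coef_le mAz cz0 Mz0 AzM (DZ Vu) (DZ Vv)). Qed.

Lemma a1_le u v : V u -> V v -> `|a1 u v| <= Mperp * N (dx u) * N (dx v).
Proof. by move=> Vu Vv; rewrite a1E; exact: (coef_le mA c0 M0 AM (DX Vu) (DX Vv)). Qed.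

Lemma W_H11 h : W h -> H1_1 Lx h. Proof. by case. Qed.

Lemma W_L2 h : W h -> L2 m1 Ix h. Proof. by case => [[]]. Qed.

Lemma N_dz_lift h : W h -> N (dz (lift h)) = 0.
Proof.
move=> Wh; apply/(L2norm_eq0 mO); first exact: (L2_wdz (lift_H1 (W_H11 Wh))).
exact: (wdz_lift (W_H11 Wh)).
Qed.

Lemma V_mean_lift u : V u -> V (lift (mean u)).
Proof. by move=> /(V_W)/(W_V). Qed.

Lemma V_fluct u : V u -> V (fl u).
Proof. by move=> Vu; exact: (V_sub Vu (V_mean_lift Vu)). Qed.

Lemma fluct_lift h : fl (lift h) = fun=> 0.
Proof. by apply/funext => p; rewrite /fluct mean_lift// /lift subrr. Qed.

Lemma dx_lift_mean u : V u -> ae_eq m2 Om (dx (lift (mean u))) (lift (mean (dx u))).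
Proof.
move=> Vu; have Wm := V_W Vu.
have /(ae_eq_lift hLz (L2_wd1 (W_H11 Wm)) (L2_meanz hLx hLz (DX Vu))) := wd1_mean Vu.
by apply: aeS2 (wdx_lift (W_H11 Wm)) => p h1 h2 Op; rewrite h1// /lift h2.
Qed.

Lemma a1_lift_r u h : W h -> V u ->
  a1 u (lift h) = L2prod m2 Om (fun p => Aperp p * dx u p) (lift (d1 h)).
Proof.
move=> Wh Vu; rewrite a1E; apply: (ae_eq_L2prodr mO (DX (W_V Wh)) (lift_L2 (L2_wd1 (W_H11 Wh)))).
  exact: (L2_coef mA c0 AM (DX Vu)).
exact: (wdx_lift (W_H11 Wh)).
Qed.

Lemma a2E h k : W h -> W k -> Lz * a2 h k = a1 (lift h) (lift k).
Proof.
move=> Wh Wk; rewrite (a1_lift_r Wk (W_V Wh)) /form_a2 weak_d1E.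
have [L1 L2] := (L2_wd1 (W_H11 Wh), L2_wd1 (W_H11 Wk)).
rewrite (coef_lift mA c0 AM L1 L2); symmetry.
apply: (coef_aeql mA c0 AM (DX (W_V Wh)) (lift_L2 L1) (lift_L2 L2)).
exact: (wdx_lift (W_H11 Wh)).
Qed.

Lemma coef_fluct_dx u (k : R -> R) : V u -> L2 m1 Ix k ->
  L2prod m2 Om (fun p => fl Aperp p * dx u p) (lift k) =
  L2prod m2 Om (fun p => Aperp p * dx (fl u) p) (lift k).
Proof.
move=> Vu Lk; have [_ ->] := coef_fluct mA c0 M0 AM (DX Vu) Lk.
have LM := lift_L2 (L2_meanz hLx hLz (DX Vu)).
symmetry; apply: (coef_aeql mA c0 AM (DX (V_fluct Vu)) (L2B mO (DX Vu) LM) (lift_L2 Lk)).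
apply: aeS2 (wdx_sub (V_H1 Vu) (V_H1 (V_mean_lift Vu))) (dx_lift_mean Vu) => p h1 h2 Op.
by rewrite h1// h2.
Qed.

Lemma cE u k : V u -> W k -> c u k = a1 (fl u) (lift k).
Proof.
move=> Vu Wk; rewrite (a1_lift_r Wk (V_fluct Vu)) /form_c weak_dxE weak_d1E.
exact: (coef_fluct_dx Vu (L2_wd1 (W_H11 Wk))).
Qed.

(** Integrating over zeta replaces the x-derivative of [v] by its mean, which is the x-derivative of
    the mean; then the fluctuation is moved from the coefficient to [u]. *)
Lemma dE u v : V u -> V v -> d u v = a1 (fl u) (lift (mean v)).
Proof.
move=> Vu Vv; have Lm := L2_meanz hLx hLz (DX Vv).
have [Lau _] := coef_fluct mA c0 M0 AM (DX Vu) Lm.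
rewrite /form_d weak_dxE (triple_integral hLx hLz Lau (DX Vv)).
rewrite (coef_fluct_dx Vu Lm) a1E; symmetry.
apply: (ae_eq_L2prodr mO (DX (V_mean_lift Vv)) (lift_L2 Lm)).
  exact: (L2_coef mA c0 AM (DX (V_fluct Vu))).
exact: dx_lift_mean.
Qed.

Lemma bE (P : R -> R) v : L2 m1 Ix P -> L2 m2 Om v -> b P v = L2prod m2 Om (lift P) v.
Proof.
move=> LP Lv; rewrite (L2prod_meanz hLz LP Lv) /form_b /L2prod -RintegralZl//; last first.
  exact: (L2_intgM mI LP (L2_meanz hLx hLz Lv)).
apply: eq_Rintegral => x _; rewrite /meanz [in RHS]mulrCA [X in _ = _ * X]mulrA mulfV ?mul1r//.
by rewrite gt_eqF.
Qed.

Lemma L2prod_mean f h : L2 m2 Om f -> L2 m1 Ix h ->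
  Lz * L2prod m1 Ix (mean f) h = L2prod m2 Om f (lift h).
Proof. by move=> Lf Lh; rewrite L2prodC -(L2prod_meanz hLz Lh Lf) L2prodC. Qed.

Lemma L2prod_fluct f v : L2 m2 Om f -> L2 m2 Om v ->
  L2prod m2 Om (fl f) v = L2prod m2 Om f v - L2prod m2 Om f (lift (mean v)).
Proof.
move=> Lf Lv; have [LF LV] := (L2_meanz hLx hLz Lf, L2_meanz hLx hLz Lv).
rewrite (L2prodBl mO Lf (lift_L2 LF) Lv); congr (_ - _).
by rewrite (L2prod_meanz hLz LF Lv) (L2prod_mean Lf LV).
Qed.

End bilinear_forms.

(** * Gradient norms of differences, fluctuations and means *)

Lemma V_L2 u : V u -> L2 m2 Om u. Proof. by case=> [[]]. Qed.

Lemma N_dx_sub u v : H1 u -> H1 v ->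
  N (dx (fun p => u p - v p)) = N (fun p => dx u p - dx v p).
Proof.
move=> Hu Hv; apply: (ae_eq_L2norm mO (L2_wdx (H1_sub Hu Hv)) _ (wdx_sub Hu Hv)).
exact: (L2B mO (L2_wdx Hu) (L2_wdx Hv)).
Qed.

Lemma N_dz_sub u v : H1 u -> H1 v ->
  N (dz (fun p => u p - v p)) = N (fun p => dz u p - dz v p).
Proof.
move=> Hu Hv; apply: (ae_eq_L2norm mO (L2_wdz (H1_sub Hu Hv)) _ (wdz_sub Hu Hv)).
exact: (L2B mO (L2_wdz Hu) (L2_wdz Hv)).
Qed.

Lemma N_dx_triangle u v w : H1 u -> H1 v -> H1 w ->
  N (dx (fun p => u p - w p)) <= N (dx (fun p => u p - v p)) + N (dx (fun p => v p - w p)).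
Proof.
move=> Hu Hv Hw; rewrite !N_dx_sub//.
exact: (L2norm_triangle3 mO (L2_wdx Hu) (L2_wdx Hv) (L2_wdx Hw)).
Qed.

(** A selected derivative need not respect equality almost everywhere by construction; uniqueness
    identifies it with the derivative of the zero function. *)
Lemma N_dx_eq0 u : H1 u -> ae_eq m2 Om u (cst 0) -> N (dx u) = 0.
Proof.
move=> Hu u0; apply/(L2norm_eq0 mO); first exact: L2_wdx.
have H0 := V_H1 (V_0).
have e0 : ae_eq m2 Om (dx (fun=> 0 : R)) (cst 0).
  have := wdx_smooth (@smooth_cst R (R * R)%type 0).
  by apply: aeS => p h Op; rewrite h// derive_cst.
have := wdxE (weak_deriv2_ae (H1_L2 Hu) (H1_L2 H0) (L2_wdx Hu) u0
  (ae_eq_refl m2 Om (dx u)) (H1_wdx Hu)).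
by apply: aeS2 e0 => p h1 h2 Op; rewrite -(h2 Op) h1.
Qed.

Lemma N_fluct u : L2 m2 Om u -> N (fl u) <= N u.
Proof.
move=> Lu; apply: le_trans (fluct_min (L2_0 m1 mI) Lu) _.
by rewrite (_ : (fun p => u p - 0) = u)//; apply/funext => p; rewrite subr0.
Qed.

Lemma dx_fluct u : V u -> ae_eq m2 Om (dx (fl u)) (fl (dx u)).
Proof.
move=> Vu; have := dx_lift_mean Vu.
apply: aeS2 (wdx_sub (V_H1 Vu) (V_H1 (V_mean_lift Vu))) => p h1 h2 Op.
by rewrite h1// h2.
Qed.

(** Fluctuation commutes with the x-derivative, and the best approximation property applies to
    [dx u]. Any distance to a function of x thus controls the fluctuation. *)
Lemma N_dx_fluct_le u h : V u -> W h -> N (dx (fl u)) <= N (dx (fun p => u p - lift h p)).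
Proof.
move=> Vu Wh; have Hh := W_H11 Wh; have Lu := L2_wdx (V_H1 Vu).
rewrite (ae_eq_L2norm mO (L2_wdx (V_H1 (V_fluct Vu))) (L2_fluct Lu) (dx_fluct Vu)).
apply: le_trans (fluct_min (L2_wd1 Hh) Lu) _.
rewrite (N_dx_sub (V_H1 Vu) (lift_H1 Hh)) le_eqVlt; apply/orP; left; apply/eqP.
apply: (ae_eq_L2norm mO).
- exact: (L2B mO Lu (lift_L2 (L2_wd1 Hh))).
- exact: (L2B mO Lu (L2_wdx (lift_H1 Hh))).
- by apply: aeS (wdx_lift Hh) => p e Op; rewrite e.
Qed.

Lemma N_dz_fluct u : V u -> N (dz (fl u)) = N (dz u).
Proof.
move=> Vu; have Wm := V_W Vu.
apply: (ae_eq_L2norm mO (L2_wdz (V_H1 (V_fluct Vu))) (L2_wdz (V_H1 Vu))).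
apply: aeS2 (wdz_sub (V_H1 Vu) (V_H1 (V_mean_lift Vu)))
  (wdz_lift (W_H11 Wm)) => p h1 h2 Op.
by rewrite h1// h2// subr0.
Qed.

Lemma W_0 : W (fun=> 0).
Proof. by apply/(W_iff_V); exact: V_0. Qed.

Lemma N_dx_fluct u : V u -> N (dx (fl u)) <= N (dx u).
Proof.
move=> Vu; apply: le_trans (N_dx_fluct_le Vu W_0) _.
by rewrite (_ : (fun p => u p - lift (fun=> 0) p) = u)//; apply/funext => p; rewrite /lift subr0.
Qed.

Lemma H1norm1_mean_sub u v : V u -> V v -> H1norm1 Lx (fun x => mean u x - mean v x) <=
  (Num.sqrt Lz)^-1 * (N (fun p => u p - v p) + N (dx (fun p => u p - v p))).
Proof.
move=> Vu Vv; have [Wu Wv] := (V_W Vu, V_W Vv).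
have [Lu Lv] := (L2_wdx (V_H1 Vu), L2_wdx (V_H1 Vv)).
apply: le_trans (H1norm1_le _) _; rewrite mulrDr lerD//.
  exact: (L2norm_meanz_sub (V_L2 Vu) (V_L2 Vv)).
rewrite (N_dx_sub (V_H1 Vu) (V_H1 Vv)); apply: le_trans (L2norm_meanz_sub Lu Lv).
rewrite le_eqVlt; apply/orP; left; apply/eqP; apply: (ae_eq_L2norm mI).
- exact: (L2_wd1 (H11_sub (W_H11 Wu) (W_H11 Wv))).
- exact: (L2B mI (L2_meanz hLx hLz Lu) (L2_meanz hLx hLz Lv)).
- have := wd1_mean Vu; have := wd1_mean Vv.
  apply: filterS3 (wd1_sub (W_H11 Wu) (W_H11 Wv)) => x h1 h2 h3 Ixx.
  by rewrite h1// h2// h3.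
Qed.

(** By the Poincare inequality the gradient controls the full H^1 distance, so completeness can be
    stated in the two seminorms that the energy bounds. *)
Lemma V_complete_gradient (u : nat -> R * R -> R) : (forall n, V (u n)) ->
  (forall e : R, 0 < e -> exists n0, forall m n, (n0 <= m)%N -> (n0 <= n)%N ->
     N (dx (fun p => u m p - u n p)) <= e /\ N (dz (fun p => u m p - u n p)) <= e) ->
  exists2 v, V v & forall e : R, 0 < e -> exists n0, forall n, (n0 <= n)%N ->
    N (dx (fun p => u n p - v p)) <= e /\ N (dz (fun p => u n p - v p)) <= e.
Proof.
move=> Vu cu; have Hu n := V_H1 (Vu n).
have [e e0|v Vv [_ cx cz]] := V_complete Vu.
  have e1 : 0 < Num.min e (e / (2 * Lx)) by rewrite lt_min e0 divr_gt0// mulr_gt0.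
  have [n0 hn] := cu _ e1; exists n0 => m n /hn h /h{h}[].
  rewrite !le_min => /andP[h1 h2] /andP[h3 _].
  split; rewrite -?(N_dx_sub (Hu m) (Hu n)) -?(N_dz_sub (Hu m) (Hu n)); [|by []|by []].
  apply: le_trans (poincare (V_sub (Vu m) (Vu n))) _.
  by rewrite mulrC -ler_pdivlMr// mulr_gt0.
exists v => // e e0; have Hv := V_H1 Vv.
have [n1 h1] := cvg0_le cx e0; have [n2 h2] := cvg0_le cz e0.
exists (maxn n1 n2) => n hn; rewrite (N_dx_sub (Hu n) Hv) (N_dz_sub (Hu n) Hv).
have := h1 n (leq_trans (leq_maxl _ _) hn); have := h2 n (leq_trans (leq_maxr _ _) hn).
by rewrite !ger0_norm ?L2norm_ge0.
Qed.

(** What the variational argument retains of the two forms. [a0] is controlled by [dz] alone and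
    [a1] by [dx] alone; this separation isolates the effect of eps. *)
Record dirichlet_forms (a0 a1 : (R * R -> R) -> (R * R -> R) -> R)
    (cx cz Mx Mz : R) : Prop := DirichletForms {
  df_cx : 0 < cx;
  df_cz : 0 < cz;
  df_Mx : 0 < Mx;
  df_Mz : 0 < Mz;
  df_sym0 : forall u v, a0 u v = a0 v u;
  df_sym1 : forall u v, a1 u v = a1 v u;
  df_lin0 : forall (k : R) u v w, V u -> V v -> V w ->
    a0 (fun p => k * u p + v p) w = k * a0 u w + a0 v w;
  df_lin1 : forall (k : R) u v w, V u -> V v -> V w ->
    a1 (fun p => k * u p + v p) w = k * a1 u w + a1 v w;
  df_coer0 : forall u, V u -> cz * N (dz u) ^+ 2 <= a0 u u;
  df_coer1 : forall u, V u -> cx * N (dx u) ^+ 2 <= a1 u u;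
  df_le0 : forall u v, V u -> V v -> `|a0 u v| <= Mz * N (dz u) * N (dz v);
  df_le1 : forall u v, V u -> V v -> `|a1 u v| <= Mx * N (dx u) * N (dx v) }.

(** * The singular perturbation model and its limit *)

Section singular_perturbation.
Variables (a0 a1 : (R * R -> R) -> (R * R -> R) -> R) (cx cz Mx Mz : R).
Hypothesis df : dirichlet_forms a0 a1 cx cz Mx Mz.
Variable f : R * R -> R.
Hypothesis Lf : L2 (mu2 R) (Omega Lx Lz) f.
Local Notation l := (L2prod m2 Om f).
Implicit Types k : R -> R.

Let c0 := df_cx df.
Let cz0 := df_cz df.

Lemma a1_addl u v w : V u -> V v -> V w -> a1 (fun p => u p + v p) w = a1 u w + a1 v w.
Proof.
by move=> Vu Vv Vw; rewrite addE (df_lin1 df)//; move: (a1 u w) (a1 v w) => x y; ring.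
Qed.

Lemma a1_subl u v w : V u -> V v -> V w -> a1 (fun p => u p - v p) w = a1 u w - a1 v w.
Proof.
by move=> Vu Vv Vw; rewrite subE (df_lin1 df)//; move: (a1 u w) (a1 v w) => x y; ring.
Qed.

Lemma a0_addl u v w : V u -> V v -> V w -> a0 (fun p => u p + v p) w = a0 u w + a0 v w.
Proof.
by move=> Vu Vv Vw; rewrite addE (df_lin0 df)//; move: (a0 u w) (a0 v w) => x y; ring.
Qed.

Lemma a1_null u v : V u -> V v -> N (dx u) = 0 -> a1 u v = 0.
Proof.
move=> Vu Vv u0; apply/eqP; rewrite -normr_le0.
by apply: le_trans (df_le1 df Vu Vv) _; rewrite u0 mulr0 mul0r.
Qed.

Lemma a0_null u v : V u -> V v -> N (dz u) = 0 -> a0 u v = 0.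
Proof.
move=> Vu Vv u0; apply/eqP; rewrite -normr_le0.
by apply: le_trans (df_le0 df Vu Vv) _; rewrite u0 mulr0 mul0r.
Qed.

Lemma a1_definite u : V u -> a1 u u <= 0 -> N (dx u) = 0 /\ ae_eq m2 Om u (cst 0).
Proof.
move=> Vu u0; have := le_trans (df_coer1 df Vu) u0.
rewrite pmulr_rle0// => x0; have X0 : N (dx u) = 0.
  by apply/eqP; rewrite -sqrf_eq0 eq_le x0 sqr_ge0.
split => //; apply/(L2norm_eq0 mO); first exact: V_L2.
by apply/eqP; rewrite eq_le L2norm_ge0 andbT (le_trans (poincare Vu))// X0 mulr0.
Qed.

Definition energy (eps : R) u v : R := a1 u v + eps^-1 * a0 u v.

(** For the concrete forms this is convertible to [sol_SP], so solutions pass from one to the other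
    without rewriting. *)
Definition solves_SP (eps : R) phi : Prop :=
  V phi /\ forall psi, V psi -> energy eps phi psi = l psi.

Lemma energy_semi_inner (eps : R) : 0 < eps -> semi_inner V (energy eps).
Proof.
move=> e0; have e1 : 0 <= eps^-1 by rewrite invr_ge0 ltW.
split.
- by move=> u v _ _; rewrite /energy (df_sym0 df) (df_sym1 df).
- move=> k u v w Vu Vv Vw; rewrite /energy (df_lin0 df)// (df_lin1 df)//.
  by move: (a0 u w) (a0 v w) (a1 u w) (a1 v w) => *; ring.
- move=> u Vu; rewrite addr_ge0//.
    by apply: le_trans (df_coer1 df Vu); rewrite mulr_ge0 ?sqr_ge0// ltW.
  rewrite mulr_ge0//; apply: le_trans (df_coer0 df Vu).
  by rewrite mulr_ge0 ?sqr_ge0// ltW.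
Qed.

Lemma energy_ge (eps : R) u : 0 < eps -> V u ->
  cx * N (dx u) ^+ 2 <= energy eps u u /\ eps^-1 * (cz * N (dz u) ^+ 2) <= energy eps u u.
Proof.
move=> e0 Vu; have e1 : 0 <= eps^-1 by rewrite invr_ge0 ltW.
have h1 := df_coer1 df Vu; have h0 := ler_wpM2l e1 (df_coer0 df Vu).
have p1 : 0 <= cx * N (dx u) ^+ 2 by rewrite mulr_ge0 ?sqr_ge0// ltW.
have p0 : 0 <= eps^-1 * (cz * N (dz u) ^+ 2) by rewrite mulr_ge0// mulr_ge0 ?sqr_ge0// ltW.
by rewrite /energy; split; lra.
Qed.

Lemma V_subspace : subspace V.
Proof. by split; [exact: V_0|move=> k u v; exact: V_lin]. Qed.

Lemma energy_complete (eps : R) : 0 < eps -> form_complete V (energy eps).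
Proof.
move=> e0 u Vu cu; have [e e1|v Vv cv] := V_complete_gradient Vu.
  (* An energy below this value forces both the x- and the z-derivative norm below [e]. *)
  pose e' := Num.min (cx * e ^+ 2) (eps^-1 * (cz * e ^+ 2)).
  have e'0 : 0 < e' by rewrite lt_min !mulr_gt0 ?exprn_gt0// invr_gt0.
  have [n0 hn] := cu _ e'0; exists n0 => m n hm hn'.
  have := hn m n hm hn'; rewrite le_min => /andP[h1 h2].
  have [h3 h4] := energy_ge e0 (V_sub (Vu m) (Vu n)).
  have := le_trans h3 h1; have := le_trans h4 h2.
  rewrite ler_pM2l ?invr_gt0// !ler_pM2l// !ler_sqr ?nnegrE ?L2norm_ge0//; last exact: ltW.
  by rewrite ltW.
exists v => // e e1.
pose K := Mx + eps^-1 * Mz; have K0 : 0 < K.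
  by rewrite addr_gt0 ?mulr_gt0 ?invr_gt0// ?(df_Mx df)// (df_Mz df).
(* A nonnegative number at most 1 and at most e / K has its square at most e / K, while the energy
   is at most K times such squares. *)
pose e' := Num.min 1 (e / K); have e'0 : 0 < e' by rewrite lt_min ltr01 divr_gt0.
have [n0 hn] := cv _ e'0.
have [n1 _ hn1] := near_infty_natSinv_lt (PosNum e1).
pose n := maxn n0 n1; have [h1 h2] := hn n (leq_maxl _ _).
exists n; split; last exact: (ltW (hn1 n (leq_maxr _ _))).
have Vd := V_sub (Vu n) Vv.
have sq (x : R) : 0 <= x -> x <= e' -> x * x <= e / K.
  move=> x0; rewrite le_min => /andP[x1 xe].
  by rewrite (le_trans _ xe)// ler_piMl.
apply: (@le_trans _ _ (K * (e / K))); last by rewrite mulrCA mulfV ?mulr1// gt_eqF.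
rewrite /K mulrDl /energy lerD//.
  apply: le_trans (le_trans (ler_norm _) (df_le1 df Vd Vd)) _.
  by rewrite -mulrA ler_wpM2l ?(ltW (df_Mx df))// sq// L2norm_ge0.
rewrite -mulrA ler_wpM2l ?invr_ge0 ?(ltW e0)//.
apply: le_trans (le_trans (ler_norm _) (df_le0 df Vd Vd)) _.
by rewrite -mulrA ler_wpM2l ?(ltW (df_Mz df))// sq// L2norm_ge0.
Qed.

Lemma l_le u : V u -> `|l u| <= 2 * Lx * N f * N (dx u).
Proof.
move=> Vu; apply: le_trans (L2_CauchySchwarz mO Lf (V_L2 Vu)) _.
by rewrite [leRHS]mulrAC [leRHS]mulrC ler_wpM2l ?L2norm_ge0//; exact: poincare.
Qed.

Lemma SP_exists (eps : R) : 0 < eps -> exists phi, solves_SP eps phi.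
Proof.
move=> e0.
have [||v Vv|phi Vphi hphi] := riesz_representation V_subspace (energy_semi_inner e0)
  (K := (2 * Lx * N f) ^+ 2 / cx) (l := l); last by exists phi.
- by move=> k u v Vu Vv; exact: (L2prod_linr mO k (V_L2 Vu) (V_L2 Vv) Lf).
- exact: energy_complete.
- have [h1 _] := energy_ge e0 Vv; have := l_le Vv; rewrite ler_norml => /andP[_ h2].
  rewrite -subr_ge0; set K := 2 * Lx * N f in h2 *.
  (* Completing the square: t -> cx t^2 - 2Kt is minimal at t = K / cx, with value -K^2 / cx, the
     lower bound given to the minimisation. *)
  have : 0 <= cx * (N (dx v) - K / cx) ^+ 2 by rewrite mulr_ge0 ?sqr_ge0// ltW.
  have -> : cx * (N (dx v) - K / cx) ^+ 2 = cx * N (dx v) ^+ 2 - 2 * (K * N (dx v)) + K ^+ 2 / cx.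
    by field; rewrite gt_eqF.
  by lra.
Qed.

Lemma SP_unique (eps : R) u v : 0 < eps -> solves_SP eps u -> solves_SP eps v -> ae_eq m2 Om u v.
Proof.
move=> e0 [Vu hu] [Vv hv]; have Vd := V_sub Vu Vv.
have [_ lB _] := energy_semi_inner e0.
have d0 : energy eps (fun p => u p - v p) (fun p => u p - v p) = 0.
  rewrite {1}[X in energy _ X _](subE u v) lB// hu// hv//.
  by rewrite mulN1r addNr.
have [h1 _] := energy_ge e0 Vd.
have [|_] := a1_definite Vd.
  rewrite -d0 /energy lerDl mulr_ge0 ?invr_ge0 ?(ltW e0)//.
  by apply: le_trans (df_coer0 df Vd); rewrite mulr_ge0 ?sqr_ge0// ltW.
by apply: aeS => p h Op; apply/eqP; rewrite -subr_eq0 h.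
Qed.

(** The equation is tested with the solution itself. The z-derivative enters the energy divided by
    eps, hence the factor eps in its bound. *)
Lemma SP_bound (eps : R) phi : 0 < eps -> solves_SP eps phi ->
  N (dx phi) <= 2 * Lx * N f / cx /\
  cz * N (dz phi) ^+ 2 <= eps * ((2 * Lx * N f) ^+ 2 / cx).
Proof.
move=> e0 [Vphi hphi]; have [h1 h2] := energy_ge e0 Vphi.
have := l_le Vphi; rewrite ler_norml -hphi// => /andP[_ h3].
set K := 2 * Lx * N f in h3 *.
have hX : N (dx phi) <= K / cx.
  have [->|X0] := eqVneq (N (dx phi)) 0.
    by rewrite divr_ge0 ?(ltW c0)// !mulr_ge0 ?L2norm_ge0// ltW.
  have {}X0 : 0 < N (dx phi) by rewrite lt_def X0 L2norm_ge0.
  rewrite ler_pdivlMr// -(ler_pM2r X0) (le_trans _ h3)// (le_trans _ h1)//.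
  by rewrite expr2 mulrCA mulrA.
split => //; rewrite -ler_pdivrMl//; apply: le_trans h2 (le_trans h3 _).
rewrite expr2 -mulrA ler_wpM2l// /K !mulr_ge0 ?L2norm_ge0// ltW//.
Qed.

(** Expanding at parameter [del], where [v] solves the equation, gives energy(u, u) - 2 l(u) + l(v);
    and the energy of [u] at [del] is at most its energy at the smaller [eps], which is l(u). *)
Lemma SP_energy_sub (eps del : R) u v : 0 < eps -> eps <= del ->
  solves_SP eps u -> solves_SP del v ->
  energy del (fun p => u p - v p) (fun p => u p - v p) <= l v - l u.
Proof.
move=> e0 ed [Vu hu] [Vv hv]; have d0 := lt_le_trans e0 ed.
rewrite subE (form_sqr V_subspace (energy_semi_inner d0) (-1) Vv Vu) !hv//.
have : energy del u u <= l u.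
  rewrite -hu// /energy lerD2l ler_wpM2r ?lef_pV2 ?posrE//.
  by apply: le_trans (df_coer0 df Vu); rewrite mulr_ge0 ?sqr_ge0// ltW.
by rewrite sqrrN expr1n; move: (energy del u u) (l u) (l v) => x y z; lra.
Qed.

Lemma energy_ge0 (eps : R) u : 0 < eps -> V u -> 0 <= energy eps u u.
Proof. by move=> e0; have [_ _] := energy_semi_inner e0; exact. Qed.

Variable phi : R -> R * R -> R.
Hypothesis hphi : forall eps : R, 0 < eps -> solves_SP eps (phi eps).

Let Vphi (eps : R) (e0 : 0 < eps) : V (phi eps) := (hphi e0).1.

Lemma N_dx_distC u v : V u -> V v ->
  N (dx (fun p => u p - v p)) = N (dx (fun p => v p - u p)).
Proof.
move=> /V_H1 Hu /V_H1 Hv; rewrite (N_dx_sub Hu Hv) (N_dx_sub Hv Hu).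
exact: (L2norm_distC mO (L2_wdx Hu) (L2_wdx Hv)).
Qed.

(* [l (phi eps)] is the energy of [phi eps]; it is nonnegative and nondecreasing
   in [eps], so its oscillation near 0, which controls the distances, vanishes. *)
Lemma SP_cauchy (e : R) : 0 < e -> exists2 eps0 : R, 0 < eps0 &
  forall eps del : R, 0 < eps < eps0 -> 0 < del < eps0 ->
  N (dx (fun p => phi eps p - phi del p)) <= e.
Proof.
move=> e0; pose F eps := l (phi eps).
have mono (eps del : R) : 0 < eps -> eps <= del -> cx * N (dx (fun p => phi eps p - phi del p)) ^+ 2 <= F del - F eps.
  move=> e1 ed; have d1 := lt_le_trans e1 ed.
  apply: le_trans (SP_energy_sub e1 ed (hphi e1) (hphi d1)).
  by have [] := energy_ge d1 (V_sub (Vphi e1) (Vphi d1)).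
have homo (eps del : R) : 0 < eps -> eps <= del -> F eps <= F del.
  move=> e1 ed; rewrite -subr_ge0; apply: le_trans (mono _ _ e1 ed).
  by rewrite mulr_ge0 ?sqr_ge0// ltW.
pose E := F @` [set eps | 0 < eps].
have E0 : has_inf E.
  split; first by exists (F 1); exists 1 => //=.
  by exists 0 => _ [eps e1 <-]; rewrite /F -(hphi e1).2 ?energy_ge0//; exact: Vphi.
have ce : 0 < cx * e ^+ 2 by rewrite mulr_gt0 ?exprn_gt0.
(* Below [eps0], monotonicity keeps the values of [F] between the infimum and [F eps0], so they
   differ by at most cx e^2. *)
have [_ [eps0 e1 <-] /ltW he] := inf_adherent ce E0; exists eps0 => //.
have wlog_le (eps del : R) : 0 < eps -> eps <= del -> del < eps0 ->
    N (dx (fun p => phi eps p - phi del p)) <= e.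
  move=> h1 h2 h3; have h4 := lt_le_trans h1 h2.
  rewrite -ler_sqr ?nnegrE ?L2norm_ge0 ?(ltW e0)// -(ler_pM2l c0).
  apply: le_trans (mono _ _ h1 h2) _.
  have : inf E <= F eps by apply: ge_inf; [exact: E0.2|exists eps].
  have := homo _ _ h4 (ltW h3).
  by move: (F eps) (F del) (F eps0) (inf E) he => *; lra.
move=> eps del /andP[h1 h2] /andP[h3 h4]; have [ed|/ltW de] := leP eps del.
  exact: wlog_le.
by rewrite N_dx_distC; [exact: wlog_le|exact: Vphi|exact: Vphi].
Qed.

Lemma SP_dz_small (e : R) : 0 < e -> exists2 eps0 : R, 0 < eps0 &
  forall eps : R, 0 < eps < eps0 -> N (dz (phi eps)) <= e.
Proof.
move=> e0; pose K := (2 * Lx * N f) ^+ 2 / cx.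
have K0 : 0 <= K by rewrite divr_ge0 ?sqr_ge0// ltW.
have K1 : 0 < K + 1 by rewrite ltr_wpDl.
exists (cz * e ^+ 2 / (K + 1)); first by rewrite divr_gt0// mulr_gt0 ?exprn_gt0.
move=> eps /andP[h1]; rewrite ltr_pdivlMr// => h2.
rewrite -ler_sqr ?nnegrE ?L2norm_ge0 ?(ltW e0)// -(ler_pM2l cz0).
have [_ h3] := SP_bound h1 (hphi h1); apply: le_trans h3 (le_trans _ (ltW h2)).
by rewrite ler_wpM2l ?(ltW h1)// lerDl.
Qed.

(** Completeness concerns sequences, so the limit is taken along eps = 1/(n+1); the Cauchy property
    then extends the convergence to the whole family. *)
Lemma SP_limit : exists2 h : R -> R, W h & forall e : R, 0 < e -> exists2 eps0 : R, 0 < eps0 &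
  forall eps : R, 0 < eps < eps0 ->
  N (dx (fun p => phi eps p - lift h p)) <= e /\ N (dz (phi eps)) <= e.
Proof.
pose u (n : nat) := phi n.+1%:R^-1.
have n0 (n : nat) : 0 < n.+1%:R^-1 :> R by rewrite invr_gt0.
have Vu n : V (u n) by exact: Vphi.
have small (eps0 : R) : 0 < eps0 -> exists n1, forall n, (n1 <= n)%N -> 0 < (n.+1%:R^-1 : R) < eps0.
  move=> e0; have [n1 _ h] := near_infty_natSinv_lt (PosNum e0).
  by exists n1 => n /h /= ->; rewrite n0.
have [e e0|v Vv cv] := V_complete_gradient Vu.
  have [e1 e10 h1] := SP_cauchy e0; have [e2 e20 h2] := SP_dz_small (divr_gt0 e0 (ltr0Sn R 1)).
  have [n1 g1] := small _ e10; have [n2 g2] := small _ e20.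
  exists (maxn n1 n2) => m n hm hn; split.
    apply: h1; apply: g1; [exact: leq_trans (leq_maxl _ _) hm|exact: leq_trans (leq_maxl _ _) hn].
  rewrite (N_dz_sub (V_H1 (Vu m)) (V_H1 (Vu n))).
  apply: le_trans (L2norm_triangleB mO (L2_wdz (V_H1 (Vu m))) (L2_wdz (V_H1 (Vu n)))) _.
  rewrite (splitr e) lerD// h2// g2//; [exact: leq_trans (leq_maxr _ _) hm|exact: leq_trans (leq_maxr _ _) hn].
have dzv : N (dz v) = 0.
  apply/eqP; rewrite eq_le L2norm_ge0 andbT.
  apply: (@le_of_le_addM _ _ _ 2) => // e e0; rewrite add0r.
  have [n1 g1] := cv _ e0; have [e2 e20 h2] := SP_dz_small e0; have [n2 g2] := small _ e20.
  have [_ k1] := g1 _ (leq_maxl n1 n2); have k2 := h2 _ (g2 _ (leq_maxr n1 n2)).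
  pose n := maxn n1 n2.
  have -> : v = fun p => u n p - (u n p - v p) by apply/funext => p; ring.
  have Vd := V_sub (Vu n) Vv.
  rewrite (N_dz_sub (V_H1 (Vu n)) (V_H1 Vd)).
  apply: le_trans (L2norm_triangleB mO (L2_wdz (V_H1 (Vu n))) (L2_wdz (V_H1 Vd))) _.
  by rewrite mulrDl mul1r lerD.
have Vf := V_fluct Vv.
have flv : ae_eq m2 Om (fl v) (cst 0).
  apply/(L2norm_eq0 mO); first exact: V_L2.
  apply/eqP; rewrite eq_le L2norm_ge0 andbT.
  by rewrite (le_trans (poincare_wirtinger Vv))// dzv mulr0.
have dxf := N_dx_eq0 (V_H1 Vf) flv.
exists (mean v); first exact: V_W.
move=> e e0; have e2 : 0 < e / 2 by rewrite divr_gt0.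
have [e1 e10 h1] := SP_cauchy e2; have [e3 e30 h3] := SP_dz_small e0.
have [n1 g1] := small _ e10; have [n2 g2] := cv _ e2.
pose n := maxn n1 n2.
exists (Num.min e1 e3); first by rewrite lt_min e10.
move=> eps /andP[p0]; rewrite lt_min => /andP[p1 p3]; split; last by apply: h3; rewrite p0.
have Hp := V_H1 (Vphi p0); have Hv := V_H1 Vv.
have Hm := V_H1 (V_mean_lift Vv).
(* The function [v] itself is inserted: it differs from its lifted mean by [fl v], whose
   x-derivative has norm 0. *)
apply: le_trans (N_dx_triangle Hp Hv Hm) _.
rewrite [X in _ + X](_ : _ = 0) ?addr0; last exact: dxf.
apply: le_trans (N_dx_triangle Hp (V_H1 (Vu n)) Hv) _.
rewrite (splitr e) lerD//.
  by apply: h1; [rewrite p0|exact: g1 (leq_maxl _ _)].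
by have [] := g2 n (leq_maxr _ _).
Qed.

(** On a lifted function the singular term is zero, so the equation has no eps left; this is what
    survives in the limit. *)
Lemma SP_lift (eps : R) h : 0 < eps -> W h -> a1 (phi eps) (lift h) = l (lift h).
Proof.
move=> e0 Wh; have Vh := W_V Wh.
have := (hphi e0).2 _ Vh; rewrite /energy (df_sym0 df) (a0_null Vh (Vphi e0)).
  by rewrite mulr0 addr0.
exact: N_dz_lift.
Qed.

(** By the previous identity the defect equals a_1 of [phi eps - lift h] against [lift k], up to
    sign, and is bounded by the distance in x-derivative; one eps below the threshold suffices for
    each error. *)
Lemma limit_equation h k : W h -> W k -> (forall e : R, 0 < e -> exists2 eps0 : R, 0 < eps0 &
  forall eps : R, 0 < eps < eps0 ->
  N (dx (fun p => phi eps p - lift h p)) <= e /\ N (dz (phi eps)) <= e) ->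
  a1 (lift h) (lift k) = l (lift k).
Proof.
move=> Wh Wk lim; have [Vh Vk] := (W_V Wh, W_V Wk).
apply/eqP; rewrite eq_sym -subr_eq0 -normr_le0.
apply: (@le_of_le_addM _ _ _ (Mx * N (dx (lift k)))).
  by rewrite mulr_ge0 ?L2norm_ge0// (ltW (df_Mx df)).
move=> e /lim[eps0 e0 hh]; pose eps := eps0 / 2.
have e1 : 0 < eps by rewrite divr_gt0.
have [|he _] := hh eps; first by rewrite e1 /eps; lra.
rewrite add0r -(SP_lift e1 Wk) -(a1_subl (Vphi e1) Vh Vk).
apply: le_trans (df_le1 df (V_sub (Vphi e1) Vh) Vk) _.
rewrite -mulrA [X in _ * X]mulrC mulrA ler_wpM2l// mulr_ge0 ?L2norm_ge0//.
exact: (ltW (df_Mx df)).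
Qed.

Lemma limit_unique h (k : R -> R) : W h -> W k ->
  (forall j : R -> R, W j -> a1 (lift h) (lift j) = a1 (lift k) (lift j)) -> ae_eq m1 Ix h k.
Proof.
move=> Wh Wk hk; have [Vh Vk] := (W_V Wh, W_V Wk).
have Wd := W_sub Wh Wk; have Vd := W_V Wd.
have [_] : N (dx (lift (fun x => h x - k x))) = 0 /\ ae_eq m2 Om (lift (fun x => h x - k x)) (cst 0).
  apply: (a1_definite Vd).
  have := a1_subl Vh Vk Vd; rewrite hk// subrr => h0.
  by rewrite -[X in _ <= X]h0.
move=> h0; apply/(ae_eq_lift hLz (W_L2 Wh) (W_L2 Wk)).
by apply: aeS h0 => p h0 Op; apply/eqP; rewrite -subr_eq0; apply/eqP; exact: h0.
Qed.

End singular_perturbation.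

(** * The systems (S) and (AP) *)

Section fluctuation_system.
Variables (a0 a1 : (R * R -> R) -> (R * R -> R) -> R) (cx cz Mx Mz : R).
Hypothesis df : dirichlet_forms a0 a1 cx cz Mx Mz.
Variable f : R * R -> R.
Hypothesis Lf : L2 (mu2 R) (Omega Lx Lz) f.
Local Notation l := (L2prod m2 Om f).
Implicit Types k : R -> R.

(** The first equation of (S) multiplied by Lz, with a_2 and c expressed by a_1. *)
Definition mean_system u h : Prop := forall k, W k ->
  a1 (lift h) (lift k) = l (lift k) - a1 (fl u) (lift k).

(** With [fluct_rhs], the second equation of (S) once c, d and the product with the fluctuation of f
    are rewritten on the rectangle. *)
Definition fluct_lhs (eps : R) u psi : R :=
  a0 u psi + eps * a1 u psi - eps * a1 (fl u) (lift (mean psi)).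

Definition fluct_rhs (eps : R) h psi : R :=
  eps * (l psi - l (lift (mean psi))) - eps * a1 (fl psi) (lift h).

(** On a function of x the term from d removes the fluctuating part of [u], a_0 vanishes, and the
    right-hand side cancels because [lift k] equals its own lifted mean. Both mean u = 0 and P = 0
    rest on this. *)
Lemma fluct_system_lift (eps : R) u h k : V u -> W h -> W k ->
  fluct_lhs eps u (lift k) = eps * a1 (lift (mean u)) (lift k) /\
  fluct_rhs eps h (lift k) = 0.
Proof.
move=> Vu Wh Wk; have [Vk Vh] := (W_V Wk, W_V Wh).
have Vm := V_mean_lift Vu.
rewrite /fluct_lhs /fluct_rhs (mean_lift) fluct_lift//; split; last first.
  have -> : a1 (fun=> 0) (lift h) = 0.
    apply: (a1_null df (V_0) Vh).
    by apply: (N_dx_eq0 (V_H1 (V_0))); exact: ae_eq_refl.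
  by move: (l (lift k)) => x; ring.
have -> : a0 u (lift k) = 0.
  rewrite (df_sym0 df); apply: (a0_null df Vk Vu); exact: N_dz_lift.
have := a1_subl df Vu Vm Vk; rewrite -/(fl u) => ->.
by move: (a1 u (lift k)) (a1 (lift (mean u)) (lift k)) => x y; ring.
Qed.

Lemma mean_null u : V u -> a1 (lift (mean u)) (lift (mean u)) <= 0 ->
  N (dx (lift (mean u))) = 0 /\ ae_eq m1 Ix (mean u) (cst 0).
Proof.
move=> Vu h0; have [x0 h1] := a1_definite df (V_mean_lift Vu) h0.
split => //; have Lm := W_L2 (V_W Vu).
exact/(ae_eq_lift hLz Lm (L2_0 m1 mI)).
Qed.

Lemma mean_null_dx u : V u -> ae_eq m1 Ix (mean u) (cst 0) -> N (dx (lift (mean u))) = 0.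
Proof.
move=> Vu h0; apply: (N_dx_eq0 (V_H1 (V_mean_lift Vu))).
by move: h0 => /(ae_eq_lift hLz (W_L2 (V_W Vu)) (L2_0 m1 mI)).
Qed.

(** Tested with the lifted mean of [u], the equation says that a_1 of this lifted mean with itself
    is 0; coercivity and the Poincare inequality conclude. *)
Lemma fluct_system_mean (eps : R) u h : 0 < eps -> V u -> W h ->
  (forall psi, V psi -> fluct_lhs eps u psi = fluct_rhs eps h psi) ->
  ae_eq m1 Ix (mean u) (cst 0).
Proof.
move=> e0 Vu Wh hS; have Wm := V_W Vu.
have [h1 h2] := fluct_system_lift eps Vu Wh Wm.
have := hS _ (V_mean_lift Vu); rewrite h1 h2 => /eqP.
rewrite mulf_eq0 gt_eqF//= => /eqP m0.
by have [|_] := mean_null Vu; first by rewrite m0.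
Qed.

(* [fluct_lhs - fluct_rhs] is the residual of the singular perturbation
   equation at [psi], minus that of the mean equation at [mean psi]. *)
Lemma fluct_residual (eps : R) u h psi : 0 < eps -> V u -> W h -> V psi ->
  fluct_lhs eps u psi - fluct_rhs eps h psi =
  eps * (energy a0 a1 eps (fun p => u p + lift h p) psi - l psi) -
  eps * (a1 (lift h) (lift (mean psi)) - (l (lift (mean psi)) - a1 (fl u) (lift (mean psi)))).
Proof.
move=> e0 Vu Wh Vpsi; have Vh := W_V Wh; have Vm := V_mean_lift Vpsi.
rewrite /fluct_lhs /fluct_rhs /energy.
rewrite (a1_addl df Vu Vh Vpsi) (a0_addl df Vu Vh Vpsi).
rewrite (a0_null df Vh Vpsi (N_dz_lift Wh)).
have := a1_subl df Vpsi Vm Vh; rewrite -/(fl psi) => ->.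
rewrite (df_sym1 df psi) (df_sym1 df (lift (mean psi))).
move: (a0 u psi) (a1 u psi) (a1 (lift h) psi) (a1 (lift h) (lift (mean psi))) => x y z t.
move: (l psi) (l _) (a1 _ _) => p q r.
by field; rewrite gt_eqF.
Qed.

Lemma fluct_system_SP (eps : R) u h : 0 < eps -> V u -> W h -> mean_system u h ->
  (forall psi, V psi -> fluct_lhs eps u psi = fluct_rhs eps h psi) ->
  solves_SP a0 a1 f eps (fun p => u p + lift h p).
Proof.
move=> e0 Vu Wh hm hS; split; first exact: (V_add Vu (W_V Wh)).
move=> psi Vpsi; have := fluct_residual e0 Vu Wh Vpsi.
rewrite (hm _ (V_W Vpsi)) hS// !subrr mulr0 subr0 => /esym/eqP.
by rewrite mulf_eq0 gt_eqF//= subr_eq0 => /eqP.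
Qed.

(** Testing the model with functions of x gives the mean equation; the residual identity then yields
    the other one. *)
Lemma SP_fluct_system (eps : R) phi : 0 < eps -> solves_SP a0 a1 f eps phi ->
  mean_system (fl phi) (mean phi) /\
  (forall psi, V psi -> fluct_lhs eps (fl phi) psi = fluct_rhs eps (mean phi) psi).
Proof.
move=> e0 [Vphi hphi]; have Vf := V_fluct Vphi; have Vm := V_mean_lift Vphi.
have E : (fun p => fl phi p + lift (mean phi) p) = phi.
  by apply/funext => p; rewrite /fluct /lift subrK.
have Vmf := V_mean_lift Vf.
have mf : ae_eq m1 Ix (mean (fl phi)) (cst 0).
  have := meanzB hLx hLz (V_L2 Vphi) (V_L2 Vm).
  by apply: aeS => x h Ixx; rewrite [LHS]h// (mean_lift) subrr.
have hm : mean_system (fl phi) (mean phi).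
  move=> k Wk; have Vk := W_V Wk.
  have := hphi _ Vk; rewrite /energy (df_sym0 df) (a0_null df Vk Vphi (N_dz_lift Wk)) mulr0 addr0.
  (* [mean (fl phi)] vanishes only almost everywhere, so [fl (fl phi)] is not [fl phi] as a
     function; the discrepancy has zero x-derivative and is removed by [a1_null]. *)
  move=> <-; have := a1_subl df Vf Vmf Vk; rewrite -/(fl (fl phi)) => ->.
  rewrite (a1_null df Vmf Vk (mean_null_dx Vf mf)) subr0.
  have := a1_addl df Vf Vm Vk; rewrite E => ->.
  by move: (a1 _ _) (a1 _ _) => x y; ring.
split => // psi Vpsi; apply/eqP; rewrite -subr_eq0.
rewrite (fluct_residual e0 Vf (V_W Vphi) Vpsi) E hphi//.
by rewrite (hm _ (V_W Vpsi)) [l psi - _]subrr [X in _ - eps * X]subrr !mulr0 subrr.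
Qed.

End fluctuation_system.

Section systems.
Variables (Aperp Az : R * R -> R) (cperp cz Mperp Mz : R).
Hypothesis hA : hypA Lx Lz Aperp Az cperp cz Mperp Mz.
Variable f : R * R -> R.
Hypothesis Lf : L2 (mu2 R) (Omega Lx Lz) f.
Local Notation a0 := (form_a0 Lx Lz Az).
Local Notation a1 := (form_a1 Lx Lz Aperp).
Local Notation l := (L2prod m2 Om f).
Implicit Types k P Q : R -> R.

Lemma forms_dirichlet : dirichlet_forms a0 a1 cperp cz Mperp Mz.
Proof.
split.
- exact: hypA_cperp hA.
- exact: hypA_cz hA.
- exact: hypA_Mperp hA.
- exact: hypA_Mz hA.
- exact: a0_sym.
- exact: a1_sym.
- by move=> k u v w; exact: (a0_lin hA).
- by move=> k u v w; exact: (a1_lin hA).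
- exact: (a0_coercive hA).
- exact: (a1_coercive hA).
- exact: (a0_le hA).
- exact: (a1_le hA).
Qed.

Lemma mean_eqP u h : V u -> W h ->
  mean_eq Lx Lz Aperp f u h <-> mean_system a1 f u h.
Proof.
move=> Vu Wh; have z0 : Lz != 0 by rewrite gt_eqF.
have E k : W k -> Lz * (L2prod m1 Ix (mean f) k - Lz^-1 * form_c Lx Lz Aperp u k) =
    l (lift k) - a1 (fluct Lz u) (lift k).
  move=> Wk; rewrite mulrBr mulVKf// (L2prod_mean Lf (W_L2 Wk)).
  by rewrite (cE hA Vu Wk).
split=> hm k Wk.
  by rewrite -(a2E hA Wh Wk) hm// E.
apply: (mulfI z0); rewrite E//.
by rewrite (a2E hA Wh Wk) hm.
Qed.

Lemma form_aE (eps : R) u psi : V u -> V psi ->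
  form_a Lx Lz Aperp Az eps u psi = fluct_lhs a0 a1 eps u psi.
Proof. by move=> Vu Vpsi; rewrite /form_a (dE hA Vu Vpsi). Qed.

Lemma fluct_rhsE (eps : R) h psi : W h -> V psi ->
  eps * L2prod m2 Om (fluct Lz f) psi - eps * form_c Lx Lz Aperp psi h =
  fluct_rhs a1 f eps h psi.
Proof.
move=> Wh Vpsi; rewrite (cE hA Vpsi Wh).
by rewrite (L2prod_fluct Lf (V_L2 Vpsi)).
Qed.

Lemma sol_S_SP (eps : R) u h : 0 < eps -> sol_S Lx Lz Aperp Az f eps u h ->
  solves_SP a0 a1 f eps (fun p => u p + h p.1) /\ ae_eq m1 Ix (mean u) (cst 0).
Proof.
move=> e0 [Vu Wh /(mean_eqP Vu Wh) hm hS].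
have hS' psi : V psi -> fluct_lhs a0 a1 eps u psi = fluct_rhs a1 f eps h psi.
  move=> Vpsi; apply: (etrans (esym (form_aE eps Vu Vpsi))).
  by apply: (etrans (hS psi Vpsi)); exact: fluct_rhsE.
split; first exact: (fluct_system_SP forms_dirichlet e0 Vu Wh hm hS').
exact: (fluct_system_mean forms_dirichlet e0 Vu Wh hS').
Qed.

Lemma SP_sol_S (eps : R) phi : 0 < eps -> solves_SP a0 a1 f eps phi ->
  sol_S Lx Lz Aperp Az f eps (fluct Lz phi) (mean phi).
Proof.
move=> e0 hphi; have [hm hS] := SP_fluct_system forms_dirichlet e0 hphi.
have [Vf Wm] := (V_fluct hphi.1, V_W hphi.1).
split => //; first exact/(mean_eqP Vf Wm).
move=> psi Vpsi; apply: (etrans (form_aE eps Vf Vpsi)); apply: (etrans (hS psi Vpsi)).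
exact: (esym (fluct_rhsE eps Wm Vpsi)).
Qed.

(** The sum u + h is determined by uniqueness for the model. Since [u] has zero mean, averaging the
    sum recovers [h], and subtracting recovers [u]. *)
Lemma sol_S_unique (eps : R) u h phi : 0 < eps -> sol_S Lx Lz Aperp Az f eps u h ->
  solves_SP a0 a1 f eps phi ->
  ae_eq m2 Om u (fluct Lz phi) /\ ae_eq m1 Ix h (mean phi).
Proof.
move=> e0 hS hphi; have [hSP mu0] := sol_S_SP e0 hS; have [Vu Wh _ _] := hS.
have eq_phi := SP_unique forms_dirichlet e0 hSP hphi.
have Lh := lift_L2 (W_L2 Wh).
have Lm := W_L2 (V_W hphi.1).
have h_mean : ae_eq m1 Ix h (mean phi).
  have := ae_eq_meanz hLx hLz (V_L2 hSP.1) (V_L2 hphi.1) eq_phi.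
  have := meanz_lin hLx hLz 1 (V_L2 Vu) Lh.
  rewrite -(addE u (lift h)) (mean_lift) => h1 h2.
  apply: filterS3 h1 h2 mu0 => x e1 e2 e3 Ixx.
  by rewrite -e2// e1// e3// mulr0 add0r.
split => //; have := h_mean => /(ae_eq_lift hLz (W_L2 Wh) Lm).
apply: aeS2 eq_phi => p e1 e2 Op.
by rewrite /fluct -(e1 Op) -(e2 Op) addrK.
Qed.

Lemma form_b_mean P u : W P -> V u -> ae_eq m1 Ix (mean u) (cst 0) -> form_b Lx Lz P u = 0.
Proof.
move=> WP Vu u0; have LP := W_L2 WP; have Lm := W_L2 (V_W Vu).
rewrite (bE LP (V_L2 Vu)) (L2prod_meanz hLz LP (V_L2 Vu)).
rewrite (ae_eq_L2prodr mI Lm (L2_0 m1 mI) LP u0).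
by rewrite /L2prod; under eq_Rintegral do rewrite mulr0; rewrite Rintegral_cst// mul0r mulr0.
Qed.

(** The mean of [u] belongs to W, so it is an admissible Q, and the constraint says that its norm is
    0. Tested with the lift of P, the second equation then reduces to the vanishing of the squared
    norm of that lift. *)
Lemma sol_AP_multiplier (eps : R) u h P : 0 < eps -> sol_AP Lx Lz Aperp Az f eps u h P ->
  ae_eq m1 Ix P (cst 0).
Proof.
move=> e0 [[Vu Wh WP] hm hS hb]; have Wm := V_W Vu; have Lm := W_L2 Wm.
have VP := W_V WP; have LP := W_L2 WP.
have u0 : ae_eq m1 Ix (mean u) (cst 0).
  have := hb _ Wm; rewrite (bE Lm (V_L2 Vu)) (L2prod_meanz hLz Lm (V_L2 Vu)) => /eqP.
  rewrite mulf_eq0 gt_eqF//= -(L2norm_sqr Lm) sqrf_eq0 => /eqP.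
  by move=> /(L2norm_eq0 mI Lm).
have := hS _ VP; rewrite (form_aE eps Vu VP) (fluct_rhsE eps Wh VP).
have [-> ->] := fluct_system_lift forms_dirichlet f eps Vu Wh WP.
have Vmu := V_mean_lift Vu.
rewrite (a1_null forms_dirichlet Vmu VP (mean_null_dx Vu u0)) mulr0 add0r.
rewrite (bE LP (V_L2 VP)) -(L2norm_sqr (V_L2 VP)) => /eqP; rewrite sqrf_eq0 => /eqP.
move=> /(L2norm_eq0 mO (V_L2 VP)) P0.
exact/(ae_eq_lift hLz LP (L2_0 m1 mI)).
Qed.

Lemma sol_S_AP (eps : R) u h : 0 < eps ->
  sol_S Lx Lz Aperp Az f eps u h <-> exists P, sol_AP Lx Lz Aperp Az f eps u h P.
Proof.
move=> e0; split=> [hS|[P hAP]].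
- have [_ u0] := sol_S_SP e0 hS; have [Vu Wh hm hS'] := hS.
  have W0 := W_0.
  exists (fun=> 0); split => //.
  + move=> psi Vpsi; rewrite hS'//; rewrite [X in _ + X = _](_ : _ = 0) ?addr0//.
    by rewrite /form_b; under eq_Rintegral do rewrite mul0r; rewrite Rintegral_cst// mul0r.
  + by move=> Q WQ; exact: form_b_mean.
- have P0 := sol_AP_multiplier e0 hAP.
  have [[Vu Wh WP] hm hS hb] := hAP; split => // psi Vpsi.
  rewrite -hS// [X in _ = _ + X](_ : _ = 0) ?addr0//.
  have LP := W_L2 WP.
  rewrite (bE LP (V_L2 Vpsi)) (L2prod_meanz hLz LP (V_L2 Vpsi)).
  rewrite (ae_eq_L2prod mI LP (L2_0 m1 mI) (W_L2 (V_W Vpsi)) P0).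
  by rewrite /L2prod; under eq_Rintegral do rewrite mul0r; rewrite Rintegral_cst// mul0r mulr0.
Qed.

End systems.

(** * Uniform bounds and convergence of the two components *)

Section conclusion.
Variables (a0 a1 : (R * R -> R) -> (R * R -> R) -> R) (cx cz Mx Mz : R).
Hypothesis df : dirichlet_forms a0 a1 cx cz Mx Mz.
Implicit Types (f : R * R -> R) (k : R -> R).

Lemma uniform_bound : exists2 C : R, 0 < C & forall f eps phi, L2 m2 Om f -> 0 < eps < 1 ->
  solves_SP a0 a1 f eps phi ->
  [/\ H1norm2 Lx Lz phi <= C * N f, H1norm2 Lx Lz (fl phi) <= C * N f
    & H1norm1 Lx (mean phi) <= C * N f].
Proof.
have [cx0 cz0] := (df_cx df, df_cz df).
(* [al] bounds the x-derivative, [be] the z-derivative (this is where eps < 1 enters), and 2 Lx al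
   the function itself by Poincare. Averaging costs the factor s = 1 / sqrt Lz, and 1 + s serves all
   three estimates. *)
pose al := 2 * Lx / cx; have al0 : 0 < al by rewrite divr_gt0 ?mulr_gt0.
pose be := Num.sqrt ((2 * Lx) ^+ 2 / (cx * cz)).
have be0 : 0 <= be by exact: sqrtr_ge0.
pose C0 := 2 * Lx * al + al + be.
have C00 : 0 < C0 by rewrite ltr_wpDr// addr_gt0// mulr_gt0// mulr_gt0.
pose s := (Num.sqrt Lz)^-1; have s0 : 0 < s by rewrite invr_gt0 sqrtr_gt0.
exists ((1 + s) * C0); first by rewrite mulr_gt0// addr_gt0.
move=> f eps phi Lf /andP[e0 e1] hphi; have Vphi := hphi.1.
have F0 := L2norm_ge0 m2 Om f.
have [bx bz] := SP_bound df Lf e0 hphi.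
have hx : N (dx phi) <= al * N f by rewrite (le_trans bx)// /al mulrAC.
have hz : N (dz phi) <= be * N f.
  rewrite -ler_sqr ?nnegrE ?mulr_ge0 ?L2norm_ge0// exprMn sqr_sqrtr; last first.
    by rewrite divr_ge0 ?sqr_ge0// ltW// mulr_gt0.
  rewrite -(ler_pM2l cz0); apply: le_trans bz _.
  apply: (@le_trans _ _ ((2 * Lx * N f) ^+ 2 / cx)).
    by rewrite ler_piMl ?(ltW e1)// divr_ge0 ?sqr_ge0// ltW.
  rewrite le_eqVlt; apply/orP; left; apply/eqP; rewrite exprMn.
  by move: (N f) => F; field; rewrite !gt_eqF.
have hn : N phi <= 2 * Lx * al * N f.
  apply: le_trans (poincare Vphi) _.
  by rewrite -[leRHS]mulrA ler_wpM2l// mulr_ge0// ltW.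
have E : C0 * N f = 2 * Lx * al * N f + al * N f + be * N f by rewrite !mulrDl.
have C0F : 0 <= C0 * N f by rewrite mulr_ge0// ltW.
have le_C : C0 * N f <= (1 + s) * C0 * N f.
  rewrite -[leRHS]mulrA; move: (C0 * N f) C0F => x x0; rewrite [leRHS]mulrDl mul1r lerDl.
  by rewrite mulr_ge0// ltW.
have Vf := V_fluct Vphi.
split.
- apply: le_trans (H1norm2_le _) (le_trans _ le_C).
  by rewrite E !lerD.
- apply: le_trans (H1norm2_le _) (le_trans _ le_C).
  rewrite E (N_dz_fluct Vphi) !lerD//.
    exact: le_trans (N_fluct (V_L2 Vphi)) hn.
  exact: le_trans (N_dx_fluct Vphi) hx.
- have V0 := V_0.
  have := H1norm1_mean_sub Vphi V0.
  rewrite (_ : (fun x => _) = mean phi); last first.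
    by apply/funext => x; rewrite /meanz Rintegral_cst// mul0r mulr0 subr0.
  rewrite (_ : (fun p : R * R => phi p - 0) = phi); last by apply/funext => p; rewrite subr0.
  move=> h1; apply: le_trans h1 _; rewrite -/s.
  apply: (@le_trans _ _ (s * (C0 * N f))); last first.
    rewrite -[leRHS]mulrA; move: (C0 * N f) C0F => x x0; rewrite [leRHS]mulrDl mul1r.
    by rewrite lerDr.
  by rewrite ler_wpM2l ?(ltW s0)// E ler_wpDr ?lerD// mulr_ge0.
Qed.

Variables (phi : R -> R * R -> R) (h : R -> R).
Hypothesis Vphi : forall eps : R, 0 < eps -> V (phi eps).
Hypothesis Wh : W h.
Hypothesis lim : forall e : R, 0 < e -> exists2 eps0 : R, 0 < eps0 &
  forall eps : R, 0 < eps < eps0 ->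
  N (dx (fun p => phi eps p - lift h p)) <= e /\ N (dz (phi eps)) <= e.

(** The function costs 2 Lz times the z-derivative, and each derivative costs 1, hence the
    denominator 2 Lz + 1 + 1. The subtraction of 0 prepares the limit of the fluctuating
    component. *)
Lemma fluct_small (e : R) : 0 < e -> exists2 eps0 : R, 0 < eps0 &
  forall eps : R, 0 < eps < eps0 ->
  H1norm2 Lx Lz (fun p => fl (phi eps) p - 0) <= e.
Proof.
move=> e0; have K0 : 0 < 2 * Lz + 1 + 1 by rewrite !addr_gt0// mulr_gt0.
have [eps0 p0 he] := lim (divr_gt0 e0 K0); exists eps0 => // eps heps.
have [h1 h2] := he _ heps; have /andP[p1 _] := heps; have Vp := Vphi p1.
rewrite (_ : (fun p => _) = fl (phi eps)); last by apply/funext => p; rewrite subr0.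
apply: le_trans (H1norm2_le _) _; rewrite (N_dz_fluct Vp).
have -> : e = 2 * Lz * (e / (2 * Lz + 1 + 1)) + e / (2 * Lz + 1 + 1) + e / (2 * Lz + 1 + 1).
  by rewrite -[X in _ = _ + X + _]mul1r -[X in _ = _ + X]mul1r -!mulrDl mulrC divfK// gt_eqF.
rewrite !lerD//.
  apply: le_trans (poincare_wirtinger Vp) _.
  by rewrite ler_wpM2l// mulr_ge0// ltW.
exact: le_trans (N_dx_fluct_le Vp Wh) h1.
Qed.

(** Since [h] is the mean of its lift, the difference is one of means, controlled through the
    Poincare inequality by the x-derivative; this gives [K]. *)
Lemma mean_small (e : R) : 0 < e -> exists2 eps0 : R, 0 < eps0 &
  forall eps : R, 0 < eps < eps0 ->
  H1norm1 Lx (fun x => mean (phi eps) x - h x) <= e.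
Proof.
move=> e0; pose K := (Num.sqrt Lz)^-1 * (2 * Lx + 1).
have K0 : 0 < K by rewrite mulr_gt0 ?invr_gt0 ?sqrtr_gt0// addr_gt0// mulr_gt0.
have [eps0 p0 he] := lim (divr_gt0 e0 K0); exists eps0 => // eps heps.
have [h1 _] := he _ heps; have /andP[p1 _] := heps; have Vp := Vphi p1.
have Vh := W_V Wh.
have := H1norm1_mean_sub Vp Vh; rewrite (mean_lift) => h2; apply: le_trans h2 _.
have -> : e = (Num.sqrt Lz)^-1 * (2 * Lx * (e / K) + e / K).
  rewrite (_ : 2 * Lx * (e / K) + e / K = (2 * Lx + 1) * (e / K)).
    by rewrite [RHS]mulrA -/K [RHS]mulrC divfK// gt_eqF.
  by rewrite [RHS]mulrDl mul1r.
rewrite ler_wpM2l ?invr_ge0 ?sqrtr_ge0// lerD//.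
apply: le_trans (poincare (V_sub Vp Vh)) _.
by rewrite ler_wpM2l// mulr_ge0// ltW.
Qed.

End conclusion.

End rectangle.

Theorem theorem2p4 (R : realType) (Lx Lz : R) (hLx : 0 < Lx) (hLz : 0 < Lz)
  (Aperp Az : R * R -> R) (cperp cz Mperp Mz : R)
  (hA : hypA Lx Lz Aperp Az cperp cz Mperp Mz) :
  exists C : R, 0 < C /\
  forall f : R * R -> R, L2 (mu2 R) (Omega Lx Lz) f ->
  exists (phi' : R -> R * R -> R) (phib : R -> R -> R),
  [/\
    forall eps : R, 0 < eps ->
      [/\ sol_S Lx Lz Aperp Az f eps (phi' eps) (phib eps),
          forall u v, sol_S Lx Lz Aperp Az f eps u v ->
            ae_eq (mu2 R) (Omega Lx Lz) u (phi' eps) /\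
            ae_eq (mu1 R) (Itv Lx) v (phib eps),
          sol_SP Lx Lz Aperp Az f eps (fun p => phi' eps p + phib eps p.1),
          forall w, sol_SP Lx Lz Aperp Az f eps w ->
            ae_eq (mu2 R) (Omega Lx Lz) w (fun p => phi' eps p + phib eps p.1)
        & ae_eq (mu1 R) (Itv Lx) (meanz Lz (phi' eps)) (cst 0)],
    forall eps : R, 0 < eps ->
      (forall u v, sol_S Lx Lz Aperp Az f eps u v <->
         exists P, sol_AP Lx Lz Aperp Az f eps u v P) /\
      (forall u v P, sol_AP Lx Lz Aperp Az f eps u v P ->
         ae_eq (mu1 R) (Itv Lx) P (cst 0)),
    forall eps : R, 0 < eps < 1 ->
      [/\ H1norm2 Lx Lz (fun p => phi' eps p + phib eps p.1)
            <= C * L2norm (mu2 R) (Omega Lx Lz) f,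
          H1norm2 Lx Lz (phi' eps) <= C * L2norm (mu2 R) (Omega Lx Lz) f
        & H1norm1 Lx (phib eps) <= C * L2norm (mu2 R) (Omega Lx Lz) f]
  & exists (phi'0 : R * R -> R) (phib0 : R -> R),
      [/\ spaceV Lx Lz phi'0 /\ spaceW Lx phib0,
          weak_cvg0 (H1_2 Lx Lz) (H1norm2 Lx Lz) phi' phi'0 /\
          weak_cvg0 (H1_1 Lx) (H1norm1 Lx) phib phib0,
          [/\ L2norm (mu2 R) (Omega Lx Lz) (fun p => phi' eps p - phi'0 p)
                @[eps --> 0^'+] --> (0 : R),
              L2norm (mu2 R) (Omega Lx Lz)
                (fun p => wdz Lx Lz (phi' eps) p - wdz Lx Lz phi'0 p)
                @[eps --> 0^'+] --> (0 : R)
            & L2norm (mu1 R) (Itv Lx) (fun x => phib eps x - phib0 x)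
                @[eps --> 0^'+] --> (0 : R)],
          ae_eq (mu2 R) (Omega Lx Lz) phi'0 (cst 0)
        & sol_lim Lx Lz Aperp f phib0 /\
          forall v, sol_lim Lx Lz Aperp f v ->
            ae_eq (mu1 R) (Itv Lx) v phib0]].
Proof.
have df := forms_dirichlet hLx hLz hA.
have [C C0 hC] := uniform_bound hLx hLz df.
exists C; split => // f Lf.
(* Nothing is asked for eps <= 0, where the zero function is taken so that [phi] is defined for
   every real parameter. *)
have /choice[phi hphi] : forall eps : R, exists phi : R * R -> R, 0 < eps ->
    solves_SP Lx Lz (form_a0 Lx Lz Az) (form_a1 Lx Lz Aperp) f eps phi.
  move=> eps; have [e0|_] := ltP 0 eps; last by exists (fun=> 0).
  by have [phi] := SP_exists hLx hLz df Lf e0; exists phi.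
have Vphi eps : 0 < eps -> spaceV Lx Lz (phi eps) by move=> /hphi[].
have [h Wh lim] := SP_limit hLx hLz df Lf hphi.
have sum_phi eps : (fun p => fluct Lz (phi eps) p + meanz Lz (phi eps) p.1) = phi eps.
  by apply/funext => p; rewrite /fluct subrK.
exists (fun eps => fluct Lz (phi eps)), (fun eps => meanz Lz (phi eps)); split.
- move=> eps e0; have hS := SP_sol_S hLx hLz hA Lf e0 (hphi _ e0).
  rewrite sum_phi; split.
  + exact: hS.
  + by move=> u v huv; exact: (sol_S_unique hLx hLz hA Lf e0 huv (hphi _ e0)).
  + exact: hphi.
  + by move=> w hw; exact: (SP_unique hLx hLz df e0 hw (hphi _ e0)).
  + by have [] := sol_S_SP hLx hLz hA Lf e0 hS.
- move=> eps e0; split.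
  + by move=> u v; exact: (sol_S_AP hLx hLz hA Lf u v e0).
  + by move=> u v P; exact: (sol_AP_multiplier hLx hLz hA Lf e0).
- move=> eps e01; rewrite sum_phi; have /andP[e0 _] := e01.
  exact: hC Lf e01 (hphi _ e0).
have V0 := V_0 hLx hLz.
have fl_small := fluct_small hLx hLz Vphi Wh lim.
have m_small := mean_small hLx hLz Vphi Wh lim.
have lim_eq k : spaceW Lx k -> form_a1 Lx Lz Aperp (lift h) (lift k) =
    L2prod (mu2 R) (Omega Lx Lz) f (lift k).
  by move=> Wk; apply: (limit_equation hLx hLz df hphi Wh Wk lim).
have z0 : Lz != 0 by rewrite gt_eqF.
exists (fun=> 0), h; split.
- by split.
- split.
  + apply: (weak_cvg0_strong _ _ (V_H1 V0) _ fl_small).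
    * by move=> v; exact: sqrtr_ge0.
    * by move=> eps e0; apply: V_H1; apply: (V_fluct hLx hLz); exact: Vphi.
    * by move=> v w; exact: (H1_sub hLx hLz).
  + apply: (weak_cvg0_strong _ _ (W_H11 Wh) _ m_small).
    * by move=> v; exact: sqrtr_ge0.
    * by move=> eps e0; apply: W_H11; apply: (V_W hLx hLz); exact: Vphi.
    * by move=> v w; exact: H11_sub.
- split; apply: cvg_at_right0 => e e0.
  + have [eps0 p0 he] := fl_small _ e0; exists eps0 => // eps /he.
    rewrite ger0_norm ?L2norm_ge0//; apply: le_trans.
    by have [] := H1norm2_ge Lx Lz (fun p => fluct Lz (phi eps) p - 0).
  + have [eps0 p0 he] := fl_small _ e0; exists eps0 => // eps heps.
    have /andP[eps_gt0 _] := heps; have := he _ heps.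
    rewrite ger0_norm ?L2norm_ge0//; apply: le_trans.
    have Vf := V_fluct hLx hLz (Vphi _ eps_gt0).
    (* The derivative selected for the zero function is zero only almost everywhere, so the
       difference of derivatives is read as the derivative of a difference. *)
    rewrite weak_dzE -(N_dz_sub hLx hLz (V_H1 Vf) (V_H1 V0)).
    by have [] := H1norm2_ge Lx Lz (fun p => fluct Lz (phi eps) p - 0).
  + have [eps0 p0 he] := m_small _ e0; exists eps0 => // eps /he.
    rewrite ger0_norm ?L2norm_ge0//; apply: le_trans.
    by have [] := H1norm1_ge Lx (fun x => meanz Lz (phi eps) x - h x).
- exact: ae_eq_refl.
- split.
  + split => // k Wk; apply: (mulfI z0).
    by rewrite (a2E hLx hLz hA Wh Wk) (L2prod_mean hLz Lf (W_L2 Wk)) lim_eq.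
  + move=> v [Wv hv]; apply: (limit_unique hLx hLz df Wv Wh) => k Wk.
    by rewrite -(a2E hLx hLz hA Wv Wk) (hv _ Wk) (L2prod_mean hLz Lf (W_L2 Wk)) lim_eq.
Qed.
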